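(* Let $\varepsilon>0$, $\mu\in[0,1]$. For $\sigma,\tau\in\mathcal T_0$, $$B\big(\tilde\Pi^R_{\varepsilon,\mu}\sigma,\tilde\Pi^R_{\varepsilon,\mu}\tau\big)[\phi,\tilde\phi]=\sum_{a\in\mathbb N^{d+1}}\tilde\Pi^R_{\varepsilon,\mu}(\sigma\curvearrowright_a\tau)[\phi,\tilde\phi].$$ In the particular case where $\tau\in\mathcal T_0^*$, i.e. one can graft everywhere on $\tau$, this gives $$B\big(\Pi^R_{\varepsilon,\mu}\sigma,\Pi^R_{\varepsilon,\mu}\tau\big)[\phi]=\sum_{a\in\mathbb N^{d+1}}\Pi^R_{\varepsilon,\mu}(\sigma\curvearrowright_a\tau)[\phi].$$
   Context: **Trees.** Fix $d\ge1$; $0\in\mathbb N$. A decorated tree is a finite non-planar rooted tree. Each node carries a decoration $X^kY^{\mathfrak v}$, $k\in\mathbb N^{d+1}$, $\mathfrak v\in\{0,1\}$ ($X^0=\mathbf 1$). Each edge is of one of the types $\mathcal I_a$, $\mathcal I'_a$, grey $\bar{\mathcal I}_a$ ($a\in\mathbb N^{d+1}$), noise $\Xi$, grey noise $\bar\Xi$. At most one noise-type edge leaves a node; grey edges $\bar{\mathcal I}_a$ are terminal with top node decorated by some $X^k$, written $\bar{\mathcal I}_a(X^k)$. The product of trees identifies the roots and adds their decorations. $\mathcal I_a(\tau)$ (resp. $\mathcal I_a'(\tau)$) attaches the root of $\tau$ to a new root by an edge of that type. Put $\zeta_0=\mathbf 1$, $\zeta_1=\Xi$. A tree is $\zeta_lX^kY^{\mathfrak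 v}\prod_i\mathcal I_{a_i}(\tau_i)\prod_j\mathcal I'_{b_j}(\tau'_j)\prod_q\bar{\mathcal I}_{c_q}(X^{k_q})$ (empty products allowed), possibly with a factor $\bar\Xi$. Standing convention: $\mathcal I_a(Y^{\mathfrak v})=\mathcal I'_a(Y^{\mathfrak v})=0$, and $\mathcal I_a(\tau)=\mathcal I'_a(\tau)=0$ if $\tau$ is composed only of grey symbols or contains at least one $\bar\Xi$. $T_0$: trees with only $\mathcal I$ and $\Xi$ edges and no polynomials. $T_0^*$: trees of $T_0$ with $\mathfrak v=1$ at all nodes. $T_1$: as $T_0$ with at most one $\mathcal I'$ edge. $T_0^X$: as $T_0$ with polynomial decorations. A superscript $\mathfrak g$ allows grey decorations. $\mathcal T$ with the same indices denotes the linear span. Infinite sums over multi-indices are formal (in practice finite). **Degree.** Parabolic scaling $|k|_{\mathfrak s}=2k_1+\sum_{i\ge2}k_i$; fixed $\alpha\in(0,1]$, small $\kappa>0$. $\deg\Xi=-2+\alpha-\kappa$, $\deg X^k=|k|_{\mathfrak s}$, $\deg(\sigma\tau)=\deg\sigma+\deg\tau$, $\deg\mathcal I_a(\tau)=\deg\tau+2-|a|_{\mathfrak s}$, $\deg\mathcal I'_a(\tau)=\deg\mathcal I_a(\tau)-1$, grey edges have degree $0$. **Grafting.** Bilinearly, $\sigma\curvearrowright_a\big(\zeta_lY^1\prod_{i=1}^n\mathcal I_{a_i}(\tau_i)\big)=\mathcal I'_a(\sigma)\,\zeta_lY^0\prod_{i}\mathcal I_{a_i}(\tau_i)+\zeta_lY^1\sum_i\mathcal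 I_{a_i}(\sigma\curvearrowright_a\tau_i)\prod_{j\neq i}\mathcal I_{a_j}(\tau_j)$ and $\sigma\curvearrowright_a\big(\zeta_lY^0\prod_{i=1}^n\mathcal I_{a_i}(\tau_i)\big)=\zeta_lY^0\sum_i\mathcal I_{a_i}(\sigma\curvearrowright_a\tau_i)\prod_{j\neq i}\mathcal I_{a_j}(\tau_j)$. So $\sigma$ is attached by an edge $\mathcal I'_a$ successively to each node with $\mathfrak v=1$, the mark of the node on which one grafts being reset to $0$. **Root extraction.** $\Delta_r:\mathcal T_1\to\mathcal T_0^{\mathfrak g}\otimes\mathcal T_1$ is multiplicative with $\Delta_rY^{\mathfrak v}=Y^{\mathfrak v}\otimes\mathbf 1$, $\Delta_r\Xi=\bar\Xi\otimes\Xi+\Xi\otimes\mathbf 1$, $\Delta_r\mathcal I_a(\tau)=(\mathcal I_a\otimes\mathrm{id})\Delta_r\tau+\sum_k\frac1{k!}\bar{\mathcal I}_a(X^k)\otimes\mathcal I_{a+k}(\tau)$, $\Delta_r\mathcal I'_a(\tau)=\sum_k\frac1{k!}\bar{\mathcal I}_a(X^k)\otimes\mathcal I'_{a+k}(\tau)$, sums over $k\in\mathbb N^{d+1}$. **Localisation.** $M_{\rm loc}\big(\zeta_lY^{\mathfrak v}\prod_i\mathcal I_{a_i}(\tau_i)\big)=\sum_{k\in\mathbb N^{d+1}}\frac{X^k}{k!}\zeta_lY^{\mathfrak v}\prod_i\mathcal I_{a_i}(M_{\rm loc}\tau_i)$; factors $\bar\Xi$ and $\bar{\mathcal I}_b(X^j)$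 are left untouched. **Elementary differentials.** Let $\Upsilon^0=g$, $\Upsilon^1=f$ be the smooth nonlinearities of the subcritical equation $(\partial_t-\Delta)\psi=g(\psi,\dots,\nabla^q\psi)+f(\psi,\dots,\nabla^p\psi)\xi$ ($p,q<2$), seen as functions of variables $Z=(Z_a)_{a\in\mathbb N^{d+1}}$ representing $\partial^a\phi$; let $\tilde Z_a$ represent $\partial^a\tilde\phi$. $D_a=\partial_{Z_a}$, $\tilde D_a=\partial_{\tilde Z_a}$; $\partial^{e_i}=\sum_aZ_{a+e_i}D_a$ ($e_i$ the canonical basis of $\mathbb N^{d+1}$), $\partial^k=\prod_i(\partial^{e_i})^{k_i}$, and $\tilde\partial^k$ similarly. $\tilde\Upsilon[\zeta_lY^{\mathfrak v}]=\mathfrak v\Upsilon^l(Z)+(1-\mathfrak v)\Upsilon^l(\tilde Z)$. For $\tau=X^kY^{\mathfrak v}\zeta_l\prod_{i=1}^n\mathcal I_{a_i}(\tau_i)\prod_{j=1}^m\bar{\mathcal I}_{b_j}(X^{k_j})$: if $\mathfrak v=1$, $\tilde\Upsilon[\tau]=(\partial^kD_{a_1}\cdots D_{a_n}D_{b_1}\cdots D_{b_m}\tilde\Upsilon[\zeta_lY^1])\prod_i\tilde\Upsilon[\tau_i]$; if $\mathfrak v=0$, the same with $\tilde\partial,\tilde D$ and $\tilde\Upsilon[\zeta_lY^0]$ at the root. If $\bar\Xi$ is present at a node, $\Upsilon^1$ is used there. The map $\downarrow$ removes $\bar\Xi$, and removes each $\bar{\mathcal I}_b(X^j)$ while multiplying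 its base node by $X^j$. $\ell:\mathcal T_0^X\to\mathbb R$ is a character, independent of $\mathfrak v$, with $\ell(\mathbf 1)=1$ and vanishing on all other trees of non-negative degree. $\ell\tilde\Upsilon[\tau]:=\ell(\downarrow\tau)\tilde\Upsilon[\tau]$. **Evaluation.** $G$ is the Green kernel of $\partial_t-\Delta$ on $[0,1]\times\mathbb T^d$, $G_\mu(t,x)=\chi(t/\mu^2)G(t,x)$, $G_0=G$, with $\chi$ smooth non-decreasing, $\chi=0$ on $[0,1]$, $\chi=1$ on $[2,\infty)$; $\dot G_\mu=\partial_\mu G_\mu$; $\xi_\varepsilon$ is a mollified noise. The following are functionals of $(\phi,\tilde\phi)$. $\Pi^{R\times}_{\varepsilon,\mu}\mathbf 1=1$, $\Pi^{R\times}_{\varepsilon,\mu}\Xi=\xi_\varepsilon$, $\Pi^{R\times}_{\varepsilon,\mu}$ is multiplicative, $\Pi^{R\times}_{\varepsilon,\mu}\mathcal I_a(\tau)=\partial^a(G-G_\mu)*\tilde\Pi^R_{\varepsilon,\mu}\tau$, $\Pi^{R\times}_{\varepsilon,\mu}\mathcal I'_a(\tau)=-\partial^a\dot G_\mu*\tilde\Pi^R_{\varepsilon,\mu}\tau$, and $\tilde\Pi^R_{\varepsilon,\mu}\tau=(\ell\tilde\Upsilon\otimes\Pi^{R\times}_{\varepsilon,\mu})(M_{\rm loc}\otimes\mathrm{id})\Delta_r\tau$. Finally $(\Pi^R_{\varepsilon,\mu}\tau)[\phi]=(\tilde\Pi^R_{\varepsilon,\mu}\tau)[\phi,\phi]$.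 **The operator $B$.** For $a\in\mathbb N^{d+1}$, $B_a(X,Y)[\phi,\tilde\phi]=(D_{\partial^a\phi}Y[\phi,\tilde\phi])\cdot(-\partial^a\dot G_\mu)*X[\phi,\tilde\phi]$, where $D_{\partial^a\phi}$ is the Fréchet derivative with respect to $\partial^a\phi$ only. $B=\sum_{a\in\mathbb N^{d+1}}B_a$ (in fact a finite sum), so that $B(X,Y)[\phi,\tilde\phi]=(DY[\phi,\tilde\phi])\cdot(-\dot G_\mu)*X[\phi,\tilde\phi]$ with $D$ the Fréchet derivative in $\phi$. Finally $B(X,Y)[\phi]=B(X,Y)[\phi,\phi]$ (a functional of $\phi$ alone being viewed as a functional of $(\phi,\tilde\phi)$).
   Formalization: The first identity is stated at φ̃ = φ (it fails for φ̃ ≠ φ, e.g. σ = τ = ΞY¹ with f′ non-constant), and in both identities σ contains no bare node Y^v (there I′_a(Y^v) = 0 makes the right side vanish while the left side does not in general). *)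

(* Defs.v *)
From HB Require Import structures.
From mathcomp Require Import all_boot all_order all_algebra.
From mathcomp Require Import all_classical all_reals all_analysis.

Set Implicit Arguments.
Unset Strict Implicit.
Unset Printing Implicit Defensive.

Import Order.TTheory GRing.Theory Num.Theory.
Import numFieldNormedType.Exports.

Local Open Scope classical_set_scope.
Local Open Scope ring_scope.

(** * Multi-indices

    Coordinate [ord0] is time, the coordinates [lift ord0 j] are space. *)

Notation mindex d := {ffun 'I_d.+1 -> nat}.

Definition unit_index d (i : 'I_d.+1) : mindex d := [ffun j => nat_of_bool (j == i)].

Definition sdeg d (k : mindex d) : nat :=
  (2 * k ord0 + \sum_(j < d) k (lift ord0 j))%N.

Definition mfact d (k : mindex d) : nat := (\prod_(i < d.+1) (k i)`!)%N.

(** * Decorated trees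

    [Node l k v ch gr] is the tree whose root carries the noise-type edge [l]
    (if any), the decoration [X^k Y^v], the planted trees [ch] and the grey
    edges [gr].  An element [(b, a, t)] of [ch] is [I_a(t)] if [b = false] and
    [I'_a(t)] if [b = true]; an element [(a, k)] of [gr] is the grey edge
    [Ibar_a(X^k)].

    Trees are given by planar representatives: non-planar trees are the classes
    of the equivalence relation generated by [reorder] below.  All the maps on
    trees defined in this file are compatible with it. *)

Inductive noise_edge := NoNoise | Noise | GreyNoise.

Inductive tree (d : nat) : Type :=
  Node of noise_edge & mindex d & bool & seq (bool * mindex d * tree d)
    & seq (mindex d * mindex d).

Inductive reorder d : tree d -> tree d -> Prop :=
| reorder_edges l k v c1 x y c2 gr :
    reorder (Node l k v (c1 ++ x :: y :: c2) gr)
            (Node l k v (c1 ++ y :: x :: c2) gr)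
| reorder_grey l k v ch gr gr' :
    perm_eq gr gr' -> reorder (Node l k v ch gr) (Node l k v ch gr')
| reorder_child l k v c1 e t t' c2 gr :
    reorder t t' ->
    reorder (Node l k v (c1 ++ (e, t) :: c2) gr)
            (Node l k v (c1 ++ (e, t') :: c2) gr).

Definition is_noise (l : noise_edge) := if l is Noise then true else false.
Definition is_grey_noise (l : noise_edge) := if l is GreyNoise then true else false.

(** The bare node [Y^v]. *)
Definition bare d (v : bool) : tree d := Node NoNoise 0 v [::] [::].

Definition is_bare d (t : tree d) : bool :=
  let: Node l k v ch gr := t in
  [&& ~~ is_noise l, ~~ is_grey_noise l, k == 0, nilp ch & nilp gr].

(** Only grey symbols, including the case of [Y^v]. *)
Definition grey_only d (t : tree d) : bool :=
  let: Node l k v ch gr := t in [&& ~~ is_noise l, k == 0 & nilp ch].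

Fixpoint has_grey_noise d (t : tree d) : bool :=
  let: Node l k v ch gr := t in
  is_grey_noise l || has (fun c => has_grey_noise c.2) ch.

(** The trees [t] for which [I_a(t) = I'_a(t) = 0] by convention. *)
Definition null_planted d (t : tree d) : bool := grey_only t || has_grey_noise t.

Fixpoint height d (t : tree d) : nat :=
  let: Node l k v ch gr := t in (foldr (fun c n => maxn (height c.2) n) 0 ch).+1.

Fixpoint in_T0X d (t : tree d) : bool :=
  let: Node l k v ch gr := t in
  [&& ~~ is_grey_noise l, nilp gr &
      all (fun c => [&& ~~ c.1.1, ~~ null_planted c.2 & in_T0X c.2]) ch].

Fixpoint no_poly d (t : tree d) : bool :=
  let: Node l k v ch gr := t in (k == 0) && all (fun c => no_poly c.2) ch.

Definition in_T0 d (t : tree d) : bool := in_T0X t && no_poly t.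

Fixpoint all_marked d (t : tree d) : bool :=
  let: Node l k v ch gr := t in v && all (fun c => all_marked c.2) ch.

Definition in_T0star d (t : tree d) : bool := in_T0 t && all_marked t.

Fixpoint unmark d (t : tree d) : tree d :=
  let: Node l k v ch gr := t in
  Node l k false [seq (c.1, unmark c.2) | c <- ch] gr.

Definition mul_noise (l l' : noise_edge) := if l is NoNoise then l' else l.

Definition tree_mul d (s t : tree d) : tree d :=
  let: Node l k v ch gr := s in
  let: Node l' k' v' ch' gr' := t in
  Node (mul_noise l l') (k + k') (v || v') (ch ++ ch') (gr ++ gr').

Definition tree_one d : tree d := bare d false.

Definition planted d (b : bool) (a : mindex d) (t : tree d) : tree d :=
  Node NoNoise 0 false [:: (b, a, t)] [::].

Definition grey_edge d (a k : mindex d) : tree d :=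
  Node NoNoise 0 false [::] [:: (a, k)].

(** * Grafting

    [graft a s t] lists, with multiplicity, the trees of [s \graft_a t]. *)

Fixpoint graft d (a : mindex d) (s t : tree d) : seq (tree d) :=
  let: Node l k v ch gr := t in
  (if v && ~~ null_planted s
   then [:: Node l k false ((true, a, s) :: ch) gr] else [::]) ++
  (fix graft_edges (pre post : seq (bool * mindex d * tree d)) :=
     if post is c :: post' then
       [seq Node l k v (pre ++ (c.1, t') :: post') gr | t' <- graft a s c.2]
         ++ graft_edges (rcons pre c) post'
     else [::]) [::] ch.

(** Finite linear combinations of trees. *)
Definition lincomb (R : realType) d := seq (R * tree d).

Definition supported (R : realType) d (P : tree d -> bool) (s : lincomb R d) : bool :=
  all (fun p => P p.2) s.

Definition graft_lin (R : realType) d (a : mindex d) (s t : lincomb R d)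
    : lincomb R d :=
  flatten [seq [seq (p.1 * q.1, u) | u <- graft a p.2 q.2] | p <- s, q <- t].

(** * Formal sums

    A possibly infinite formal linear combination [\sum_i fcoef i *: fterm i]. *)

Record fsum (R : realType) (A : Type) := FSum {
  fidx : choiceType;
  fcoef : fidx -> R;
  fterm : fidx -> A }.

Definition fsum_one (R : realType) A (x : A) : fsum R A :=
  @FSum R A unit (fun=> 1) (fun=> x).

Definition fsum_add (R : realType) A (u w : fsum R A) : fsum R A :=
  @FSum R A (fidx u + fidx w)%type
    (fun i => match i with inl j => fcoef j | inr j => fcoef j end)
    (fun i => match i with inl j => fterm j | inr j => fterm j end).

Definition fsum_mul (R : realType) A (mul : A -> A -> A) (u w : fsum R A)
    : fsum R A :=
  @FSum R A (fidx u * fidx w)%type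
    (fun i => fcoef i.1 * fcoef i.2) (fun i => mul (fterm i.1) (fterm i.2)).

Definition fsum_bind (R : realType) A B (u : fsum R A) (f : A -> fsum R B)
    : fsum R B :=
  @FSum R B {i : fidx u & fidx (f (fterm i))}
    (fun i => fcoef (projT1 i) * fcoef (projT2 i)) (fun i => fterm (projT2 i)).

(** [\sum_k 1/k! *: F k] over all multi-indices. *)
Definition fsum_taylor (R : realType) d A (F : mindex d -> A) : fsum R A :=
  @FSum R A (mindex d) (fun k => (mfact k)%:R^-1) F.

(** Value of a formal sum under the linear map extending [F]; as everywhere in
    this file, the sum runs over the indices with a non-zero contribution. *)
Definition fsum_eval (R : realType) A (u : fsum R A) (F : A -> R) : R :=
  \sum_(i \in [set: fidx u]) fcoef i * F (fterm i).

(** The linear map [I_a], applied to the component of the terms that [get]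
    selects and [put] replaces. *)
Definition fsum_plant (R : realType) d (a : mindex d) A (get : A -> tree d)
    (put : A -> tree d -> A) (u : fsum R A) : fsum R A :=
  @FSum R A (fidx u)
    (fun i => if null_planted (get (fterm i)) then 0 else fcoef i)
    (fun i => put (fterm i) (planted false a (get (fterm i)))).

(** * Root extraction and localisation *)

Notation tree2 d := (tree d * tree d)%type.

Definition tree2_mul d (p q : tree2 d) : tree2 d :=
  (tree_mul p.1 q.1, tree_mul p.2 q.2).

Definition Delta_noise (R : realType) d (l : noise_edge) : fsum R (tree2 d) :=
  let edge l : tree d := Node l 0 false [::] [::] in
  match l with
  | Noise => fsum_add (fsum_one R (edge GreyNoise, edge Noise))
                      (fsum_one R (edge Noise, tree_one d))
  | l => fsum_one R (edge l, tree_one d)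
  end.

(** The decoration [X^k Y^v] and the grey edges stay on the left; for trees of
    [T_1], [k = 0] and there are no grey edges. *)
Fixpoint Delta (R : realType) d (t : tree d) : fsum R (tree2 d) :=
  let: Node l k v ch gr := t in
  foldr (fun c u =>
      let cut := fsum_taylor R (fun j : mindex d =>
                   (grey_edge c.1.2 j, planted c.1.1 (c.1.2 + j) c.2)) in
      let edge := if c.1.1 then cut else
        fsum_add (fsum_plant c.1.2 fst (fun p t' => (t', p.2)) (Delta R c.2)) cut in
      fsum_mul (@tree2_mul d) edge u)
    (fsum_mul (@tree2_mul d)
      (fsum_one R (Node NoNoise k v [::] gr, tree_one d)) (Delta_noise R d l))
    ch.

(** The root [Node l j v [::] gr] is multiplied by [\sum_k X^k / k!]. *)
Fixpoint Mloc (R : realType) d (t : tree d) : fsum R (tree d) :=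
  let: Node l j v ch gr := t in
  foldr (fun c u =>
      fsum_mul (@tree_mul d)
        (fsum_plant c.1.2 id (fun _ t' => t') (Mloc R c.2)) u)
    (fsum_taylor R (fun k : mindex d => Node l (j + k) v [::] gr))
    ch.

(** [(Mloc \otimes id) \o Delta] *)
Definition Mloc_Delta (R : realType) d (t : tree d) : fsum R (tree2 d) :=
  fsum_bind (Delta R t) (fun p =>
    let u := Mloc R p.1 in @FSum R (tree2 d) (fidx u) (@fcoef _ _ u)
                             (fun i => (fterm i, p.2))).

(** The map [\downarrow]. *)
Fixpoint down d (t : tree d) : tree d :=
  let: Node l k v ch gr := t in
  Node (if is_grey_noise l then NoNoise else l) (k + \sum_(g <- gr) g.2) v
    [seq (c.1, down c.2) | c <- ch] [::].

(** * Calculus on space-time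

    Points of [\mathbb{R} \times \mathbb{R}^d] are row vectors, time first;
    functions on [\mathbb{R} \times \mathbb{T}^d] are functions of such points
    that are 1-periodic in space. *)

Notation spacetime R d := 'rV[R]_d.+1.

Definition stpoint (R : realType) d (r : R) (y : 'rV[R]_d) : spacetime R d :=
  row_mx (const_mx r : 'rV[R]_1) y.

Definition time (R : realType) d (z : spacetime R d) : R := z 0 ord0.

Definition slab (R : realType) d : set (spacetime R d) :=
  [set z | 0 <= time z <= 1].
Arguments slab : clear implicits.

Definition space_periodic (R : realType) d (f : spacetime R d -> R) : Prop :=
  forall z (j : 'I_d), f (z + delta_mx 0 (lift ord0 j)) = f z.

Definition pderiv (R : realType) d (i : 'I_d.+1) (f : spacetime R d -> R)
    : spacetime R d -> R :=
  fun z => 'D_(delta_mx 0 i : spacetime R d) f z.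

Definition pderivs (R : realType) d (s : seq 'I_d.+1) (f : spacetime R d -> R) :=
  foldr (@pderiv R d) f s.

Definition index_seq d (a : mindex d) : seq 'I_d.+1 :=
  flatten [seq nseq (a i) i | i <- enum 'I_d.+1].

(** [\partial^a f] *)
Definition pder (R : realType) d (a : mindex d) (f : spacetime R d -> R) :=
  pderivs (index_seq a) f.

(** [A] is meant to be open. *)
Definition smooth_on (R : realType) d (A : set (spacetime R d))
    (f : spacetime R d -> R) : Prop :=
  forall (s : seq 'I_d.+1) (z : spacetime R d), A z ->
    {for z, continuous (pderivs s f)} /\
    forall i, derivable (pderivs s f) z (delta_mx 0 i).

Definition smooth1 (R : realType) (f : R -> R) : Prop :=
  forall (n : nat) (x : R), derivable (derive1n n f) x 1.

(** Lebesgue integral over [\mathbb{T}^n], identified with [[0,1]^n]. *)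
Fixpoint torus_integral (R : realType) n : ('rV[R]_n -> \bar R) -> \bar R :=
  if n is m.+1 then fun f =>
    (\int[lebesgue_measure]_(y in `[0%R, 1%R])
      torus_integral (fun x : 'rV[R]_m => f (row_mx (const_mx y : 'rV[R]_1) x)))%E
  else fun f => f 0.

(** Causal convolution on [[0,1] \times \mathbb{T}^d]:
    [\int_0^t \int_{\mathbb{T}^d} K(r, y) f(t - r, x - y) dy dr]. *)
Definition conv (R : realType) d (K f : spacetime R d -> R) : spacetime R d -> R :=
  fun z => fine (\int[lebesgue_measure]_(r in `[0%R, time z])
    torus_integral (fun y : 'rV[R]_d => (K (stpoint r y) * f (z - stpoint r y))%R%:E))%E.

(** The Green kernel of [\partial_t - \Delta], i.e. its fundamental solution on
    the torus, which these conditions determine; the integrability condition,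
    with [a] of scaled degree at most 1, is automatic for it. *)
Record green_kernel (R : realType) d (G : spacetime R d -> R) : Prop := GreenKernel {
  green_causal : forall z, time z <= 0 -> G z = 0;
  green_periodic : space_periodic G;
  green_smooth : smooth_on [set z | 0 < time z] G;
  green_heat : forall z, 0 < time z ->
    pderiv ord0 G z = \sum_(j < d) pderivs [:: lift ord0 j; lift ord0 j] G z;
  green_integrable : forall a : mindex d, (sdeg a < 2)%N ->
    (\int[lebesgue_measure]_(r in `[0%R, 1%R])
       torus_integral (fun y : 'rV[R]_d => (`| pder a G (stpoint r y) |)%R%:E)
     < +oo)%E;
  green_initial : forall (g : 'rV[R]_d -> R) (x : 'rV[R]_d),
    continuous g -> (forall y j, g (y + delta_mx 0 j) = g y) ->
    torus_integral (fun y => (G (stpoint r y) * g (x - y))%:E) @[r --> 0^'+]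
      --> (g x)%:E }.

(** * Data of the equation *)

Record setting (R : realType) d := Setting {
  alpha : R;
  kappa : R;
  (* [nonlin false] is [g] and [nonlin true] is [f], as functions of
     [(psi, \nabla psi)]: entry [ord0] is [psi], the others its spatial
     derivatives *)
  nonlin : bool -> 'rV[R]_d.+1 -> R;
  ell : tree d -> R;
  chi : R -> R;
  green : spacetime R d -> R;
  (* [noise eps] is the noise mollified at scale [eps] *)
  noise : R -> spacetime R d -> R }.

(** Values of the variables [(Z_a)_a]. *)
Notation jet R d := (mindex d -> R).

Definition Upsilon (R : realType) d (S : setting R d) (l : bool) (Z : jet R d) : R :=
  nonlin S l (\row_(i < d.+1) Z (if i == ord0 then 0 else unit_index i)).

Definition shift_jet (R : realType) d (a : mindex d) (s : R) (Z : jet R d) : jet R d :=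
  fun b => if b == a then Z b + s else Z b.

(** [D_a] *)
Definition Dvar (R : realType) d (a : mindex d) (F : jet R d -> R) : jet R d -> R :=
  fun Z => derive1 (fun s : R => F (shift_jet a s Z)) 0.

(** [\partial^{e_i}] *)
Definition total_deriv (R : realType) d (i : 'I_d.+1) (F : jet R d -> R)
    : jet R d -> R :=
  fun Z => \sum_(a \in [set: mindex d]) Z (a + unit_index i) * Dvar a F Z.

(** [\partial^k] *)
Definition total_derivs (R : realType) d (k : mindex d) (F : jet R d -> R) :=
  foldr (@total_deriv R d) F (index_seq k).

(** [\tilde\Upsilon[t]] as a function of [Z] and [\tilde Z].  Since
    [\tilde\Upsilon[\zeta_l Y^1] = \Upsilon^l(Z)] and
    [\tilde\Upsilon[\zeta_l Y^0] = \Upsilon^l(\tilde Z)], the derivatives (with or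
    without tilde according to the mark) are those of [\Upsilon^l], evaluated at
    [Z] or at [\tilde Z]. *)
Fixpoint UpsilonT (R : realType) d (S : setting R d) (t : tree d)
    (Z Zt : jet R d) : R :=
  let: Node l k v ch gr := t in
  let F0 := Upsilon S (is_noise l || is_grey_noise l) in
  let F := total_derivs k
    (foldr (@Dvar R d) F0 ([seq c.1.2 | c <- ch] ++ [seq g.1 | g <- gr])) in
  F (if v then Z else Zt) * foldr (fun c x => UpsilonT S c.2 Z Zt * x) 1 ch.

Definition deg_noise (R : realType) d (S : setting R d) : R := - 2 + alpha S - kappa S.

Fixpoint deg (R : realType) d (S : setting R d) (t : tree d) : R :=
  let: Node l k v ch gr := t in
  (if is_noise l then deg_noise S else 0) + (sdeg k)%:R +
  foldr (fun c x =>
    deg S c.2 + 2 - (sdeg c.1.2)%:R - (if c.1.1 then 1 else 0) + x) 0 ch.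

(** Local subcriticality by power counting: every monomial of the right-hand
    side other than the noise itself, with each argument [\partial^b \psi]
    replaced by [I_b(\Xi)], has larger degree than the noise. *)
Definition subcritical (R : realType) d (S : setting R d) : Prop :=
  forall (l : bool) (bs : seq (mindex d)) (Z : jet R d),
    foldr (@Dvar R d) (Upsilon S l) bs Z != 0 -> ~~ l || ~~ nilp bs ->
    deg_noise S < (if l then deg_noise S else 0)
                  + \sum_(b <- bs) (deg_noise S + 2 - (sdeg b)%:R).

(** Invariance under [reorder] says that [ell] is a function of non-planar
    trees.  Multiplicativity is not required. *)
Record counterterms (R : realType) d (S : setting R d) : Prop := Counterterms {
  ell_one : ell S (tree_one d) = 1;
  ell_deg : forall t, in_T0X t -> ~~ is_bare t -> 0 <= deg S t -> ell S t = 0;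
  ell_unmark : forall t, ell S t = ell S (unmark t);
  ell_reorder : forall t t', reorder t t' -> ell S t = ell S t' }.

Record cutoff (R : realType) (c : R -> R) : Prop := Cutoff {
  cutoff_smooth : smooth1 c;
  cutoff_homo : {homo c : x y / x <= y};
  cutoff0 : forall x, 0 <= x <= 1 -> c x = 0;
  cutoff1 : forall x, 2 <= x -> c x = 1 }.

Record admissible (R : realType) d (S : setting R d) : Prop := Admissible {
  adm_dim : (1 <= d)%N;
  adm_alpha : 0 < alpha S <= 1;
  adm_kappa : 0 < kappa S < alpha S;
  adm_nonlin : forall l, smooth_on setT (nonlin S l);
  adm_subcritical : subcritical S;
  adm_ell : counterterms S;
  adm_chi : cutoff (chi S);
  adm_green : green_kernel (green S);
  adm_noise : forall eps, 0 < eps ->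
    smooth_on setT (noise S eps) /\ space_periodic (noise S eps) }.

(** [G_mu] and its derivative in [mu]. *)
Definition Gmu (R : realType) d (S : setting R d) (mu : R) : spacetime R d -> R :=
  fun z => if mu == 0 then green S z else chi S (time z / mu ^+ 2) * green S z.

Definition dGmu (R : realType) d (S : setting R d) (mu : R) : spacetime R d -> R :=
  fun z => derive1 (fun m => Gmu S m z) mu.

(** * Evaluation

    A functional of [(\phi, \tilde\phi)] is a function of the two families
    [(\partial^a \phi)_a] and [(\partial^a \tilde\phi)_a], seen as independent
    variables, with values in the functions on space-time. *)

Notation jetfield R d := (mindex d -> spacetime R d -> R).
Notation functional R d := (jetfield R d -> jetfield R d -> spacetime R d -> R).

Definition jet_of (R : realType) d (phi : spacetime R d -> R) : jetfield R d :=
  fun a => pder a phi.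

Definition at_fields (R : realType) d (Y : functional R d)
    (phi phit : spacetime R d -> R) : spacetime R d -> R :=
  Y (jet_of phi) (jet_of phit).

(** The operator [\partial^a (G - G_mu) *] or [- \partial^a \dot G_mu *]. *)
Definition edge_op (R : realType) d (S : setting R d) (mu : R) (b : bool)
    (a : mindex d) (f : spacetime R d -> R) : spacetime R d -> R :=
  if b then fun z => - conv (pder a (dGmu S mu)) f z
  else conv (pder a (fun z => green S z - Gmu S mu z)) f.

(** [\Pi^{R\times}] in terms of [\tilde\Pi^R] ([P]).  It is only applied to
    products of planted trees and of [\Xi]. *)
Definition PiTimes_of (R : realType) d (S : setting R d) (eps mu : R)
    (P : tree d -> functional R d) (t : tree d) : functional R d :=
  fun Z Zt z =>
  let: Node l k v ch gr := t in
  (if is_noise l then noise S eps z else 1) *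
  foldr (fun c x => edge_op S mu c.1.1 c.1.2 (P c.2 Z Zt) z * x) 1 ch.

(** [\tilde\Pi^R] in terms of [\Pi^{R\times}] ([Q]). *)
Definition PiTilde_of (R : realType) d (S : setting R d)
    (Q : tree d -> functional R d) (t : tree d) : functional R d :=
  fun Z Zt z =>
  fsum_eval (Mloc_Delta R t) (fun p =>
    ell S (down p.1) * UpsilonT S p.1 (Z^~ z) (Zt^~ z) * Q p.2 Z Zt z).

(** The mutual recursion between [\tilde\Pi^R] and [\Pi^{R\times}] decreases the
    height; the recursion equation is [PiTildeE] below. *)
Fixpoint PiTilde_rec (R : realType) d (S : setting R d) (eps mu : R) (n : nat)
    (t : tree d) : functional R d :=
  if n is m.+1 then PiTilde_of S (PiTimes_of S eps mu (PiTilde_rec S eps mu m)) t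
  else fun _ _ _ => 0.

Definition PiTilde (R : realType) d (S : setting R d) (eps mu : R) (t : tree d)
    : functional R d := PiTilde_rec S eps mu (height t) t.

Definition PiTimes (R : realType) d (S : setting R d) (eps mu : R) :=
  PiTimes_of S eps mu (PiTilde S eps mu).

Definition children_below d (n : nat) (t : tree d) : bool :=
  let: Node l k v ch gr := t in all (fun c => height c.2 < n)%N ch.

Lemma children_below_mul d n (s t : tree d) :
  children_below n s -> children_below n t -> children_below n (tree_mul s t).
Proof. by case: s => ? ? ? ? ?; case: t => ? ? ? ? ? /=; rewrite all_cat => -> ->. Qed.

Lemma children_belowW d n m (t : tree d) :
  (n <= m)%N -> children_below n t -> children_below m t.
Proof. by case: t => ? ? ? ch ? nm; apply: sub_all => c /leq_trans; apply. Qed.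

Lemma Delta_below (R : realType) d (t : tree d) (i : fidx (Delta R t)) :
  children_below (height t) (fterm i).2.
Proof.
suff H n : forall t : tree d, (height t <= n)%N ->
    forall i : fidx (Delta R t), children_below (height t) (fterm i).2.
  by have := H (height t) t (leqnn _) i.
elim: n => [|n IH] {i}t; first by case: t.
case: t => l k v ch gr /=; rewrite ltnS.
elim: ch => [|[[b a] t] ch IHch] /=.
  by move=> _ [[]]; case: l => //= -[] //=; case.
rewrite geq_max => /andP[tn chn] [i j] /=.
apply: children_below_mul; last first.
  apply: children_belowW (IHch chn j); rewrite ltnS; exact: leq_maxr.
case: b i => /= [i|[i|i]] /=; rewrite ?andbT ?ltnS ?leq_maxl //.
apply: children_belowW (IH _ tn i).
by apply: leq_trans (leq_maxl _ _) _.
Qed.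


Lemma PiTimes_of_eq (R : realType) d (S : setting R d) (eps mu : R)
    (P P' : tree d -> functional R d) n (t : tree d) :
  (forall s, (height s < n)%N -> P s = P' s) -> children_below n t ->
  PiTimes_of S eps mu P t = PiTimes_of S eps mu P' t.
Proof.
move=> PP'; case: t => l k v ch gr chn; do 3 apply/funext => ?.
rewrite /PiTimes_of; congr (_ * _).
by elim: ch chn => //= c ch IH /andP[cn chn]; rewrite PP' ?IH.
Qed.

Lemma PiTilde_of_eq (R : realType) d (S : setting R d)
    (Q Q' : tree d -> functional R d) (t : tree d) :
  (forall s, children_below (height t) s -> Q s = Q' s) ->
  PiTilde_of S Q t = PiTilde_of S Q' t.
Proof.
move=> QQ'; do 3 apply/funext => ?.
by apply: eq_fsbigr => -[i j] _ /=; rewrite QQ' ?Delta_below.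
Qed.

Lemma PiTilde_recE (R : realType) d (S : setting R d) (eps mu : R) n (t : tree d) :
  (height t <= n)%N -> PiTilde_rec S eps mu n t = PiTilde S eps mu t.
Proof.
have [m] := ubnP (height t); elim: m => // m IH in n t *.
rewrite ltnS => tm tn; rewrite /PiTilde.
have [h th] : exists h, height t = h.+1 by case: t {tm tn} => *; eexists.
rewrite th in tm tn *; case: n tn => // n hn /=.
apply: PiTilde_of_eq => s; rewrite th => sh.
apply: PiTimes_of_eq sh => u; rewrite ltnS => uh.
by rewrite !IH ?(leq_ltn_trans uh tm) ?(leq_trans uh) //.
Qed.

Lemma PiTildeE (R : realType) d (S : setting R d) (eps mu : R) (t : tree d) :
  PiTilde S eps mu t = PiTilde_of S (PiTimes S eps mu) t.
Proof.
rewrite -(PiTilde_recE S eps mu (leqnSn _)) /=.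
apply: PiTilde_of_eq => s; apply: PiTimes_of_eq => u uh.
by rewrite PiTilde_recE // ltnW.
Qed.

(** Linear extension of [\tilde\Pi^R], and [\Pi^R], as a functional of
    [(\phi, \tilde\phi)] that does not depend on [\tilde\phi]. *)
Definition PiTilde_lin (R : realType) d (S : setting R d) (eps mu : R)
    (s : lincomb R d) : functional R d :=
  fun Z Zt z => \sum_(p <- s) p.1 * PiTilde S eps mu p.2 Z Zt z.

Definition Pi_lin (R : realType) d (S : setting R d) (eps mu : R)
    (s : lincomb R d) : functional R d :=
  fun Z _ => PiTilde_lin S eps mu s Z Z.

(** * The operator [B] *)

(** The elements of [C([0,1] \times \mathbb{T}^d)]. *)
Definition slab_continuous (R : realType) d (h : spacetime R d -> R) : Prop :=
  {within slab R d, continuous h} /\ space_periodic h.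

Definition slab_bounded (R : realType) d (m : R) (h : spacetime R d -> R) : Prop :=
  forall z, slab R d z -> `|h z| <= m.

Definition perturb (R : realType) d (a : mindex d) (h : spacetime R d -> R)
    (Z : jetfield R d) : jetfield R d :=
  fun b z => if b == a then Z b z + h z else Z b z.

(** [L] is the Fréchet derivative of [Y] at [(Z, \tilde Z)] with respect to
    [\partial^a \phi] only, in [C([0,1] \times \mathbb{T}^d)] with the uniform
    norm: a bounded linear map with [Y(Z + h) = Y(Z) + L h + o(h)]. *)
Definition is_frechet (R : realType) d (Y : functional R d) (Z Zt : jetfield R d)
    (a : mindex d) (L : (spacetime R d -> R) -> spacetime R d -> R) : Prop :=
  [/\ forall (c : R) h1 h2 z, slab_continuous h1 -> slab_continuous h2 ->
        slab R d z -> L (fun w => c * h1 w + h2 w) z = c * L h1 z + L h2 z,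
      exists C : R, forall h m, slab_continuous h -> slab_bounded m h ->
        slab_bounded (C * m) (L h)
    & forall e : R, 0 < e -> exists2 r : R, 0 < r &
        forall h m, slab_continuous h -> slab_bounded m h -> m <= r ->
        slab_bounded (e * m) (fun z => Y (perturb a h Z) Zt z - Y Z Zt z - L h z)].

Definition frechet (R : realType) d (Y : functional R d) (Z Zt : jetfield R d)
    (a : mindex d) : (spacetime R d -> R) -> spacetime R d -> R :=
  xget (fun _ _ => 0) [set L | is_frechet Y Z Zt a L].

Definition Ba (R : realType) d (S : setting R d) (mu : R) (a : mindex d)
    (X Y : functional R d) : functional R d :=
  fun Z Zt =>
  frechet Y Z Zt a (fun z => - conv (pder a (dGmu S mu)) (X Z Zt) z).

Definition B (R : realType) d (S : setting R d) (mu : R) (X Y : functional R d)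
    : functional R d :=
  fun Z Zt z => \sum_(a \in [set: mindex d]) Ba S mu a X Y Z Zt z.

(** Pitfall: where [Y] is [\tilde\Pi^R \tau], [B] leaves at the differentiated
    node a derivative of [\Upsilon^l] evaluated at [\phi], whereas in the grafted
    tree this node has lost its mark and the same derivative is evaluated at
    [\tilde\phi].  The two can only be compared at [\tilde\phi = \phi]. *)

(* Main.v *)
From HB Require Import structures.
Require Import Defs.
From mathcomp Require Import all_boot all_order all_algebra.
From mathcomp Require Import all_classical all_reals all_analysis.
From mathcomp Require Import measurable_realfun ring lra.

Set Implicit Arguments.
Unset Strict Implicit.
Unset Printing Implicit Defensive.

Import Order.TTheory GRing.Theory Num.Theory.
Import numFieldNormedType.Exports.

Local Open Scope classical_set_scope.
Local Open Scope ring_scope.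
Local Notation conv := (@Defs.conv _ _).
Local Notation down := (@Defs.down _).

(** Both sides of the identity are derivatives of [\tilde\Pi^R \tau] in [\phi],
    along the increment of the fields that [\tilde\Pi^R \sigma] generates:
    [H b = - \partial^b \dot G_mu * \tilde\Pi^R \sigma].

    For a tree [t], [\tilde\Pi^R t] is a sum of products.  Besides the
    counterterm, the factors are the [edge_op] of [\tilde\Pi^R u], for the
    subtrees [u] cut off by root extraction, and, for each node of the extracted
    tree, a derivative of a nonlinearity, at [\phi] if the node is marked and at
    [\tilde\phi] if not.  By Leibniz' rule the derivative along [H] hits one
    factor at a time.  If it hits some [\tilde\Pi^R u], induction on the height
    yields the graftings on the nodes of [u].  If it hits a marked node, it yields
    the grafting on this node: cutting the new edge [I'_a(\sigma)] leaves a grey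
    edge [Ibar_a(X^j)], that is a derivative [D_a] at the node, and produces the
    factor [H (a + j)].

    The last point is not an equality term by term.  Localisation gives the node
    a decoration [X^k], that is an operator [\partial^k] on top of the
    derivatives [D] of the nonlinearity.  The chain rule differentiates
    [\partial^k F], whereas the grafted tree carries [\partial^m D_a F] together
    with [X^j] in its grey edge, and its counterterm sees [X^(m + j)].  The two
    sums agree because of the commutation rule
    [[D_b, \partial^(e_i)] = D_(b - e_i)]: this is [node_identity], propagated to
    all the nodes of a tree by [mark_to_grey_localisations].  The node has
    lost its mark, so its factor is evaluated at [\tilde\phi], and the comparison
    takes place at [\tilde\phi = \phi].  The matching combinatorial statement on
    the side of root extraction is [graft_extractions], and both are put together
    in [dPiTilde_grafts].

    Two facts make this meaningful.  First, subcriticality: [ell] vanishes in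
    non-negative degree, except on [Y^v], so that power counting
    ([tame_of_nonzero]) leaves only multi-indices of scaled degree at most one.
    All formal sums then reduce to finite lists with coefficients one.  Secondly,
    [\tilde\Pi^R t] is differentiable on the space of continuous functions: edges
    act as bounded operators ([conv_good]), since their kernels are integrable
    and, for [\dot G_mu], supported away from time zero, and the nonlinearities
    are smooth.
    A calculus of differentiable functionals ([gdiff]) computes the derivative,
    which is the Fréchet derivative by [frechet_unique].

    If every node of [\tau] is marked, then [\tilde\Pi^R \tau] does not depend on
    [\tilde\phi] ([PiTilde_marked]), which gives the second identity. *)

(** * Continuity at a point *)

(** [{for x, continuous f}], kept folded so that the closure properties below
    apply without unfolding to filters. *)
Definition cont_at (T U : topologicalType) (f : T -> U) (x : T) : Prop :=
  {for x, continuous f}.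

Lemma cont_atP (T U : topologicalType) (f : T -> U) :
  (forall x, cont_at f x) -> continuous f.
Proof. by []. Qed.

Lemma cont_at_pair (T U V : topologicalType) (f : T -> U) (g : T -> V) x :
  cont_at f x -> cont_at g x ->
  cont_at (fun t => (f t, g t)) x.
Proof. by move=> fx gx; exact: (cvg_pair fx gx). Qed.

Lemma cont_at_comp (T U V : topologicalType) (f : T -> U) (g : U -> V) x :
  cont_at f x -> cont_at g (f x) ->
  cont_at (fun t => g (f t)) x.
Proof. exact: continuous_comp. Qed.

Lemma cont_at_cst (T U : topologicalType) (c : U) (x : T) :
  cont_at (fun _ : T => c) x.
Proof. exact: cvg_cst. Qed.

Lemma cont_at_id (T : topologicalType) (x : T) :
  cont_at (fun y : T => y) x.
Proof. exact: cvg_id. Qed.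

Lemma cont_at_fst (T U : topologicalType) (x : T * U) :
  cont_at (fun p : T * U => p.1) x.
Proof. by case: x => a b; exact: cvg_fst. Qed.

Lemma cont_at_snd (T U : topologicalType) (x : T * U) :
  cont_at (fun p : T * U => p.2) x.
Proof. by case: x => a b; exact: cvg_snd. Qed.

Lemma cont_at_fstf (T U V : topologicalType) (f : T -> U * V) x :
  cont_at f x -> cont_at (fun t => (f t).1) x.
Proof. by move=> fx; exact: (cont_at_comp fx (@cont_at_fst _ _ (f x))). Qed.

Lemma cont_at_sndf (T U V : topologicalType) (f : T -> U * V) x :
  cont_at f x -> cont_at (fun t => (f t).2) x.
Proof. by move=> fx; exact: (cont_at_comp fx (@cont_at_snd _ _ (f x))). Qed.

Lemma cont_at_ext (T U : topologicalType) (f g : T -> U) x :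
  f =1 g -> cont_at f x -> cont_at g x.
Proof. by move=> /funext ->. Qed.

Section RealValued.
Variables (R : realType) (T : topologicalType).
Implicit Types (f g : T -> R) (x : T).

Lemma cont_at_add f g x :
  cont_at f x -> cont_at g x -> cont_at (fun t => f t + g t) x.
Proof. by move=> fx gx; exact: (cvgD fx gx). Qed.

Lemma cont_at_mul f g x :
  cont_at f x -> cont_at g x -> cont_at (fun t => f t * g t) x.
Proof. by move=> fx gx; exact: (cvgM fx gx). Qed.

Lemma cont_at_norm f x : cont_at f x -> cont_at (fun t => `|f t|) x.
Proof. by move=> fx; exact: (cvg_norm fx). Qed.

Lemma cont_at_opp f x : cont_at f x -> cont_at (fun t => - f t) x.
Proof. by move=> fx; exact: (cvgN fx). Qed.

Lemma cont_at_sub (V : normedModType R) (f g : T -> V) x :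
  cont_at f x -> cont_at g x -> cont_at (fun t => f t - g t) x.
Proof. by move=> fx gx; exact: (cvgB fx gx). Qed.

End RealValued.

(** * Integrals over the torus *)

Section TorusIntegral.
Variable R : realType.
Local Notation mu := (@lebesgue_measure R).

Lemma cvg_rV (T : Type) (F : set_system T) {FF : Filter F} n
    (f : T -> 'rV[R]_n) (l : 'rV[R]_n) :
  (forall j, f t 0 j @[t --> F] --> l 0 j) -> f t @[t --> F] --> l.
Proof.
move=> H A [P hP sub].
suff : \forall t \near F, forall j, P 0 j (f t 0 j).
  by apply: filterS => t ht; apply: sub => i j; rewrite ord1.
by apply: filter_forall => j; apply: H; exact: hP.
Qed.

Lemma cont_at_coord n (j : 'I_n) (x : 'rV[R]_n) :
  cont_at (fun y : 'rV[R]_n => y 0 j) x.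
Proof. exact: coord_continuous. Qed.

Lemma cont_at_rV (T : topologicalType) n (f : T -> 'rV[R]_n) (x : T) :
  (forall j, cont_at (fun t => f t 0 j) x) -> cont_at f x.
Proof. by move=> H; apply: cvg_rV => j; exact: H. Qed.

Lemma cont_at_row_mx1 (T : topologicalType) n (f : T -> R)
    (g : T -> 'rV[R]_n) x :
  cont_at f x -> cont_at g x ->
  cont_at (fun t =>
    row_mx (const_mx (f t) : 'rV[R]_1) (g t) : 'rV[R]_(1 + n)) x.
Proof.
move=> fx gx; apply: cont_at_rV => j.
case: (splitP j) => k jk.
  have -> : j = lshift n k by apply: val_inj.
  by apply: cont_at_ext fx => t; rewrite row_mxEl mxE.
have -> : j = rshift 1 k by apply: val_inj.
apply: (cont_at_ext (f := fun t => g t 0 k)).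
  by move=> t; rewrite row_mxEr.
exact: (cont_at_comp gx (@cont_at_coord _ k (g x))).
Qed.

(** Real-valued counterpart of [torus_integral], with which it agrees on
    continuous functions by [torus_integralE]. *)
Fixpoint tint n : ('rV[R]_n -> R) -> R :=
  if n is m.+1 then fun f =>
    \int[mu]_(y in `[0, 1]) tint (fun x : 'rV[R]_m => f (row_mx (const_mx y : 'rV[R]_1) x))
  else fun f => f 0.

Lemma integrable_unit (g : R -> R) : continuous g ->
  mu.-integrable `[0, 1] (EFin \o g).
Proof.
move=> gc; apply: continuous_compact_integrable; first exact: segment_compact.
exact: continuous_subspaceT.
Qed.

(** By compactness of [[0, 1]], [g v] tends to [g u] uniformly there as [v] tends
    to [u]. *)
Lemma continuous_integral_param (U : topologicalType) (A : set U) (g : U -> R -> R) :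
  open A ->
  (forall u y, A u -> cont_at (fun p => g p.1 p.2) (u, y)) ->
  forall u, A u ->
    cont_at (fun u => \int[mu]_(y in `[0, 1]) g u y) u.
Proof.
move=> oA gc u Au.
have gyc v : A v -> continuous (g v).
  move=> Av y; apply: (cont_at_comp (f := fun y => (v, y)) _ (gc v y Av)).
  by apply: cont_at_pair; [exact: cont_at_cst|exact: cont_at_id].
apply/cvgrPdist_le => /= e e0.
have : \forall v \near u, forall y, `[0, 1]%classic y -> `|g u y - g v y| <= e.
  have /compact_near_coveringP nc := @segment_compact R 0 1.
  apply: (nc _ (nbhs u) (fun v y => `|g u y - g v y| <= e)) => y _.
  have e20 : 0 < e / 2 by rewrite divr_gt0.
  have H := (proj1 (cvgrPdist_lt _ _) (gc u y Au)) _ e20.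
  have H2 := (proj1 (cvgrPdist_lt _ _) (gyc u Au y)) _ e20.
  have {H}[[V W] /= [nV nW] VW] := H.
  exists (W `&` [set x | `|g u y - g u x| < e / 2], V).
    split; last exact: nV. by apply: filterI; [exact: nW|exact: H2].
  move=> [x v] /= [[Wx h2] Vv].
  have h1 := VW (v, x) (conj Vv Wx).
  have -> : g u x - g v x = (g u y - g v x) - (g u y - g u x) by ring.
  rewrite (le_trans (ler_normB _ _))// [leRHS](splitr e) lerD// ltW//.
move=> H.
have nA : \forall v \near u, A v by apply: open_nbhs_nbhs.
near=> v.
have Av : A v by near: v.
have Hv : forall y, `[0, 1]%classic y -> `|g u y - g v y| <= e by near: v.
rewrite -RintegralB//; [|exact: integrable_unit (gyc _ _)..].
have cuv : continuous (g u \- g v).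
  by move=> y; apply: cvgB; exact: gyc.
apply: (le_trans (le_normr_Rintegral _ (integrable_unit cuv))) => //.
have <- : \int[mu]_(y in `[0, 1]) (cst e) y = e.
  by rewrite Rintegral_cst//= lebesgue_measure_itv/= lte_fin ltr01/= oppr0 addr0 mulr1.
apply: le_Rintegral => //.
- apply: integrable_unit => y; apply: cvg_norm; exact: cuv.
- by apply: integrable_unit => y; exact: cvg_cst.
Unshelve. all: by end_near.
Qed.

Lemma continuous_tint (U : topologicalType) (A : set U) n (f : U -> 'rV[R]_n -> R) :
  open A ->
  (forall u y, A u -> cont_at (fun p => f p.1 p.2) (u, y)) ->
  forall u, A u -> cont_at (fun u => tint (f u)) u.
Proof.
elim: n => [|n IH] in U A f *; move=> oA fc u Au /=.
  apply: (cont_at_comp (f := fun u => (u, 0 : 'rV[R]_0)) _ (fc u 0 Au)).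
  by apply: cont_at_pair; [exact: cont_at_id|exact: cont_at_cst].
apply: (@continuous_integral_param U A
  (fun v y => tint (fun x => f v (row_mx (const_mx y : 'rV[R]_1) x)))) => //.
move=> v y Av.
apply: (IH (U * R)%type (fst @^-1` A)
  (fun p x => f p.1 (row_mx (const_mx p.2 : 'rV[R]_1) x))) => //.
  by apply: open_comp => // -[? ?] _; exact: cvg_fst.
move=> [{Av}v {}y] x /= Av.
apply: (cont_at_comp (f := fun p : (U * R) * 'rV[R]_n =>
  (p.1.1, row_mx (const_mx p.1.2 : 'rV[R]_1) p.2 : 'rV[R]_n.+1))
  (g := fun p => f p.1 p.2) (x := ((v, y), x)) _ (fc _ _ Av)).
apply: cont_at_pair => /=.
  by do 2 apply: cont_at_fstf; exact: cont_at_id.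
apply: cont_at_row_mx1; last exact: cont_at_snd.
by apply: cont_at_sndf; apply: cont_at_fstf; exact: cont_at_id.
Qed.

Lemma continuous_slice n (f : 'rV[R]_n.+1 -> R) y : continuous f ->
  continuous (fun x : 'rV[R]_n => f (row_mx (const_mx y : 'rV[R]_1) x)).
Proof.
move=> fc x; apply: (cont_at_comp (f := fun x : 'rV[R]_n =>
  row_mx (const_mx y : 'rV[R]_1) x)); last exact: fc.
by apply: cont_at_row_mx1; [exact: cont_at_cst|exact: cont_at_id].
Qed.

Lemma continuous_tint_slice n (f : 'rV[R]_n.+1 -> R) : continuous f ->
  continuous (fun y => tint (fun x => f (row_mx (const_mx y : 'rV[R]_1) x))).
Proof.
move=> fc y; apply: (@continuous_tint _ setT _
  (fun y x => f (row_mx (const_mx y : 'rV[R]_1) x))) => //; first exact: openT.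
move=> {}y x _; apply: (cont_at_comp (f := fun p : R * 'rV[R]_n =>
  row_mx (const_mx p.1 : 'rV[R]_1) p.2)); last exact: fc.
by apply: cont_at_row_mx1; [exact: cont_at_fst|exact: cont_at_snd].
Qed.

Lemma torus_integralE n (f : 'rV[R]_n -> R) : continuous f ->
  torus_integral (fun x => (f x)%:E) = (tint f)%:E.
Proof.
elim: n => [|n IH] in f * => // fc /=.
transitivity (\int[mu]_(y in `[0%R, 1%R])
    (tint (fun x => f (row_mx (const_mx y : 'rV[R]_1) x)))%:E)%E; last first.
  rewrite /Rintegral fineK//; apply: integrable_fin_num => //.
  exact/integrable_unit/continuous_tint_slice.
by apply: eq_integral => y _; rewrite IH//; exact: continuous_slice.
Qed.

Lemma tint0 n : tint (fun _ : 'rV[R]_n => 0) = 0.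
Proof.
by elim: n => //= n IH; under eq_Rintegral do rewrite IH; rewrite Rintegral_cst// mul0r.
Qed.

Lemma tintP n (c : R) (f g : 'rV[R]_n -> R) : continuous f -> continuous g ->
  tint (fun x => c * f x + g x) = c * tint f + tint g.
Proof.
elim: n => [|n IH] in f g * => // fc gc /=.
have fi := continuous_tint_slice fc; have gi := continuous_tint_slice gc.
transitivity (\int[mu]_(y in `[0, 1]) (
    c * tint (fun x => f (row_mx (const_mx y : 'rV[R]_1) x)) +
    tint (fun x => g (row_mx (const_mx y : 'rV[R]_1) x)))).
  by apply: eq_Rintegral => y _; rewrite IH//; exact: continuous_slice.
rewrite RintegralD//.
- by rewrite RintegralZl//; exact: integrable_unit.
- by apply: integrable_unit => y; apply: cvgM; [exact: cvg_cst|exact: fi].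
- exact: integrable_unit.
Qed.

Lemma le_tint n (f g : 'rV[R]_n -> R) : continuous f -> continuous g ->
  (forall x, f x <= g x) -> tint f <= tint g.
Proof.
elim: n => [|n IH] in f g * => fc gc fg /=; first exact: fg.
apply: le_Rintegral => //; [exact/integrable_unit/continuous_tint_slice..|].
by move=> y _; apply: IH => //; exact: continuous_slice.
Qed.

Lemma norm_tint n (f : 'rV[R]_n -> R) : continuous f ->
  `|tint f| <= tint (fun x => `|f x|).
Proof.
move=> fc.
have nc : continuous (fun x => `|f x|).
  by move=> x; exact: (cont_at_norm (fc x)).
rewrite ler_norml le_tint// ?andbT; last by move=> x; exact: ler_norm.
rewrite lerNl -[leLHS]addr0 -[X in _ + X](tint0 n) -mulN1r -tintP//; last first.
  by move=> x; exact: cont_at_cst.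
apply: le_tint => //; last by move=> x; rewrite addr0 mulN1r lerNl; exact: lerNnormlW.
apply: cont_atP => x; apply: cont_at_add; last exact: cont_at_cst.
apply: cont_at_mul; [exact: cont_at_cst|exact: fc].
Qed.

End TorusIntegral.

(** * Continuous periodic functions on the slab *)

Section SlabFunctions.
Variables (R : realType) (d : nat).
Local Notation ST := (spacetime R d).
Implicit Types (h g : ST -> R) (z : ST).

(** A continuous retraction on the slab.  Composing with it extends a function
    that is continuous within the slab to a continuous function, so that the
    theory of globally continuous functions applies. *)
Definition clamp z : ST :=
  \row_j (if j == ord0 then Num.max 0 (Num.min 1 (z 0 j)) else z 0 j).

Lemma clamp_slab z : slab R d (clamp z).
Proof.
rewrite /slab /= /time /clamp mxE eqxx.
by rewrite le_max lexx/= ge_max ler01 ge_min lexx.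
Qed.

Lemma clamp_id z : slab R d z -> clamp z = z.
Proof.
move=> /= /andP[z0 z1]; apply/rowP => j; rewrite mxE; case: eqP => // ->.
by rewrite min_r// max_r.
Qed.

Lemma clamp_continuous : continuous clamp.
Proof.
apply: cont_atP => z; apply: cont_at_rV => j; rewrite /clamp.
case: (eqVneq j ord0) => [->|j0].
  apply: (@cont_at_ext _ _ (fun z : ST => Num.max 0 (Num.min 1 (z 0 ord0)))).
    by move=> t; rewrite mxE eqxx.
  apply: (@continuous_max _ _ (fun=> 0) (fun z : ST => Num.min 1 (z 0 ord0))).
    exact: cont_at_cst.
  apply: (@continuous_min _ _ (fun=> 1) (fun z : ST => (z 0 ord0))).
    exact: cont_at_cst.
  exact: cont_at_coord.
apply: cont_at_ext (@cont_at_coord _ _ j z) => t.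
by rewrite mxE (negbTE j0).
Qed.

Lemma within_slab_ext h : {within slab R d, continuous h} ->
  continuous (fun z => h (clamp z)).
Proof.
move=> /subspace_continuousP hc; apply: cont_atP => z.
move=> A nA; have {}nA := hc _ (clamp_slab z) A nA.
apply: (@filterS _ (nbhs z) _ _ _ _ (@clamp_continuous z _ nA)) => t /=.
by apply; exact: clamp_slab.
Qed.

Lemma slab_continuous_ext g h : continuous g -> space_periodic h ->
  (forall z, slab R d z -> g z = h z) -> slab_continuous h.
Proof.
move=> gc hp gh; split => //.
apply: (@subspace_eq_continuous _ _ _ g); last exact: continuous_subspaceT.
by move=> z; rewrite inE => /gh.
Qed.

Lemma space_periodic_int h z (j : 'I_d) (n : int) : space_periodic h ->
  h (z + n%:~R *: delta_mx 0 (lift ord0 j)) = h z.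
Proof.
move=> hp.
have H (m : nat) y : h (y + m%:R *: delta_mx 0 (lift ord0 j)) = h y.
  elim: m => [|m IH]; first by rewrite scale0r addr0.
  by rewrite -natr1 scalerDl scale1r addrA hp.
case: n => n; first exact: H.
by rewrite NegzE mulrNz scaleNr -[LHS](H n.+1) subrK.
Qed.

Lemma space_periodic_sum h z (n : 'I_d -> int) : space_periodic h ->
  h (z + \sum_j (n j)%:~R *: delta_mx 0 (lift ord0 j)) = h z.
Proof.
move=> hp; elim: (index_enum _) => [|j s IH] in z *.
  by rewrite big_nil addr0.
by rewrite big_cons addrA IH space_periodic_int.
Qed.

Definition unit_cube : set ST := [set z | forall j, z ord0 j \in `[0, 1]].

Lemma compact_unit_cube : compact unit_cube.
Proof.
have := (@rV_compact R d.+1 (fun=> `[0, 1]%classic)); apply => i.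
exact: segment_compact.
Qed.

Lemma to_unit_cube h z : space_periodic h -> slab R d z ->
  exists2 z', unit_cube z' & slab R d z' /\ h z' = h z.
Proof.
move=> hp /= zt.
pose z' : ST := \row_j (if j == ord0 then z 0 j else z 0 j - (Num.floor (z 0 j))%:~R).
exists z'.
  move=> j; rewrite /z' mxE; case: eqP => [->|_]; rewrite in_itv //=.
  by rewrite subr_ge0 floor_le /= lerBlDr addrC -intrD1 ltW// floorD1_gt.
split; first by rewrite /slab/= /time /z' mxE eqxx.
rewrite -(@space_periodic_sum h z' (fun j => Num.floor (z 0 (lift ord0 j))))//.
congr (h _); apply/rowP => k; rewrite !mxE summxE.
case: (unliftP ord0 k) => [j|] -> /=.
  rewrite (bigD1 j)//= !mxE !eqxx /= mulr1 big1 ?addr0 ?subrK//.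
  move=> i ij; rewrite !mxE eqxx /= (inj_eq (@lift_inj _ _)).
  by rewrite eq_sym (negbTE ij) mulr0.
by rewrite big1 ?addr0// => i _; rewrite !mxE /= mulr0.
Qed.

(** The slab is not compact, but a periodic function takes all its values there
    in the compact unit cube. *)
Lemma slab_continuous_bounded h : slab_continuous h ->
  exists2 M, 0 <= M & slab_bounded M h.
Proof.
move=> [hc hp].
have gc := within_slab_ext hc.
have /compact_bounded[M [_ HM]] := continuous_compact (continuous_subspaceT gc) compact_unit_cube.
exists (`|M| + 1); first by rewrite addr_ge0.
move=> z zs; have [z' z'c [z's <-]] := to_unit_cube hp zs.
rewrite -(clamp_id z's); apply: HM => //=.
by rewrite (le_lt_trans (ler_norm _))// ltrDl.
by exists z'.
Qed.

Lemma slab_continuousD h1 h2 : slab_continuous h1 -> slab_continuous h2 ->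
  slab_continuous (fun z => h1 z + h2 z).
Proof.
move=> [c1 p1] [c2 p2].
apply: (@slab_continuous_ext (fun z => h1 (clamp z) + h2 (clamp z))).
- by apply: cont_atP => z; apply: cont_at_add; exact: within_slab_ext.
- by move=> z j; rewrite p1 p2.
- by move=> z zs; rewrite clamp_id.
Qed.

Lemma slab_continuousM h1 h2 : slab_continuous h1 -> slab_continuous h2 ->
  slab_continuous (fun z => h1 z * h2 z).
Proof.
move=> [c1 p1] [c2 p2].
apply: (@slab_continuous_ext (fun z => h1 (clamp z) * h2 (clamp z))).
- by apply: cont_atP => z; apply: cont_at_mul; exact: within_slab_ext.
- by move=> z j; rewrite p1 p2.
- by move=> z zs; rewrite clamp_id.
Qed.

Lemma slab_continuous_cst (c : R) : slab_continuous (fun _ : ST => c).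
Proof.
apply: (@slab_continuous_ext (fun=> c)) => //.
by apply: cont_atP => z; exact: cont_at_cst.
Qed.

Lemma slab_continuous_sum (I : eqType) (r : seq I) (F : I -> ST -> R) :
  (forall i, i \in r -> slab_continuous (F i)) ->
  slab_continuous (fun z => \sum_(i <- r) F i z).
Proof.
elim: r => [|i r IH] Fc.
  by under eq_fun do rewrite big_nil; exact: slab_continuous_cst.
under eq_fun do rewrite big_cons; apply: slab_continuousD; first exact/Fc/mem_head.
by apply: IH => j jr; apply: Fc; rewrite in_cons jr orbT.
Qed.

End SlabFunctions.


(** * Convolution with a causal kernel *)

Section Convolution.
Variables (R : realType) (d : nat).
Local Notation ST := (spacetime R d).
Local Notation mu := (@lebesgue_measure R).
Implicit Types (h g f : ST -> R) (z : ST).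

Record causal_regular (K : ST -> R) : Prop := CausalRegular {
  kernel_causal : forall z, time z <= 0 -> K z = 0;
  kernel_cont : forall z, 0 < time z -> cont_at K z }.

Definition kernel_mass (K : ST -> R) r := tint (fun y : 'rV[R]_d => `|K (stpoint r y)|).

(** The kernel may blow up at time zero, provided that its mass at time [r] is
    integrable in [r]. *)
Definition causal_kernel (K : ST -> R) : Prop :=
  causal_regular K /\ mu.-integrable `](0 : R), (1 : R)]%classic (EFin \o kernel_mass K).

(** Dominated convergence is about sequences, hence so is the proof that a
    convolution is continuous. *)
Lemma cont_at_seq n (F : 'rV[R]_n -> R) (z : 'rV[R]_n) :
  (forall u : nat -> 'rV[R]_n, u k @[k --> \oo] --> z -> F (u k) @[k --> \oo] --> F z) ->
  cont_at F z.
Proof.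
move=> H; apply: (proj2 (@cvgrPdist_lt _ _ _ (nbhs z) _ F (F z))) => /= e e0.
apply: contrapT => Hn.
have Hk (k : nat) : exists w : 'rV[R]_n, `|z - w| < k.+1%:R^-1 /\ e <= `|F z - F w|.
  apply: contrapT => Hk; apply: Hn.
  have k0 : 0 < k.+1%:R^-1 :> R by rewrite invr_gt0.
  apply/nbhs_ballP; exists k.+1%:R^-1 => //= w; rewrite -ball_normE /= => wk.
  by apply: contrapT => Hw; apply: Hk; exists w; split=> //; rewrite leNgt; exact/negP.
have [u Hu] := choice Hk.
have uz : u k @[k --> \oo] --> z.
  apply: (proj2 (@cvgrPdist_lt _ _ _ \oo _ u z)) => /= s s0; near=> k.
  apply: (lt_trans (Hu k).1); near: k; exact: near_infty_natSinv_lt (PosNum s0).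
have [N _ HN] := proj1 (@cvgrPdist_lt _ _ _ \oo _ (F \o u) (F z)) (H u uz) e e0.
by have := HN N (leqnn N); rewrite /= ltNge (Hu N).2.
Unshelve. all: by end_near. Qed.

Lemma time_stpoint r (y : 'rV[R]_d) : time (stpoint r y) = r.
Proof.
by rewrite /time mxE; case: splitP => k // _; rewrite mxE.
Qed.

Lemma timeB z z' : time (z - z') = time z - time z'.
Proof. by rewrite /time !mxE. Qed.

Section FixedKernel.
Variable K : ST -> R.
Hypothesis HK : causal_regular K.

Let slice_cont g r z : continuous g ->
  continuous (fun y : 'rV[R]_d => K (stpoint r y) * g (z - stpoint r y)).
Proof.
move=> gc; apply: cont_atP => y.
have sc : cont_at (fun y : 'rV[R]_d => stpoint r y) y.
  by apply: cont_at_row_mx1; [exact: cont_at_cst|exact: cont_at_id].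
case: (ltP 0 r) => [r0|r0].
  apply: cont_at_mul.
    by apply: (cont_at_comp sc); apply: (kernel_cont HK); rewrite time_stpoint.
  apply: (cont_at_comp (f := fun y : 'rV[R]_d => z - stpoint r y)); last exact: gc.
  by apply: cont_at_sub; [exact: cont_at_cst|exact: sc].
apply: (@cont_at_ext _ _ (fun=> 0)); last exact: cont_at_cst.
by move=> t; rewrite (kernel_causal HK) ?mul0r// time_stpoint.
Qed.

Definition kernel_slice g z r := tint (fun y : 'rV[R]_d => K (stpoint r y) * g (z - stpoint r y)).
Local Notation kernel_mass := (kernel_mass K).

Lemma mass_cont r : continuous (fun y : 'rV[R]_d => `|K (stpoint r y)|).
Proof.
have c1 : continuous ((fun=> 1) : ST -> R) by apply: cont_atP => z; exact: cont_at_cst.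
apply: cont_atP => y; apply: cont_at_norm.
by apply: cont_at_ext (@slice_cont (fun=> 1) r 0 c1 y) => t; rewrite mulr1.
Qed.

Lemma kernel_slice_cont g z r : continuous g -> 0 < r ->
  cont_at (fun p : R * ST => kernel_slice g p.2 p.1) (r, z).
Proof.
move=> gc r0.
apply: (@continuous_tint _ _ [set p : R * ST | 0 < p.1] _
  (fun p y => K (stpoint p.1 y) * g (p.2 - stpoint p.1 y))) => //.
  apply: (@open_comp _ _ fst [set x : R | 0 < x]); last exact: open_gt.
  by move=> [? ?] _; exact: cvg_fst.
move=> [r' z'] y /= r'0.
have sc : cont_at (fun p : (R * ST) * 'rV[R]_d => stpoint p.1.1 p.2) ((r', z'), y).
  apply: cont_at_row_mx1; last exact: cont_at_snd.
  by do 2 apply: cont_at_fstf; exact: cont_at_id.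
apply: cont_at_mul.
  by apply: (cont_at_comp sc); apply: (kernel_cont HK); rewrite time_stpoint.
apply: (cont_at_comp (f := fun p : (R * ST) * 'rV[R]_d => p.1.2 - stpoint p.1.1 p.2));
  last exact: gc.
apply: cont_at_sub; last exact: sc.
by apply: cont_at_sndf; apply: cont_at_fstf; exact: cont_at_id.
Qed.

Let slice_cont_r g z r : continuous g -> 0 < r -> cont_at (kernel_slice g z) r.
Proof.
move=> gc r0; apply: (@cont_at_comp _ _ _ (fun r => (r, z))
  (fun p : R * ST => kernel_slice g p.2 p.1) r _ (@kernel_slice_cont g z r gc r0)).
by apply: cont_at_pair; [exact: cont_at_id|exact: cont_at_cst].
Qed.

Let slice_cont_z g z r : continuous g -> 0 < r -> cont_at (fun z => kernel_slice g z r) z.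
Proof.
move=> gc r0; apply: (@cont_at_comp _ _ _ (fun z => (r, z))
  (fun p : R * ST => kernel_slice g p.2 p.1) z _ (@kernel_slice_cont g z r gc r0)).
by apply: cont_at_pair; [exact: cont_at_cst|exact: cont_at_id].
Qed.

Lemma kernel_mass_cont r : 0 < r -> cont_at kernel_mass r.
Proof.
move=> r0.
apply: (@continuous_tint _ _ [set r : R | 0 < r] _
  (fun r (y : 'rV[R]_d) => `|K (stpoint r y)|)) => //.
move=> r' y /= r'0; apply: cont_at_norm.
have sc : cont_at (fun p : R * 'rV[R]_d => stpoint p.1 p.2) (r', y).
  by apply: cont_at_row_mx1; [exact: cont_at_fst|exact: cont_at_snd].
by apply: (cont_at_comp sc); apply: (kernel_cont HK); rewrite time_stpoint.
Qed.

Lemma measurable_pos (F : R -> R) (D : set R) : measurable D ->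
  (forall r, D r -> 0 < r) -> (forall r, 0 < r -> cont_at F r) ->
  measurable_fun D F.
Proof.
move=> mD D0 Fc; apply: subspace_continuous_measurable_fun => //.
by apply: continuous_in_subspaceT => r; rewrite inE => /D0; exact: Fc.
Qed.

Local Notation I01 := (`](0 : R), (1 : R)]%classic).

Let I01_gt0 r : I01 r -> 0 < r.
Proof. by rewrite /= in_itv /= => /andP[]. Qed.

Let mI01 : measurable (I01 : set R). Proof. exact: measurable_itv. Qed.

Lemma kernel_mass_ge0 r : 0 <= kernel_mass r.
Proof.
rewrite -(@tint0 R d); apply: le_tint => //; last exact: mass_cont.
by apply: cont_atP => y; exact: cont_at_cst.
Qed.

Lemma kernel_mass_measurable : measurable_fun I01 (EFin \o kernel_mass).
Proof. by apply/measurable_EFinP; apply: measurable_pos => // r; exact: kernel_mass_cont. Qed.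

Lemma kernel_mass_le (b : R -> R) : mu.-integrable I01 (EFin \o b) ->
  (forall r, I01 r -> kernel_mass r <= b r) -> causal_kernel K.
Proof.
move=> bi mb; split => //; apply: le_integrable bi => //.
  exact: kernel_mass_measurable.
move=> r r01 /=; rewrite lee_fin ger0_norm ?kernel_mass_ge0//.
by rewrite (le_trans (mb r r01))// ler_norm.
Qed.

Lemma causal_kernelP :
  (\int[mu]_(r in `[0%R, 1%R])
       torus_integral (fun y : 'rV[R]_d => (`|K (stpoint r y)|)%R%:E) < +oo)%E ->
  causal_kernel K.
Proof.
move=> Ki; split => //; apply/integrableP; split; first exact: kernel_mass_measurable.
have -> : (\int[mu]_(x in I01) `|(EFin \o kernel_mass) x| =
  \int[mu]_(x in `]0%R, 1%R]) torus_integral (fun y : 'rV[R]_d => (`|K (stpoint x y)|)%R%:E))%E.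
  apply: eq_integral => r _ /=.
  by rewrite torus_integralE ?ger0_norm ?kernel_mass_ge0//; exact: mass_cont.
rewrite integral_itv_obnd_cbnd; first exact: Ki.
have -> : (fun x => torus_integral (fun y : 'rV[R]_d => (`|K (stpoint x y)|)%R%:E)) =
  EFin \o kernel_mass.
  by apply/funext => r; rewrite torus_integralE//; exact: mass_cont.
exact: kernel_mass_measurable.
Qed.

Hypothesis kernel_mass_integrable : mu.-integrable I01 (EFin \o kernel_mass).

Lemma kernel_slice_le g z r M : continuous g -> (forall z, `|g z| <= M) ->
  `|kernel_slice g z r| <= M * kernel_mass r.
Proof.
move=> gc gM; apply: (le_trans (norm_tint (@slice_cont g r z gc))).
have c0 : continuous (fun _ : 'rV[R]_d => 0 : R) by apply: cont_atP => y; exact: cont_at_cst.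
have := @tintP _ _ M _ _ (@mass_cont r) c0.
rewrite tint0 addr0 => <-; apply: le_tint.
- by apply: cont_atP => y; apply: cont_at_norm; exact: slice_cont.
- apply: cont_atP => y; apply: cont_at_add; last exact: cont_at_cst.
  by apply: cont_at_mul; [exact: cont_at_cst|exact: (@mass_cont r)].
- by move=> y; rewrite addr0 normrM mulrC ler_wpM2r.
Qed.

(** Truncating the integrand rather than the domain: the domain of integration
    becomes [`]0, 1]] for all [z], as dominated convergence wants it. *)
Definition causal_slice g z r := \1_[set s : R | s <= time z] r * kernel_slice g z r.

Let causal_slice_meas g z : continuous g -> measurable_fun I01 (causal_slice g z).
Proof.
move=> gc; apply: measurable_funM.
  apply: measurable_indic.
  have -> : [set s : R | s <= time z] = `]-oo, time z]%classic.
    by apply/seteqP; split=> s /=; rewrite in_itv.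
  exact: measurable_itv.
by apply: measurable_pos => // r; exact: slice_cont_r.
Qed.

Let causal_slice_le g z r M : continuous g -> (forall z, `|g z| <= M) ->
  `|causal_slice g z r| <= M * kernel_mass r.
Proof.
move=> gc gM; rewrite /causal_slice indicE normrM.
case: (_ \in _) => /=; first by rewrite normr1 mul1r kernel_slice_le.
rewrite normr0 mul0r mulr_ge0 ?kernel_mass_ge0//.
exact: le_trans (gM 0).
Qed.

Let dominant_integrable M : mu.-integrable I01 (fun r => (M * kernel_mass r)%:E).
Proof.
have -> : (fun r => (M * kernel_mass r)%:E) = (fun r => M%:E * (kernel_mass r)%:E)%E.
  by apply/funext => r; rewrite EFinM.
by apply: integrableZl => //; exact: kernel_mass_integrable.
Qed.

Let causal_slice_integrable g z M : continuous g -> (forall z, `|g z| <= M) ->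
  mu.-integrable I01 (EFin \o causal_slice g z).
Proof.
move=> gc gM; apply: le_integrable (dominant_integrable M) => //.
  by apply/measurable_EFinP; exact: causal_slice_meas.
move=> r _ /=; rewrite lee_fin (le_trans (@causal_slice_le g z r M gc gM))//.
exact: ler_norm.
Qed.

Definition causal_conv g z := \int[mu]_(r in I01) causal_slice g z r.

(** For [z] in the slab, the convolution only involves the values of [f] on the
    slab, where [clamp] is the identity. *)
Lemma convE f z : slab_continuous f -> slab R d z ->
  conv K f z = causal_conv (fun w => f (clamp w)) z.
Proof.
move=> fc zs; have gc := within_slab_ext fc.1.
set g := fun w => f (clamp w) in gc *.
have /= /andP[z0 z1] := zs.
rewrite /Defs.conv /causal_conv.
have -> : (\int[mu]_(r in `[0%R, time z])
    torus_integral (fun y : 'rV[R]_d => (K (stpoint r y) * f (z - stpoint r y))%R%:E) =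
  \int[mu]_(r in `[0%R, time z]) (kernel_slice g z r)%:E)%E.
  apply: eq_integral => r; rewrite inE /= in_itv /= => /andP[r0 rz].
  rewrite -torus_integralE; last exact: slice_cont.
  congr torus_integral; apply/funext => y; congr (_ * _)%:E.
  rewrite /g clamp_id// /slab /= timeB time_stpoint subr_ge0 rz /= lerBlDr.
  by rewrite (le_trans z1)// lerDl.
rewrite -integral_itv_obnd_cbnd; last first.
  apply/measurable_EFinP; apply: measurable_pos => //.
    by move=> r /=; rewrite in_itv /= => /andP[].
  by move=> r; exact: slice_cont_r.
transitivity (\int[mu]_(r in `]0%R, time z]) kernel_slice g z r); first by [].
have -> : `]0%R, time z]%classic = I01 `&` [set s : R | s <= time z].
  apply/seteqP; split=> s /=; rewrite !in_itv /=.
    by move=> /andP[-> sz]; rewrite sz (le_trans sz z1).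
  by move=> [/andP[-> _] ->].
rewrite Rintegral_mkcondr; apply: eq_Rintegral => r _.
by rewrite /causal_slice indicE /patch; case: (_ \in _); rewrite ?mul1r ?mul0r.
Qed.

Lemma causal_conv_continuous g M : continuous g -> (forall z, `|g z| <= M) ->
  continuous (causal_conv g).
Proof.
move=> gc gM; apply: cont_atP => z; apply: cont_at_seq => u uz.
rewrite /causal_conv /Rintegral; apply: fine_cvg; rewrite fineK; last first.
  by apply: integrable_fin_num => //; exact: causal_slice_integrable gM.
have ae1 : {ae mu, forall r, I01 r ->
    (causal_slice g (u n) r)%:E @[n --> \oo] --> (causal_slice g z r)%:E}.
  (* the truncation jumps at [r = time z] only *)
  exists [set time z]; split => //; first exact: lebesgue_measure_set1.
  move=> r /= Hr; apply: contrapT => rz; apply: Hr => r01.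
  apply: cvg_EFin; first exact: nearW.
  apply: cvgM; last first.
    exact: (@cvg_comp _ _ _ u (fun z => kernel_slice g z r) _ _ _ uz
      (@slice_cont_z g z r gc (I01_gt0 r01))).
  have tu : time (u n) @[n --> \oo] --> time z.
    exact: (@cvg_comp _ _ _ u (fun z : ST => z 0 ord0) _ _ _ uz (@cont_at_coord _ _ ord0 z)).
  rewrite indicE; apply: cvg_near_cst.
  move/eqP : rz; rewrite neq_lt => /orP[rz|rz].
    near=> n; have ru : r < time (u n) by near: n; exact: cvgr_gt tu _ rz.
    by rewrite indicE; congr (_%:R); rewrite !mem_set//=; exact: ltW.
  near=> n; have ru : time (u n) < r by near: n; exact: cvgr_lt tu _ rz.
  by rewrite indicE; congr (_%:R); rewrite !memNset//=; apply/negP; rewrite -ltNge.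
have ae2 : {ae mu, forall r, forall n, I01 r ->
    (`|(causal_slice g (u n) r)%:E| <= (M * kernel_mass r)%:E)%E}.
  by apply: nearW => r n _ /=; rewrite lee_fin causal_slice_le.
have [_ _ //] := @dominated_convergence _ _ _ mu I01 mI01
  (fun n r => (causal_slice g (u n) r)%:E) (fun r => (causal_slice g z r)%:E)
  (fun r => (M * kernel_mass r)%:E)
  (fun n => proj2 (measurable_EFinP _ _) (@causal_slice_meas g (u n) gc))
  (proj2 (measurable_EFinP _ _) (@causal_slice_meas g z gc)) ae1
  (dominant_integrable M) ae2.
Unshelve. all: by end_near. Qed.

Let bounded_ext f : slab_continuous f ->
  exists2 M, 0 <= M & forall z, `|f (clamp z)| <= M.
Proof.
move=> /slab_continuous_bounded[M M0 fM]; exists M => // z.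
by apply: fM; exact: clamp_slab.
Qed.

Lemma conv_continuous f : slab_continuous f -> slab_continuous (conv K f).
Proof.
move=> fc; have [M M0 fM] := bounded_ext fc.
apply: (@slab_continuous_ext _ _ (causal_conv (fun w => f (clamp w)))).
- by apply: causal_conv_continuous fM; exact: within_slab_ext fc.1.
- move=> z j; rewrite /Defs.conv; congr fine.
  have -> : time (z + delta_mx 0 (lift ord0 j)) = time z.
    by rewrite /time !mxE /= addr0.
  apply: eq_integral => r _; congr torus_integral; apply/funext => y.
  by rewrite addrAC fc.2.
- by move=> z zs; rewrite convE.
Qed.

Lemma conv_linear c f1 f2 z : slab_continuous f1 -> slab_continuous f2 ->
  slab R d z ->
  conv K (fun w => c * f1 w + f2 w) z = c * conv K f1 z + conv K f2 z.
Proof.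
move=> c1 c2 zs; have g1 := within_slab_ext c1.1; have g2 := within_slab_ext c2.1.
have [M1 _ b1] := bounded_ext c1; have [M2 _ b2] := bounded_ext c2.
rewrite !convE//; last first.
  by apply: slab_continuousD => //; apply: slab_continuousM => //; exact: slab_continuous_cst.
rewrite /causal_conv -RintegralZl//; last exact: causal_slice_integrable b1.
rewrite -RintegralD//.
- apply: eq_Rintegral => r _; rewrite /causal_slice mulrCA -mulrDr; congr (_ * _).
  rewrite /kernel_slice -tintP; [|exact: (@slice_cont _ r z g1)|exact: (@slice_cont _ r z g2)].
  by congr tint; apply/funext => y; ring.
- rewrite (_ : EFin \o _ =
    (fun r => c%:E * (causal_slice (fun w => f1 (clamp w)) z r)%:E)%E); last first.
    by apply/funext => r /=; rewrite EFinM.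
  apply: integrableZl => //; exact: causal_slice_integrable b1.
- exact: causal_slice_integrable b2.
Qed.

Lemma conv_bounded : exists2 C, 0 <= C & forall f m, slab_continuous f ->
  slab_bounded m f -> slab_bounded (C * m) (conv K f).
Proof.
exists (\int[mu]_(r in I01) kernel_mass r).
  by apply: Rintegral_ge0 => r _; exact: kernel_mass_ge0.
move=> f m fc fm z zs; rewrite convE//.
have gm w : `|f (clamp w)| <= m by apply: fm; exact: clamp_slab.
have gc := within_slab_ext fc.1.
apply: (le_trans (le_normr_Rintegral _ (@causal_slice_integrable _ z _ gc gm))) => //.
have -> : \int[mu]_(r in I01) kernel_mass r * m = \int[mu]_(r in I01) (m * kernel_mass r).
  by rewrite RintegralZl// mulrC.
apply: le_Rintegral => //.
- have := causal_slice_integrable z gc gm.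
  by move/integrable_norm.
- exact: dominant_integrable.
- by move=> r _; exact: causal_slice_le.
Qed.

End FixedKernel.

Section Admissible.
Variable K : ST -> R.
Hypothesis HK : causal_kernel K.

(** What is needed of [conv K]: it acts linearly and boundedly on the
    functions that are continuous on the slab. *)
Record good_op (L : (ST -> R) -> ST -> R) : Prop := GoodOp {
  good_cont : forall f, slab_continuous f -> slab_continuous (L f);
  good_lin : forall c f1 f2 z, slab_continuous f1 -> slab_continuous f2 ->
    slab R d z -> L (fun w => c * f1 w + f2 w) z = c * L f1 z + L f2 z;
  good_bound : exists2 C, 0 <= C & forall f m, slab_continuous f ->
    slab_bounded m f -> slab_bounded (C * m) (L f) }.

Lemma conv_good : good_op (conv K).
Proof.
case: HK => HR HI; split.
- by move=> f; exact: conv_continuous.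
- by move=> c f1 f2 z; exact: conv_linear.
- exact: conv_bounded.
Qed.

End Admissible.
End Convolution.

(** * Smooth functions *)

Lemma cont_at_near (T U : topologicalType) (f g : T -> U) (z : T) :
  (\forall w \near z, f w = g w) -> cont_at f z -> cont_at g z.
Proof.
move=> fg fc; have E : f z = g z by exact: (nbhs_singleton fg).
have fc' : f w @[w --> z] --> g z by rewrite -E.
by apply: cvg_trans fc'; exact: near_eq_cvg.
Qed.

Section Smoothness.
Variables (R : realType) (d : nat).
Local Notation ST := (spacetime R d).
Implicit Types (f g : ST -> R) (z v : ST) (s : seq 'I_d.+1) (A : set ST).

Lemma near_open A (P : ST -> Prop) z : open A -> A z -> (forall w, A w -> P w) ->
  \forall w \near z, P w.
Proof. by move=> oA Az AP; apply: filterS AP _; exact: open_nbhs_nbhs. Qed.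

Lemma pderivs_eq_on A f g s z : open A -> (forall w, A w -> f w = g w) -> A z ->
  pderivs s f z = pderivs s g z.
Proof.
move=> oA fg; elim: s z => [|i s IH] z Az; first exact: fg.
by apply: near_eq_derive; apply: near_open Az _.
Qed.

Lemma pderivs_cat s1 s2 f : pderivs (s1 ++ s2) f = pderivs s1 (pderivs s2 f).
Proof. exact: foldr_cat. Qed.

Lemma smooth_on_pderivs A f s : smooth_on A f -> smooth_on A (pderivs s f).
Proof. by move=> fs s' z Az; rewrite -pderivs_cat; exact: fs. Qed.

Lemma smooth_on_eq A f g : open A -> (forall w, A w -> f w = g w) ->
  smooth_on A f -> smooth_on A g.
Proof.
move=> oA fg fs s z Az; have [fc fd] := fs s z Az.
have E : \forall w \near z, pderivs s f w = pderivs s g w.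
  by apply: near_open Az _ => // w Aw; exact: pderivs_eq_on Aw.
split; first exact: cont_at_near fc.
by move=> i; apply: near_eq_derivable (fd i).
Qed.

Lemma is_derive_sum (I : Type) (r : seq I) (F : I -> ST -> R) (dF : I -> R) z v :
  (forall i, is_derive z v (F i) (dF i)) ->
  is_derive z v (fun w => \sum_(i <- r) F i w) (\sum_(i <- r) dF i).
Proof.
move=> H; elim: r => [|i r IH].
  rewrite big_nil; have -> : (fun w => \sum_(i <- [::]) F i w) = cst 0.
    by apply/funext => w; rewrite big_nil.
  exact: is_derive_cst.
rewrite big_cons.
have -> : (fun w => \sum_(j <- i :: r) F j w) = F i + (fun w => \sum_(j <- r) F j w).
  by apply/funext => w; rewrite big_cons.
exact: is_deriveD.
Qed.

Lemma cont_at_sum (I : Type) (r : seq I) (F : I -> ST -> R) z :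
  (forall i, cont_at (F i) z) -> cont_at (fun w => \sum_(i <- r) F i w) z.
Proof.
move=> H; elim: r => [|i r IH].
  by apply: cont_at_ext (@cont_at_cst _ _ 0 z) => w; rewrite big_nil.
by apply: cont_at_ext (cont_at_add (H i) IH) => w; rewrite big_cons.
Qed.

Lemma is_derive_mul f g z v (df dg : R) : is_derive z v f df -> is_derive z v g dg ->
  is_derive z v (fun w => f w * g w) (df * g z + f z * dg).
Proof.
move=> h1 h2; have h := is_deriveM h1 h2.
have -> : df * g z + f z * dg = f z *: dg + g z *: df.
  by rewrite addrC mulrC [X in _ + X]mulrC [X in X + _]mulrC.
exact: h.
Qed.

(** Leibniz' formula without its coefficients: smoothness of a product only
    requires that its derivatives be finite sums of products. *)
Lemma pderivsM A f g s : open A -> smooth_on A f -> smooth_on A g ->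
  exists l : seq (seq 'I_d.+1 * seq 'I_d.+1), forall z, A z ->
    pderivs s (fun w => f w * g w) z = \sum_(p <- l) pderivs p.1 f z * pderivs p.2 g z.
Proof.
move=> oA fs gs; elim: s => [|i s [l IH]].
  by exists [:: ([::], [::])] => z Az; rewrite big_seq1.
exists (flatten [seq [:: (i :: p.1, p.2); (p.1, i :: p.2)] | p <- l]) => z Az.
rewrite /= /pderiv (near_eq_derive _ (near_open oA Az IH)).
have H p : is_derive z (delta_mx 0 i) (fun w => pderivs p.1 f w * pderivs p.2 g w)
    (pderivs (i :: p.1) f z * pderivs p.2 g z + pderivs p.1 f z * pderivs (i :: p.2) g z).
  have df := (fs p.1 z Az).2 i; have dg := (gs p.2 z Az).2 i.
  exact: is_derive_mul (derivableP df) (derivableP dg).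
have [_ ->] := is_derive_sum l H.
elim: l {IH} => [|p l IH]; first by rewrite !big_nil.
by rewrite /= !big_cons IH addrA.
Qed.

Lemma smooth_onM A f g : open A -> smooth_on A f -> smooth_on A g ->
  smooth_on A (fun w => f w * g w).
Proof.
move=> oA fs gs s z Az; have [l Hl] := pderivsM s oA fs gs.
have E := near_open oA Az Hl.
have E' : \forall w \near z, \sum_(p <- l) pderivs p.1 f w * pderivs p.2 g w =
    pderivs s (fun w => f w * g w) w by apply: filterS E.
split.
  apply: (cont_at_near E'); apply: cont_at_sum => p; apply: cont_at_mul.
    exact: (fs p.1 z Az).1.
  exact: (gs p.2 z Az).1.
move=> i; apply: (near_eq_derivable E').
have H p : is_derive z (delta_mx 0 i) (fun w => pderivs p.1 f w * pderivs p.2 g w)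
    (pderivs (i :: p.1) f z * pderivs p.2 g z + pderivs p.1 f z * pderivs (i :: p.2) g z).
  have df := (fs p.1 z Az).2 i; have dg := (gs p.2 z Az).2 i.
  exact: is_derive_mul (derivableP df) (derivableP dg).
by have [] := is_derive_sum l H.
Qed.

Lemma is_derive_line f z v df :
  is_derive (0 : R) 1 (fun r : R => f (r *: v + z)) df -> is_derive z v f df.
Proof.
have E : (fun h : R => h^-1 *: (((fun r : R => f (r *: v + z)) \o shift 0) (h *: 1) -
    (fun r : R => f (r *: v + z)) 0)) =
    (fun h : R => h^-1 *: ((f \o shift z) (h *: v) - f z)).
  by apply/funext => h /=; rewrite scale0r add0r addr0 [h *: 1]mulr1.
by case; rewrite /derivable /derive E => h1 h2; split.
Qed.

Lemma time_line z i (r : R) :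
  time (r *: delta_mx 0 i + z : ST) = r * (i == ord0)%:R + time z.
Proof. by rewrite /time !mxE eqxx /= eq_sym. Qed.

Lemma is_derive_time (u : R -> R) (c : R) z i : derivable u (c * time z) 1 ->
  is_derive z (delta_mx 0 i) (fun w => u (c * time w))
    ((i == ord0)%:R * c * derive1 u (c * time z)).
Proof.
move=> du; apply: is_derive_line.
have -> : (fun r : R => u (c * time (r *: delta_mx 0 i + z : ST))) =
  u \o (fun r => c * time z + r * ((i == ord0)%:R * c)).
  by apply/funext => r /=; rewrite time_line; congr u; ring.
rewrite [_ * c * _]mulrC; set k := _ * c.
have h : is_derive (0 : R) 1 (fun r : R => c * time z + r * k) k.
  have -> : (fun r : R => c * time z + r * k) = cst (c * time z) + (k *: (@id R)).
    by apply/funext => r; rewrite (mulrC r).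
  have h1 : is_derive (0 : R) (1 : R) (k *: @id R) (k *: 1).
    exact: (is_deriveZ k (is_derive_id _ _)).
  have h0 : is_derive (0 : R) (1 : R) (cst (c * time z) : R -> R) 0.
    exact: is_derive_cst.
  by have := is_deriveD h0 h1; rewrite add0r /GRing.scale /= mulr1.
apply: is_derive1_comp; rewrite mul0r addr0 derive1E.
exact: derivableP.
Qed.

Lemma pderivs_time (u : R -> R) (c : R) s : smooth1 u ->
  pderivs s (fun w : ST => u (c * time w)) =
  fun w => ((all (pred1 ord0) s)%:R * c ^+ size s) * derive1n (size s) u (c * time w).
Proof.
move=> us; elim: s => [|i s IH]; first by apply/funext => w; rewrite /= !mul1r.
rewrite /= IH; apply/funext => w; rewrite /pderiv.
have [_ ->] := is_deriveZ ((all (pred1 ord0) s)%:R * c ^+ size s)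
  (is_derive_time i (us (size s) (c * time w))).
rewrite /GRing.scale /= exprS.
by case: eqP => _ /=; rewrite ?mul0r ?mulr0 ?mul0r//; ring.
Qed.

Lemma cont_at_time z : cont_at (@time R d) z.
Proof. exact: cont_at_coord. Qed.

Lemma smooth_on_time (u : R -> R) (c : R) A : smooth1 u ->
  smooth_on A (fun w : ST => u (c * time w)).
Proof.
move=> us s z Az; rewrite pderivs_time//.
have H i := is_derive_time i (us (size s) (c * time z)).
split.
  apply: (@cont_at_mul _ _ (fun=> (all (pred1 ord0) s)%:R * c ^+ size s)
    (fun w : ST => derive1n (size s) u (c * time w))); first exact: cont_at_cst.
  apply: (@cont_at_comp _ _ _ (fun w : ST => c * time w) (derive1n (size s) u)).
    by apply: cont_at_mul; [exact: cont_at_cst|exact: cont_at_time].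
  exact/differentiable_continuous/derivable1_diffP.
by move=> i; have [] := is_deriveZ ((all (pred1 ord0) s)%:R * c ^+ size s) (H i).
Qed.

Lemma smooth1_derive1 (u : R -> R) : smooth1 u -> smooth1 (derive1 u).
Proof. by move=> us n x; rewrite -derive1Sn; exact: us. Qed.

Lemma smooth1_cst (k : R) : smooth1 (cst k).
Proof.
have E n : derive1n n (cst k) = cst (if n is 0%N then k else 0).
  elim: n => // n IH; rewrite /= IH; apply/funext => x; rewrite derive1E.
  exact: derive_cst.
by move=> n x; rewrite E; exact: derivable_cst.
Qed.

Lemma smooth1_id : smooth1 (@id R).
Proof.
have E : derive1 (@id R) = cst 1.
  by apply/funext => x; rewrite derive1E; exact: derive_id.
move=> [|n] x; first exact: derivable_id.
by rewrite derive1Sn E; exact: smooth1_cst.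
Qed.

Lemma space_periodic_pderivs f s : space_periodic f -> space_periodic (pderivs s f).
Proof.
move=> fp; elim: s => // i s IH z j; rewrite /= /pderiv /derive.
have -> : (fun h : R => h^-1 *: ((pderivs s f \o shift (z + delta_mx 0 (lift ord0 j)))
      (h *: delta_mx 0 i) - pderivs s f (z + delta_mx 0 (lift ord0 j)))) =
    (fun h : R => h^-1 *: ((pderivs s f \o shift z) (h *: delta_mx 0 i) - pderivs s f z)).
  by apply/funext => h /=; rewrite addrA !IH.
by [].
Qed.

End Smoothness.

(** * Multi-indices of scaled degree at most one *)

Section IndexBox.
Variable d : nat.
Implicit Types (a b : mindex d) (i : 'I_d.+1).

(** With this numbering, entry [i] of the argument of [nonlin] is the variable of
    index [idx i], and [ord0], the index of time, is free to stand for [0]. *)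
Definition idx i : mindex d := if i == ord0 then 0 else unit_index i.

Lemma idx0 : idx ord0 = 0. Proof. by rewrite /idx eqxx. Qed.

Lemma sdegD a b : sdeg (a + b) = (sdeg a + sdeg b)%N.
Proof.
rewrite /sdeg ffunE mulnDr addnACA; congr addn.
by rewrite -big_split /=; apply: eq_bigr => j _; rewrite ffunE.
Qed.

Lemma sdeg0 : sdeg (0 : mindex d) = 0%N.
Proof. by rewrite /sdeg ffunE muln0 add0n big1// => j _; rewrite ffunE. Qed.

Lemma sdeg_unit i : i != ord0 -> sdeg (unit_index i) = 1%N.
Proof.
move=> i0; rewrite /sdeg ffunE eq_sym (negbTE i0) muln0 add0n.
case: (unliftP ord0 i) i0 => [j -> _|-> /eqP//].
rewrite (bigD1 j)//= ffunE eqxx big1// => k kj.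
by rewrite ffunE (inj_eq (@lift_inj _ _)) (negbTE kj).
Qed.

Lemma sdeg_eq0 a : (sdeg a == 0%N) = (a == 0).
Proof.
apply/eqP/eqP => [a0|->]; last exact: sdeg0.
move/eqP: a0; rewrite /sdeg addn_eq0 muln_eq0 /= sum_nat_eq0 => /andP[/eqP a0 /forallP H].
apply/ffunP => i; rewrite ffunE; case: (unliftP ord0 i) => [j|] -> //.
exact/eqP/(implyP (H j)).
Qed.

Lemma sdeg_lt2P a : reflect (exists i, a = idx i) (sdeg a < 2)%N.
Proof.
apply: (iffP idP) => [|[i ->]]; last first.
  by rewrite /idx; case: eqP => [_|/eqP /sdeg_unit ->//]; rewrite sdeg0.
rewrite ltnS leq_eqVlt ltnS leqn0 sdeg_eq0 => /orP[a1|/eqP ->]; last first.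
  by exists ord0; rewrite idx0.
have a0 : a ord0 = 0%N.
  by move: a1; rewrite /sdeg; case: (a ord0) => // n; rewrite mulnS.
have : exists j, a (lift ord0 j) != 0%N.
  apply/existsP; apply: contraLR a1 => /existsPn H.
  by rewrite /sdeg a0 big1// => j _; apply/eqP; move: (H j); rewrite negbK.
move=> [j aj]; exists (lift ord0 j); rewrite /idx /=.
move: a1; rewrite /sdeg a0 muln0 add0n (bigD1 j)//= => /eqP E.
have aj1 : a (lift ord0 j) = 1%N by move: aj E; case: (a _) => [|[|n]].
move: E; rewrite aj1 => /eqP; rewrite eqSS sum_nat_eq0 => /forallP H.
apply/ffunP => i; rewrite ffunE; case: (unliftP ord0 i) => [k|] -> //.
rewrite (inj_eq (@lift_inj _ _)); case: (eqVneq k j) => [->//|kj].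
by apply/eqP; have := H k; rewrite kj.
Qed.

Lemma sdeg_idx i : (sdeg (idx i) < 2)%N.
Proof. by apply/sdeg_lt2P; exists i. Qed.

Lemma index_seq0 : index_seq (0 : mindex d) = [::].
Proof. by rewrite /index_seq; elim: (enum _) => //= i s ->; rewrite ffunE. Qed.

Lemma index_seq_unit i : index_seq (unit_index i) = [:: i].
Proof.
rewrite /index_seq.
have H (s : seq 'I_d.+1) : uniq s ->
    flatten [seq nseq (unit_index i j) j | j <- s] = if i \in s then [:: i] else [::].
  elim: s => //= j s IH /andP[js us]; rewrite IH// ffunE inE eq_sym.
  by case: eqP js => [->|] //=; case: (_ \in _).
by rewrite H ?enum_uniq// mem_enum.
Qed.

Lemma index_seq_idx i : index_seq (idx i) = if i == ord0 then [::] else [:: i].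
Proof. by rewrite /idx; case: eqP => _; rewrite ?index_seq0 ?index_seq_unit. Qed.

Lemma unit_index_neq0 i : unit_index i != 0 :> mindex d.
Proof. by apply/eqP => /ffunP /(_ i); rewrite !ffunE eqxx. Qed.

Lemma unit_index_inj : injective (@unit_index d).
Proof.
by move=> i j /ffunP /(_ i); rewrite !ffunE eqxx; case: eqP.
Qed.

Lemma idx_inj : injective idx.
Proof.
move=> i j; rewrite /idx; case: (eqVneq i ord0) => [->|i0];
  case: (eqVneq j ord0) => [->|j0] //.
- by move=> /esym/eqP; rewrite (negbTE (unit_index_neq0 _)).
- by move=> /eqP; rewrite (negbTE (unit_index_neq0 _)).
- exact: unit_index_inj.
Qed.

Lemma mfact_idx i : mfact (idx i) = 1%N.
Proof.
rewrite /mfact big1// => j _; rewrite /idx; case: eqP => _; rewrite !ffunE//.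
by case: eqP.
Qed.

End IndexBox.

(** * The kernels of the edges *)

Section Kernels.
Variables (R : realType) (d : nat) (S : setting R d) (mu : R).
Hypothesis HS : admissible S.
Local Notation ST := (spacetime R d).
Implicit Types (z : ST).

Let G := green S.
Let HG : green_kernel G. Proof. exact: adm_green HS. Qed.
Let Hchi : cutoff (chi S). Proof. exact: adm_chi HS. Qed.

Let open_pos : open [set z : ST | 0 < time z].
Proof.
apply: (@open_comp _ _ (@time R d) [set x : R | 0 < x]); last exact: open_gt.
by move=> z _; exact: cont_at_time.
Qed.

Lemma chi_le1 x : 0 <= x -> 0 <= chi S x <= 1.
Proof.
move=> x0.
have c0 : chi S 0 = 0 by apply: (cutoff0 Hchi); rewrite lexx ler01.
have c1 : chi S (Num.max x 2) = 1 by apply: (cutoff1 Hchi); rewrite le_max lexx orbT.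
have h0 := cutoff_homo Hchi x0.
have h1 : chi S x <= chi S (Num.max x 2) by apply: (cutoff_homo Hchi); rewrite le_max lexx.
by rewrite c0 in h0; rewrite c1 in h1; rewrite h0 h1.
Qed.

Lemma chi_derivable x : derivable (chi S) x 1.
Proof.
have cs : smooth1 (chi S) by exact: cutoff_smooth Hchi.
exact: (cs 0%N x).
Qed.

Lemma chi_cont x : cont_at (chi S) x.
Proof. exact/differentiable_continuous/derivable1_diffP/chi_derivable. Qed.

Lemma derive_line_eq (f g : ST -> R) z v :
  (forall r : R, f (r *: v + z) = g (r *: v + z)) -> 'D_v f z = 'D_v g z.
Proof.
move=> H; rewrite /derive.
have -> : (fun h : R => h^-1 *: ((f \o shift z) (h *: v) - f z)) =
    (fun h : R => h^-1 *: ((g \o shift z) (h *: v) - g z)).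
  by apply/funext => h /=; rewrite H; have := H 0; rewrite scale0r add0r => ->.
by [].
Qed.

(** Along a spatial direction [c (time w)] is constant. *)
Lemma pderiv_spatial (j : 'I_d) z (c : R -> R) :
  pderiv (lift ord0 j) (fun w => c (time w) * G w) z =
  c (time z) * pderiv (lift ord0 j) G z.
Proof.
have [z0|z0] := ltP 0 (time z); last first.
  rewrite /pderiv (@derive_line_eq _ (cst 0)) ?(@derive_line_eq G (cst 0)).
  - by rewrite derive_cst mulr0.
  - by move=> r; rewrite (green_causal HG)// time_line mulr0 add0r.
  - by move=> r; rewrite (green_causal HG) ?mulr0// time_line mulr0 add0r.
rewrite /pderiv (@derive_line_eq _ (fun w => c (time z) * G w)).
  by rewrite (deriveZ (c (time z)) ((green_smooth HG [::] z0).2 (lift ord0 j))).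
by move=> r; rewrite time_line /= mulr0 add0r.
Qed.

Lemma pder_time_mul i z (c : R -> R) :
  pder (idx i) (fun w => c (time w) * G w) z = c (time z) * pder (idx i) G z.
Proof.
rewrite /pder index_seq_idx; case: (unliftP ord0 i) => [j|] -> //=.
exact: pderiv_spatial.
Qed.

Lemma pder_green_causal i z : time z <= 0 -> pder (idx i) G z = 0.
Proof.
move=> z0; rewrite /pder index_seq_idx; case: (unliftP ord0 i) => [j|] -> /=.
  rewrite /pderiv (@derive_line_eq G (cst 0)) ?derive_cst// => r.
  by rewrite (green_causal HG)// time_line mulr0 add0r.
exact: (green_causal HG).
Qed.

Lemma green_regular i : causal_regular (pder (idx i) G).
Proof.
split=> z z0; first exact: pder_green_causal.
exact: (green_smooth HG _ z0).1.
Qed.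

Lemma green_causal_kernel i : causal_kernel (pder (idx i) G).
Proof.
apply: causal_kernelP; first exact: green_regular.
exact: (green_integrable HG (sdeg_idx i)).
Qed.

Lemma zero_kernel : causal_kernel (fun _ : ST => 0 : R).
Proof.
have R0 : causal_regular (fun _ : ST => 0 : R) by split => // z _; exact: cont_at_cst.
apply: (kernel_mass_le R0 (b := fun=> 0)) => [|r _].
  exact: integrable0.
rewrite /kernel_mass; have -> : (fun y : 'rV[R]_d => `|0 : R|) = fun=> 0.
  by apply/funext => y; rewrite normr0.
by rewrite tint0.
Qed.

Lemma pderivs0 s : pderivs s (fun _ : ST => 0 : R) = fun=> 0.
Proof.
elim: s => //= i s ->; apply/funext => z.
exact: (derive_cst (0 : R)).
Qed.

(** The factor [1 - chi] lies between zero and one, so the mass is at most that of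
    the Green kernel. *)
Lemma green_cutoff_kernel i :
  causal_kernel (pder (idx i) (fun z => G z - Gmu S mu z)).
Proof.
have [m0|m0] := eqVneq mu 0.
  have -> : (fun z => G z - Gmu S mu z) = fun=> 0.
    by apply/funext => z; rewrite /Gmu m0 eqxx subrr.
  by rewrite /pder pderivs0; exact: zero_kernel.
pose c (t : R) : R := 1 - chi S (t / mu ^+ 2).
have -> : (fun z => G z - Gmu S mu z) = fun z => c (time z) * G z.
  by apply/funext => z; rewrite /Gmu (negbTE m0) /c mulrBl mul1r.
have E : pder (idx i) (fun z => c (time z) * G z) =
    fun z => c (time z) * pder (idx i) G z.
  by apply/funext => z; exact: pder_time_mul.
have cc t : cont_at c t.
  rewrite /c; apply: (@cont_at_add R R (fun=> 1) (fun t => - chi S (t / mu ^+ 2))).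
    exact: cont_at_cst.
  apply: cont_at_opp.
  apply: (@cont_at_comp _ _ _ (fun t : R => t / mu ^+ 2) (chi S)).
    by apply: (cont_at_mul (f := id)); [exact: cont_at_id|exact: cont_at_cst].
  exact: chi_cont.
rewrite E.
have reg : causal_regular (fun z => c (time z) * pder (idx i) G z).
  split=> z z0; first by rewrite pder_green_causal// mulr0.
  apply: cont_at_mul; last exact: (kernel_cont (green_regular i)).
  by apply: (cont_at_comp _ (cc _)); exact: cont_at_time.
apply: (kernel_mass_le reg (green_causal_kernel i).2) => r.
rewrite /= in_itv /= => /andP[r0 _].
apply: le_tint; [exact: (@mass_cont _ _ _ reg r)|exact: (@mass_cont _ _ _ (green_regular i) r)|].
move=> y; rewrite time_stpoint normrM ler_piMl//.
  have /chi_le1 /andP[h0 h1] : 0 <= r / mu ^+ 2.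
    by rewrite divr_ge0 ?sqr_ge0// ltW.
  by rewrite /c ger0_norm ?subr_ge0// lerBlDr lerDl.
Qed.

(** At a fixed positive time the cutoff equals one for all small [m]: [Gmu S m z]
    is locally constant in [m]. *)
Lemma dGmu_mu0 : mu = 0 -> dGmu S mu = fun=> 0.
Proof.
move=> m0; apply/funext => z; rewrite /dGmu derive1E m0.
suff E : \forall m \near (0 : R), Gmu S m z = cst (G z) m.
  by rewrite (near_eq_derive _ E) derive_cst.
have [z0|z0] := ltP 0 (time z); last first.
  by near=> m; rewrite /Gmu; case: ifP => // _; rewrite /= -/G !(green_causal HG)// mulr0.
have e0 : 0 < Num.min 1 (time z / 2) by rewrite lt_min ltr01 divr_gt0.
near=> m; rewrite /Gmu; case: eqP => [//|/eqP m1].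
rewrite (cutoff1 Hchi) ?mul1r// ler_pdivlMr ?exprn_even_gt0//.
have : `|m| < Num.min 1 (time z / 2).
  near: m; apply/nbhs_ballP; exists (Num.min 1 (time z / 2)) => // y.
  by rewrite -ball_normE /= sub0r normrN.
rewrite lt_min => /andP[m2 m3].
have : `|m| ^+ 2 <= `|m| by rewrite expr2 ler_piMl// ltW.
rewrite real_normK ?num_real// => m4.
by rewrite mulrC -ler_pdivlMr// (le_trans m4)// ltW.
Unshelve. all: by end_near. Qed.

Lemma dGmu_early z : mu != 0 -> time z < mu ^+ 2 -> dGmu S mu z = 0.
Proof.
move=> m0 zm; rewrite /dGmu derive1E.
suff E : \forall m \near mu, Gmu S m z = cst (0 : R) m.
  by rewrite (near_eq_derive _ E) derive_cst.
have [z0|z0] := ltP 0 (time z); last first.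
  by near=> m; rewrite /Gmu -/G (green_causal HG)// mulr0; case: ifP.
have sqc : (m ^+ 2) @[m --> mu] --> mu ^+ 2 by exact: exprn_continuous.
near=> m; have m1 : time z < m ^+ 2 by near: m; exact: cvgr_gt sqc _ zm.
have mm : m != 0.
  by apply/eqP => mE; move: m1; rewrite mE expr0n /= ltNge ltW.
rewrite /Gmu (negbTE mm) (cutoff0 Hchi) ?mul0r//.
rewrite divr_ge0 ?sqr_ge0 ?(ltW z0)//= ler_pdivrMr ?mul1r ?(ltW m1)//.
by rewrite exprn_even_gt0.
Unshelve. all: by end_near. Qed.

Lemma dGmu_chain : mu != 0 -> exists k : R, forall z,
  dGmu S mu z = derive1 (chi S) ((mu ^+ 2)^-1 * time z) * (k * time z) * G z.
Proof.
move=> m0.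
have sqd : derivable (fun m : R => (m ^+ 2)^-1) mu 1.
  apply: derivableV; first by rewrite sqrf_eq0.
  by have := @exprn_derivable R 2 mu 1; apply.
exists (derive1 (fun m : R => (m ^+ 2)^-1) mu) => z; rewrite /dGmu.
have D : is_derive mu 1 (fun m : R => chi S (time z * (m ^+ 2)^-1))
   (derive1 (chi S) (time z * (mu ^+ 2)^-1) * (time z *: derive1 (fun m : R => (m ^+ 2)^-1) mu)).
  apply: is_derive1_comp; last first.
    by rewrite derive1E; exact: (is_deriveZ (time z) (derivableP sqd)).
  by rewrite derive1E; apply: derivableP; exact: chi_derivable.
suff E : \forall m \near mu, Gmu S m z = (G z *: (fun m : R => chi S (time z * (m ^+ 2)^-1))) m.
  rewrite derive1E (near_eq_derive _ E).
  have [_ ->] := is_deriveZ (G z) D.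
  by rewrite /GRing.scale /= mulrC [time z * _^-1]mulrC [time z * derive1 _ _]mulrC.
near=> m; rewrite /Gmu.
have -> : (m == 0) = false by apply/negbTE; near: m; exact: cvgr_neq0 cvg_id m0.
by rewrite mulrC.
Unshelve. all: by end_near. Qed.

Lemma dGmu_smooth : mu != 0 -> smooth_on [set z : ST | 0 < time z] (dGmu S mu).
Proof.
move=> m0; have [k Hk] := dGmu_chain m0.
have cs := smooth1_derive1 (cutoff_smooth Hchi).
apply: (@smooth_on_eq _ _ _ (fun z => (derive1 (chi S) ((mu ^+ 2)^-1 * time z) *
   (k * time z)) * G z) _ open_pos); first by move=> w _; rewrite Hk.
apply: (smooth_onM open_pos); last exact: green_smooth HG.
apply: (smooth_onM open_pos); first exact: smooth_on_time.
exact: (@smooth_on_time R d (@id R) k _ (@smooth1_id R)).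
Qed.

Lemma dGmu_periodic : space_periodic (dGmu S mu).
Proof.
move=> z j; rewrite /dGmu; congr (derive1 _ mu); apply/funext => m.
rewrite /Gmu -/G (green_periodic HG); congr (if _ then _ else chi S (_ / _) * _).
by rewrite /time !mxE /= addr0.
Qed.

(** For nonzero [mu], [dGmu S mu] vanishes for times below [mu ^+ 2], hence near the
    singularity of the Green kernel.  Its derivatives are therefore continuous everywhere, and
    bounded on the slab. *)
Lemma pder_dGmu_kernel a : causal_kernel (pder a (dGmu S mu)).
Proof.
have [m0|m0] := eqVneq mu 0.
  by rewrite dGmu_mu0// /pder pderivs0; exact: zero_kernel.
have mu2 : 0 < mu ^+ 2 by rewrite exprn_even_gt0.
have oE : open [set z : ST | time z < mu ^+ 2].
  apply: (@open_comp _ _ (@time R d) [set x : R | x < mu ^+ 2]); last exact: open_lt.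
  by move=> z _; exact: cont_at_time.
have early z : time z < mu ^+ 2 -> pder a (dGmu S mu) z = 0.
  move=> zm; rewrite /pder (@pderivs_eq_on _ _ _ _ (fun=> 0) _ z oE _ zm) ?pderivs0//.
  by move=> w wm; exact: dGmu_early.
have Kc z : cont_at (pder a (dGmu S mu)) z.
  have [z0|z0] := ltP 0 (time z); first exact: (dGmu_smooth m0 _ z0).1.
  apply: (@cont_at_near _ _ (fun=> 0)); last exact: cont_at_cst.
  by apply: near_open oE (le_lt_trans z0 mu2) _ => w /early ->.
have reg : causal_regular (pder a (dGmu S mu)).
  by split=> z z0 //; exact: early (le_lt_trans z0 mu2).
have sc : slab_continuous (pder a (dGmu S mu)).
  apply: (slab_continuous_ext (cont_atP Kc)) => //.
  exact: space_periodic_pderivs dGmu_periodic.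
have [M M0 KM] := slab_continuous_bounded sc.
apply: (kernel_mass_le reg (b := fun=> tint (fun _ : 'rV[R]_d => M))) => [|r].
  have C : continuous ((fun=> tint (fun _ : 'rV[R]_d => M)) : R -> R).
    exact: (cont_atP (fun _ => @cont_at_cst _ _ _ _)).
  apply: (integrableS _ _ _ (integrable_unit C)) => //.
  by apply: subset_itv; rewrite bnd_simp.
rewrite /= in_itv /= => /andP[r0 r1]; apply: le_tint; first exact: (@mass_cont _ _ _ reg r).
  by apply: cont_atP => y; exact: cont_at_cst.
by move=> y; apply: KM; rewrite /slab /= time_stpoint ltW.
Qed.
End Kernels.

(** * Differentiable maps on continuous functions *)

Section Frechet.
Variables (R : realType) (d : nat).
Local Notation ST := (spacetime R d).
Local Notation jf := (jetfield R d).
Implicit Types (h f g : ST -> R) (z : ST) (a b : mindex d) (y L : (ST -> R) -> ST -> R).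

Lemma good_ext L f g z : good_op L -> slab_continuous f -> slab_continuous g ->
  (forall w, slab R d w -> f w = g w) -> slab R d z -> L f z = L g z.
Proof.
move=> gL fc gc fg zs; have [C C0 HC] := good_bound gL.
have dc : slab_continuous (fun w => -1 * g w + f w).
  apply: slab_continuousD => //; apply: slab_continuousM => //.
  exact: slab_continuous_cst.
have d0 : slab_bounded 0 (fun w => -1 * g w + f w).
  by move=> w ws; rewrite fg// mulN1r addNr normr0.
have := HC _ _ dc d0 z zs; rewrite mulr0 (good_lin gL)// normr_le0 mulN1r addrC subr_eq0.
by move/eqP.
Qed.

Lemma good_sum L (I : eqType) (r : seq I) (F : I -> ST -> R) z : good_op L ->
  (forall i, i \in r -> slab_continuous (F i)) -> slab R d z ->
  L (fun w => \sum_(i <- r) F i w) z = \sum_(i <- r) L (F i) z.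
Proof.
move=> gL + zs; elim: r => [|i r IH] Fc.
  have := good_lin gL 1 (@slab_continuous_cst R d 0) (@slab_continuous_cst R d 0) zs.
  under eq_fun do rewrite mulr0 addr0.
  rewrite mul1r big_nil; under [in X in _ -> X]eq_fun do rewrite big_nil.
  by move=> /eqP; rewrite -subr_eq0 opprD addrA subrr sub0r oppr_eq0 => /eqP.
have Fr j : j \in r -> slab_continuous (F j) by move=> jr; apply: Fc; rewrite in_cons jr orbT.
have := good_lin gL 1 (Fc i (mem_head _ _)) (slab_continuous_sum Fr) zs.
rewrite big_cons -IH// mul1r => <-; congr (L _ z); apply/funext => w.
by rewrite mul1r big_cons.
Qed.

Lemma good_scale L c f z : good_op L -> slab_continuous f -> slab R d z ->
  L (fun w => c * f w) z = c * L f z.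
Proof.
move=> gL fc zs.
have := good_lin gL c fc (@slab_continuous_cst R d 0) zs.
under eq_fun do rewrite addr0.
have := @good_sum L _ [::] (fun _ : unit => f) z gL (fun _ _ => fc) zs.
by rewrite big_nil; under eq_fun do rewrite big_nil; move=> -> ->; rewrite addr0.
Qed.

(** [L] is the derivative of [y] at [0] for the uniform norm.  A quadratic
    remainder, rather than [o(h)], is stable under products and operators without
    any choice of radii. *)
Record fdiff y L : Prop := FDiff {
  fd_cont : forall h, slab_continuous h -> slab_continuous (y h);
  fd_lcont : forall h, slab_continuous h -> slab_continuous (L h);
  fd_lin : forall c h1 h2 z, slab_continuous h1 -> slab_continuous h2 ->
    slab R d z -> L (fun w => c * h1 w + h2 w) z = c * L h1 z + L h2 z;
  fd_bound : exists2 C, 0 <= C & forall h m, slab_continuous h ->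
    slab_bounded m h -> slab_bounded (C * m) (L h);
  fd_rem : exists2 C, 0 <= C & forall h m, slab_continuous h ->
    slab_bounded m h -> m <= 1 ->
    slab_bounded (C * m ^+ 2) (fun z => y h z - y (fun=> 0) z - L h z) }.

Let CC0 : slab_continuous ((fun=> 0) : ST -> R). Proof. exact: slab_continuous_cst. Qed.

Let slab0 : slab R d 0.
Proof. by rewrite /slab /= /time mxE lexx ler01. Qed.

Let bound_ge0 m h : slab_bounded m h -> 0 <= m.
Proof. by move=> hm; exact: le_trans (hm 0 slab0). Qed.

Lemma fdiff_cst f : slab_continuous f -> fdiff (fun _ => f) (fun _ _ => 0).
Proof.
move=> fc; split=> //.
- by move=> *; rewrite mulr0 addr0.
- exists 0 => // h m _ _ z _; by rewrite normr0 mul0r.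
- exists 0 => // h m _ _ _ z _; by rewrite mul0r subrr subr0 normr0.
Qed.

Lemma fdiff_id b a f : slab_continuous f ->
  fdiff (fun h z => f z + (b == a)%:R * h z) (fun h z => (b == a)%:R * h z).
Proof.
move=> fc.
have kc h : slab_continuous h -> slab_continuous (fun z => (b == a)%:R * h z).
  by move=> hc; apply: slab_continuousM => //; exact: slab_continuous_cst.
split=> //.
- by move=> h hc; apply: slab_continuousD => //; exact: kc.
- by move=> c h1 h2 z _ _ _; rewrite mulrDr mulrCA.
- exists 1 => // h m hc hm z zs; rewrite mul1r normrM.
  rewrite (le_trans _ (hm z zs))// ler_piMl// ger0_norm ?ler0n//.
  by case: (b == a).
- exists 0 => // h m hc hm m1 z zs.
  rewrite (_ : _ - _ = 0) ?normr0 ?mul0r//; ring.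
Qed.

Lemma fdiffD y1 L1 y2 L2 : fdiff y1 L1 -> fdiff y2 L2 ->
  fdiff (fun h z => y1 h z + y2 h z) (fun h z => L1 h z + L2 h z).
Proof.
move=> D1 D2; split.
- by move=> h hc; apply: slab_continuousD; [exact: fd_cont D1 _ hc|exact: fd_cont D2 _ hc].
- by move=> h hc; apply: slab_continuousD; [exact: fd_lcont D1 _ hc|exact: fd_lcont D2 _ hc].
- move=> c h1 h2 z c1 c2 zs; rewrite (fd_lin D1)// (fd_lin D2)//; ring.
- have [C1 C10 H1] := fd_bound D1; have [C2 C20 H2] := fd_bound D2.
  exists (C1 + C2); first exact: addr_ge0.
  move=> h m hc hm z zs; rewrite (le_trans (ler_normD _ _))// mulrDl.
  by rewrite lerD ?(H1 _ _ hc hm)// (H2 _ _ hc hm).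
- have [C1 C10 H1] := fd_rem D1; have [C2 C20 H2] := fd_rem D2.
  exists (C1 + C2); first exact: addr_ge0.
  move=> h m hc hm m1 z zs; rewrite mulrDl.
  rewrite (_ : _ - _ = (y1 h z - y1 (fun=> 0) z - L1 h z) +
    (y2 h z - y2 (fun=> 0) z - L2 h z)); last by ring.
  by rewrite (le_trans (ler_normD _ _))// lerD ?(H1 _ _ hc hm m1)// (H2 _ _ hc hm m1).
Qed.

Lemma fdiffM y1 L1 y2 L2 : fdiff y1 L1 -> fdiff y2 L2 ->
  fdiff (fun h z => y1 h z * y2 h z)
        (fun h z => L1 h z * y2 (fun=> 0) z + y1 (fun=> 0) z * L2 h z).
Proof.
move=> D1 D2.
have c10 := fd_cont D1 CC0; have c20 := fd_cont D2 CC0.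
have [M1 M10 B1] := slab_continuous_bounded c10.
have [M2 M20 B2] := slab_continuous_bounded c20.
have [C1 C10 H1] := fd_bound D1; have [C2 C20 H2] := fd_bound D2.
split.
- by move=> h hc; apply: slab_continuousM; [exact: fd_cont D1 _ hc|exact: fd_cont D2 _ hc].
- move=> h hc; apply: slab_continuousD; apply: slab_continuousM => //.
    exact: fd_lcont D1 _ hc.
  exact: fd_lcont D2 _ hc.
- move=> c h1 h2 z c1 c2 zs; rewrite (fd_lin D1)// (fd_lin D2)//; ring.
- exists (C1 * M2 + M1 * C2); first by rewrite addr_ge0// mulr_ge0.
  move=> h m hc hm z zs; rewrite (le_trans (ler_normD _ _))// mulrDl !normrM.
  rewrite -mulrA [M2 * m]mulrC mulrA -[M1 * C2 * m]mulrA.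
  by rewrite lerD// ler_pM// ?B1 ?B2 ?(H1 _ _ hc hm) ?(H2 _ _ hc hm).
- have [E1 E10 R1] := fd_rem D1; have [E2 E20 R2] := fd_rem D2.
  exists (E1 * (M2 + C2 + E2) + (M1 + C1) * E2 + C1 * C2).
    by rewrite !addr_ge0// mulr_ge0// !addr_ge0.
  move=> h m hc hm m1 z zs; have m0 := bound_ge0 hm.
  have m2 : m ^+ 2 <= 1 by rewrite exprn_ile1.
  set u1 := y1 (fun=> 0) z; set u2 := y2 (fun=> 0) z.
  set r1 := y1 h z - u1 - L1 h z; set r2 := y2 h z - u2 - L2 h z.
  have -> : y1 h z * y2 h z - u1 * u2 - (L1 h z * u2 + u1 * L2 h z) =
    r1 * (u2 + L2 h z + r2) + (u1 + L1 h z) * r2 + L1 h z * L2 h z.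
    by rewrite /r1 /r2; ring.
  have b1 : `|L1 h z| <= C1 * m := H1 _ _ hc hm z zs.
  have b2 : `|L2 h z| <= C2 * m := H2 _ _ hc hm z zs.
  have d1 : `|r1| <= E1 * m ^+ 2 := R1 _ _ hc hm m1 z zs.
  have d2 : `|r2| <= E2 * m ^+ 2 := R2 _ _ hc hm m1 z zs.
  have a1 : `|u1| <= M1 := B1 z zs.
  have a2 : `|u2| <= M2 := B2 z zs.
  rewrite (le_trans (ler_normD _ _))// [leRHS]mulrDl lerD//; last first.
    by rewrite normrM expr2 mulrACA ler_pM.
  rewrite (le_trans (ler_normD _ _))// [leRHS]mulrDl lerD//.
    rewrite normrM mulrAC ler_pM// (le_trans (ler_normD _ _))// lerD//.
      by rewrite (le_trans (ler_normD _ _))// lerD// (le_trans b2)// ler_piMr.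
    by rewrite (le_trans d2)// ler_piMr.
  rewrite normrM -mulrA ler_pM// (le_trans (ler_normD _ _))// lerD//.
  by rewrite (le_trans b1)// ler_piMr.
Qed.

Lemma fdiff_op (K : (ST -> R) -> ST -> R) y L : good_op K -> fdiff y L ->
  fdiff (fun h => K (y h)) (fun h => K (L h)).
Proof.
move=> gK D; have [C C0 HC] := good_bound gK.
have c0 := fd_cont D CC0.
split.
- by move=> h hc; apply: (good_cont gK); exact: fd_cont D _ hc.
- by move=> h hc; apply: (good_cont gK); exact: fd_lcont D _ hc.
- move=> c h1 h2 z c1 c2 zs.
  have l1 := fd_lcont D c1; have l2 := fd_lcont D c2.
  rewrite -(good_lin gK)//; apply: good_ext => //.
  + apply: (fd_lcont D); apply: slab_continuousD => //; apply: slab_continuousM => //.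
    exact: slab_continuous_cst.
  + apply: slab_continuousD => //; apply: slab_continuousM => //.
    exact: slab_continuous_cst.
  + by move=> w ws; rewrite (fd_lin D).
- have [C1 C10 H1] := fd_bound D; exists (C * C1); first exact: mulr_ge0.
  move=> h m hc hm; rewrite -mulrA; apply: HC; first exact: fd_lcont D _ hc.
  exact: H1.
- have [C1 C10 H1] := fd_rem D; exists (C * C1); first exact: mulr_ge0.
  move=> h m hc hm m1 z zs; rewrite -mulrA.
  have lc := fd_lcont D hc; have yc := fd_cont D hc.
  have sc : slab_continuous (fun w => -1 * y (fun=> 0) w + y h w).
    apply: slab_continuousD => //; apply: slab_continuousM => //.
    exact: slab_continuous_cst.
  have rc : slab_continuous (fun w => -1 * L h w + (-1 * y (fun=> 0) w + y h w)).
    apply: slab_continuousD => //; apply: slab_continuousM => //.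
    exact: slab_continuous_cst.
  have -> : K (y h) z - K (y (fun=> 0)) z - K (L h) z =
      K (fun w => -1 * L h w + (-1 * y (fun=> 0) w + y h w)) z.
    by rewrite (good_lin gK)// (good_lin gK)//; ring.
  apply: HC => // w ws.
  rewrite (_ : -1 * _ + _ = y h w - y (fun=> 0) w - L h w); last by ring.
  exact: H1.
Qed.

End Frechet.

(** * Functionals of a family of fields *)

Section Calculus.
Variables (R : realType) (d : nat).
Local Notation ST := (spacetime R d).
Local Notation jf := (jetfield R d).
Implicit Types (h f g : ST -> R) (z : ST) (a b : mindex d) (Z H : jf).

Definition slab_field Z := forall a, slab_continuous (Z a).

Definition single a h : jf := fun b z => (b == a)%:R * h z.

(** The variables on which [\partial^k D_b \Upsilon^l] depends when [k] is in the
    image of [idx]. *)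
Definition box2 : seq (mindex d) :=
  undup [seq idx i + idx j | i <- enum 'I_d.+1, j <- enum 'I_d.+1].

Lemma box2_add i j : idx i + idx j \in box2.
Proof. by rewrite mem_undup; apply/allpairsP; exists (i, j); rewrite !mem_enum. Qed.

Lemma box2_idx i : idx i \in box2.
Proof. by rewrite -[idx i]addr0 -idx0 box2_add. Qed.

Lemma slab_field_single a h : slab_continuous h -> slab_field (single a h).
Proof. by move=> hc b; apply: slab_continuousM => //; exact: slab_continuous_cst. Qed.

Lemma perturbE a h Z b z : perturb a h Z b z = Z b z + (b == a)%:R * h z.
Proof. by rewrite /perturb; case: eqP; rewrite ?mul1r ?mul0r ?addr0. Qed.

Lemma perturb0 a Z : perturb a (fun=> 0) Z = Z.
Proof. by do 2 apply/funext => ?; rewrite perturbE mulr0 addr0. Qed.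

Lemma slab_field_perturb a h Z : slab_continuous h -> slab_field Z ->
  slab_field (perturb a h Z).
Proof.
move=> hc Zc b; have -> : perturb a h Z b = fun z => Z b z + (b == a)%:R * h z.
  by apply/funext => z; exact: perturbE.
by apply: slab_continuousD => //; apply: slab_continuousM => //; exact: slab_continuous_cst.
Qed.

Section AtField.
Variable Z : jf.
Hypothesis Zc : slab_field Z.

(** [dY] is the derivative of [Y] at [Z] along a family of increments.  Its
    restriction to one variable is a partial derivative in the sense of [fdiff],
    and only the finitely many variables of [box2] matter. *)
Record gdiff (Y dY : jf -> ST -> R) : Prop := GDiff {
  gd_partial : forall a, fdiff (fun h => Y (perturb a h Z)) (fun h => dY (single a h));
  gd_cont : forall H, slab_field H -> slab_continuous (dY H);
  gd_sum : forall H z, slab_field H -> slab R d z ->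
    dY H z = \sum_(a <- box2) dY (single a (H a)) z }.

Lemma gd_val Y dY : gdiff Y dY -> slab_continuous (Y Z).
Proof.
move=> D; have := fd_cont (gd_partial D 0) (@slab_continuous_cst R d 0).
by rewrite perturb0.
Qed.

Lemma gdiff_cst f : slab_continuous f -> gdiff (fun _ => f) (fun _ _ => 0).
Proof.
move=> fc; split.
- by move=> a; exact: fdiff_cst.
- by move=> H _; exact: slab_continuous_cst.
- by move=> H z _ _; rewrite big1.
Qed.

Lemma gdiffD Y1 dY1 Y2 dY2 : gdiff Y1 dY1 -> gdiff Y2 dY2 ->
  gdiff (fun Z z => Y1 Z z + Y2 Z z) (fun H z => dY1 H z + dY2 H z).
Proof.
move=> D1 D2; split.
- by move=> a; apply: fdiffD; [exact: gd_partial D1 a|exact: gd_partial D2 a].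
- move=> H Hc; apply: slab_continuousD; [exact: gd_cont D1 _ Hc|exact: gd_cont D2 _ Hc].
- by move=> H z Hc zs; rewrite (gd_sum D1)// (gd_sum D2)// -big_split.
Qed.

Lemma gdiffM Y1 dY1 Y2 dY2 : gdiff Y1 dY1 -> gdiff Y2 dY2 ->
  gdiff (fun Z z => Y1 Z z * Y2 Z z)
        (fun H z => dY1 H z * Y2 Z z + Y1 Z z * dY2 H z).
Proof.
move=> D1 D2; split.
- move=> a; have := fdiffM (gd_partial D1 a) (gd_partial D2 a).
  by rewrite perturb0.
- move=> H Hc; apply: slab_continuousD; apply: slab_continuousM.
  + exact: gd_cont D1 _ Hc.
  + exact: gd_val D2.
  + exact: gd_val D1.
  + exact: gd_cont D2 _ Hc.
- move=> H z Hc zs; rewrite (gd_sum D1)// (gd_sum D2)// mulr_suml mulr_sumr.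
  by rewrite -big_split.
Qed.

Lemma gdiff_sum (I : eqType) (r : seq I) (Y dY : I -> jf -> ST -> R) :
  (forall i, i \in r -> gdiff (Y i) (dY i)) ->
  gdiff (fun Z z => \sum_(i <- r) Y i Z z) (fun H z => \sum_(i <- r) dY i H z).
Proof.
elim: r => [|i r IH] D.
  have -> : (fun (Z : jf) z => \sum_(i <- [::]) Y i Z z) = fun _ _ => 0.
    by do 2 apply/funext => ?; rewrite big_nil.
  have -> : (fun (Z : jf) z => \sum_(i <- [::]) dY i Z z) = fun _ _ => 0.
    by do 2 apply/funext => ?; rewrite big_nil.
  exact/gdiff_cst/slab_continuous_cst.
have -> : (fun (Z : jf) z => \sum_(i <- i :: r) Y i Z z) =
    fun Z z => Y i Z z + \sum_(i <- r) Y i Z z.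
  by do 2 apply/funext => ?; rewrite big_cons.
have -> : (fun (Z : jf) z => \sum_(i <- i :: r) dY i Z z) =
    fun Z z => dY i Z z + \sum_(i <- r) dY i Z z.
  by do 2 apply/funext => ?; rewrite big_cons.
apply: gdiffD; first exact/D/mem_head.
by apply: IH => j jr; apply: D; rewrite in_cons jr orbT.
Qed.

Lemma gdiff_op K Y dY : good_op K -> gdiff Y dY ->
  gdiff (fun Z => K (Y Z)) (fun H => K (dY H)).
Proof.
move=> gK D; split.
- by move=> a; exact: fdiff_op (gd_partial D a).
- by move=> H Hc; apply: (good_cont gK); exact: gd_cont D _ Hc.
- move=> H z Hc zs.
  have sc a : slab_continuous (dY (single a (H a))).
    by apply: (gd_cont D); exact: slab_field_single.
  rewrite -(good_sum gK)//; apply: good_ext => //.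
  + exact: gd_cont D _ Hc.
  + exact: slab_continuous_sum.
  + by move=> w ws; rewrite (gd_sum D).
Qed.

Lemma sum_box2 (F : mindex d -> R) b : b \in box2 ->
  \sum_(a <- box2) (b == a)%:R * F a = F b.
Proof.
move=> bb; rewrite (bigD1_seq b)//= ?undup_uniq// eqxx mul1r big1 ?addr0//.
by move=> a ab; rewrite eq_sym (negbTE ab) mul0r.
Qed.

Lemma gdiff_coord b : b \in box2 -> gdiff (fun Z z => Z b z) (fun H z => H b z).
Proof.
move=> bb; split.
- move=> a; have := fdiff_id b a (Zc b).
  suff -> : (fun h z => Z b z + (b == a)%:R * h z) = (fun h z => perturb a h Z b z) by [].
  by do 2 apply/funext => ?; rewrite perturbE.
- by move=> H Hc; exact: Hc.
- by move=> H z _ _; rewrite /single sum_box2.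
Qed.

Lemma gdiff_ext Y Y' dY dY' : (forall Z z, Y Z z = Y' Z z) ->
  (forall H z, dY H z = dY' H z) -> gdiff Y dY -> gdiff Y' dY'.
Proof.
move=> E1 E2.
have -> : Y = Y' by do 2 apply/funext => ?; exact: E1.
by have -> : dY = dY' by do 2 apply/funext => ?; exact: E2.
Qed.

Definition row_jet (W : mindex d -> R) : 'rV[R]_d.+1 := \row_i W (idx i).

Lemma is_derive_dir (N : ST -> R) u i (s : R) : smooth_on setT N ->
  is_derive (s : R) 1 (fun r : R => N (r *: delta_mx 0 i + u)) (pderiv i N (s *: delta_mx 0 i + u)).
Proof.
move=> Ns; have Nd := derivableP ((Ns [::] (s *: delta_mx 0 i + u) I).2 i).
have E : (fun h : R => h^-1 *: (((fun r : R => N (r *: delta_mx 0 i + u)) \o shift s) (h *: 1) -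
    N (s *: delta_mx 0 i + u))) =
    (fun h : R => h^-1 *: ((N \o shift (s *: delta_mx 0 i + u)) (h *: delta_mx 0 i) -
    N (s *: delta_mx 0 i + u))).
  by apply/funext => h /=; rewrite [h *: 1]mulr1 scalerDl addrA.
split; last by rewrite /derive E.
by have := (Ns [::] (s *: delta_mx 0 i + u) I).2 i; rewrite /derivable E.
Qed.

Lemma mvt_abs (f df : R -> R) (s : R) : (forall x : R, is_derive (x : R) 1 f (df x)) ->
  exists2 c, `|c| <= `|s| & f s - f 0 = df c * s.
Proof.
move=> fd.
have fc (x y : R) : {within `[x, y], continuous f}.
  apply: derivable_within_continuous => t _; by have [] := fd t.
have [s0|s0] := leP 0 s.
  have [c + E] := MVT_segment s0 (fun x _ => fd x) (fc 0 s).
  rewrite in_itv /= => /andP[c0 cs]; exists c; first by rewrite !ger0_norm.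
  by rewrite E subr0.
have [c + E] := MVT_segment (ltW s0) (fun x _ => fd x) (fc s 0).
rewrite in_itv /= => /andP[sc c0]; exists c.
  by rewrite !ler0_norm// ?(ltW s0)// lerN2.
by rewrite -opprB E sub0r mulrN opprK.
Qed.

Definition cube (M : R) : set ST := [set u | forall i, `|u 0 i| <= M].

Lemma compact_cube M : compact (cube M).
Proof.
have := (@rV_compact R d.+1 (fun=> `[- M, M]%classic)).
have -> : [set v : 'rV[R]_d.+1 | forall i, `[- M, M]%classic (v ord0 i)] = cube M.
  apply/seteqP; split=> u /= H i; have := H i; rewrite in_itv /= ler_norml//.
by apply => i; exact: segment_compact.
Qed.

Lemma smooth_bounded_cube (N : ST -> R) M : smooth_on setT N ->
  exists2 C, 0 <= C & forall u, cube M u -> `|N u| <= C.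
Proof.
move=> Ns; have Nc : continuous N by move=> u; exact: (Ns [::] u I).1.
have /compact_bounded[C [_ HC]] :=
  continuous_compact (continuous_subspaceT Nc) (compact_cube (M := M)).
exists (`|C| + 1); first by rewrite addr_ge0.
move=> u uM; apply: HC => //=; last by exists u.
by rewrite (le_lt_trans (ler_norm _))// ltrDl.
Qed.

Lemma taylor2 (N : ST -> R) M i : smooth_on setT N ->
  exists2 C, 0 <= C & forall u s, cube M u -> `|s| <= 1 ->
    `|N (s *: delta_mx 0 i + u) - N u - pderiv i N u * s| <= C * s ^+ 2.
Proof.
move=> Ns.
have N1s : smooth_on setT (pderiv i N) by exact: (@smooth_on_pderivs R d setT N [:: i] Ns).
have N2s : smooth_on setT (pderiv i (pderiv i N)).
  exact: (@smooth_on_pderivs R d setT N [:: i; i] Ns).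
have [C C0 HC] := @smooth_bounded_cube _ (M + 1) N2s.
exists C => // u s uM s1.
have [c cs E] := mvt_abs s (fun x => is_derive_dir u i x Ns).
have [e ec E2] := mvt_abs c (fun x => is_derive_dir u i x N1s).
move: E E2; rewrite /= !scale0r !add0r => -> /eqP; rewrite subr_eq => /eqP ->.
rewrite mulrDl addrK !normrM -mulrA.
have es : `|e| <= `|s| := le_trans ec cs.
rewrite -[s ^+ 2]real_normK ?num_real// expr2 ler_pM// ?mulr_ge0 ?ler_pM//.
apply: HC => j; rewrite !mxE eqxx /= (le_trans (ler_normD _ _))// addrC lerD// normrM.
by case: eqP => _ /=; rewrite ?normr1 ?mulr1 ?normr0 ?mulr0 ?ler01// (le_trans es).
Qed.

Lemma slab_continuous_smooth (N : ST -> R) (W : jf) : smooth_on setT N -> slab_field W ->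
  slab_continuous (fun z => N (row_jet (W^~ z))).
Proof.
move=> Ns Wc.
apply: (@slab_continuous_ext _ _ (fun z => N (row_jet (W^~ (clamp z))))).
- apply: cont_atP => z; apply: (@cont_at_comp _ _ _ (fun z => row_jet (W^~ (clamp z))) N).
    apply: cont_at_rV => i.
    apply: (@cont_at_ext _ _ (fun z => W (idx i) (clamp z))).
      by move=> t; rewrite mxE.
    exact: within_slab_ext (Wc (idx i)).1 z.
  exact: (Ns [::] _ I).1.
- move=> z j; congr N; apply/rowP => i; rewrite !mxE; exact: (Wc (idx i)).2.
- by move=> z zs; rewrite clamp_id.
Qed.

Lemma slab_field_cube (W : jf) : slab_field W ->
  exists2 M, 0 <= M & forall z, slab R d z -> cube M (row_jet (W^~ z)).
Proof.
move=> Wc.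
have /choice[M HM] (i : 'I_d.+1) : exists M : R, 0 <= M /\ slab_bounded M (W (idx i)).
  by have [M M0 HM] := slab_continuous_bounded (Wc (idx i)); exists M.
exists (\sum_i M i); first by apply: sumr_ge0 => i _; exact: (HM i).1.
move=> z zs i; rewrite mxE (le_trans ((HM i).2 z zs))// (bigD1 i)//= lerDl.
by apply: sumr_ge0 => j _; exact: (HM j).1.
Qed.

Lemma gdiff_smooth (N : ST -> R) : smooth_on setT N ->
  gdiff (fun Z z => N (row_jet (Z^~ z)))
        (fun H z => \sum_i pderiv i N (row_jet (Z^~ z)) * H (idx i) z).
Proof.
move=> Ns.
have dNs i : smooth_on setT (pderiv i N) by exact: (@smooth_on_pderivs R d setT N [:: i] Ns).
have Pc i := slab_continuous_smooth (dNs i) Zc.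
split; last 2 first.
- move=> H Hc; apply: slab_continuous_sum => i _; exact: slab_continuousM.
- move=> H z Hc zs; rewrite exchange_big /=; apply: eq_bigr => i _.
  rewrite -mulr_sumr; congr (_ * _).
  by rewrite /single sum_box2// box2_idx.
move=> a.
have [[k ak]|na] := pselect (exists k, a = idx k); last first.
  have E1 h : (fun z => N (row_jet ((perturb a h Z)^~ z))) = fun z => N (row_jet (Z^~ z)).
    apply/funext => z; congr N; apply/rowP => i; rewrite !mxE perturbE.
    by case: eqP => [ia|]; [case: na; exists i|rewrite mul0r addr0].
  have E2 h : (fun z => \sum_i pderiv i N (row_jet (Z^~ z)) * single a h (idx i) z) = fun=> 0.
    apply/funext => z; rewrite big1// => i _; rewrite /single.
    by case: eqP => [ia|]; [case: na; exists i|rewrite mul0r mulr0].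
  under [X in fdiff X]eq_fun do rewrite E1.
  under [X in fdiff _ X]eq_fun do rewrite E2.
  by apply: fdiff_cst; exact: slab_continuous_smooth.
have E1 h z : row_jet ((perturb a h Z)^~ z) = h z *: delta_mx 0 k + row_jet (Z^~ z).
  apply/rowP => i; rewrite !mxE perturbE addrC ak eqxx /= (inj_eq (@idx_inj d)).
  by rewrite mulrC.
have E2 h z : \sum_i pderiv i N (row_jet (Z^~ z)) * single a h (idx i) z =
    pderiv k N (row_jet (Z^~ z)) * h z.
  rewrite (bigD1 k)//= big1 ?addr0; first by rewrite /single ak eqxx mul1r.
  by move=> i ik; rewrite /single ak (inj_eq (@idx_inj d)) (negbTE ik) mul0r mulr0.
have -> : (fun h z => \sum_i pderiv i N (row_jet (Z^~ z)) * single a h (idx i) z) =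
    fun h z => pderiv k N (row_jet (Z^~ z)) * h z.
  by do 2 apply/funext => ?; exact: E2.
have [M M0 HM] := slab_field_cube Zc.
split.
- move=> h hc; apply: slab_continuous_smooth => //; exact: slab_field_perturb.
- by move=> h hc; exact: slab_continuousM.
- by move=> c h1 h2 z _ _ _; rewrite mulrDr mulrCA.
- have [C C0 HC] := slab_continuous_bounded (Pc k).
  exists C => // h m hc hm z zs; rewrite normrM ler_pM ?normr_ge0//.
    exact: (HC z zs).
  exact: (hm z zs).
- have [C C0 HC] := @taylor2 N M k Ns.
  exists C => // h m hc hm m1 z zs.
  rewrite perturb0 E1 (le_trans (HC _ _ (HM z zs) _))//.
    by rewrite (le_trans (hm z zs)).
  rewrite ler_wpM2l// -[h z ^+ 2]real_normK ?num_real// ler_pXn2r ?nnegrE ?hm//.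
  exact: le_trans (hm z zs).
Qed.

End AtField.

(** Any linear map that satisfies the definition of a partial Fréchet derivative
    agrees with the one found by the calculus: their difference is linear and
    [o(h)], hence zero by scaling [h] down. *)
Lemma frechet_unique (Y : functional R d) (Z Zt : jf) a L h z :
  slab_field Z -> fdiff (fun h => Y (perturb a h Z) Zt) L ->
  slab_continuous h -> slab R d z -> frechet Y Z Zt a h z = L h z.
Proof.
move=> Zc D hc zs.
have isL : is_frechet Y Z Zt a L.
  split; first exact: fd_lin D.
    by have [C _ HC] := fd_bound D; exists C.
  move=> e e0; have [C C0 HC] := fd_rem D.
  (* within this radius the quadratic remainder is at most [e * m] *)
  exists (Num.min 1 (e / (C + 1))).
    by rewrite lt_min ltr01 divr_gt0// ltr_wpDl.
  move=> g m gc gm; rewrite le_min => /andP[m1 m2] w ws.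
  have m0 : 0 <= m by exact: le_trans (gm w ws).
  have := HC g m gc gm m1 w ws; rewrite perturb0 => /le_trans; apply.
  rewrite expr2 mulrA ler_wpM2r//.
  rewrite ler_pdivlMr ?ltr_wpDl// in m2.
  by rewrite (le_trans _ m2)// mulrC ler_wpM2l// lerDl.
have [l1 _ l3] : is_frechet Y Z Zt a (frechet Y Z Zt a).
  by rewrite /frechet; case: xgetP => [L' ->//|/(_ L)].
have [_ _ L3] := isL.
have [M M0 HM] := slab_continuous_bounded hc.
apply/eqP; rewrite -subr_eq0 -normr_le0.
apply/ler_addgt0Pr => e e0; rewrite add0r.
have e1 : 0 < e / (2 * (M + 1)) by rewrite divr_gt0// mulr_gt0// ltr_wpDl.
have [r1 r10 H1] := l3 _ e1; have [r2 r20 H2] := L3 _ e1.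
(* [t] scales [h] into the balls where both remainders are small *)
pose t := Num.min r1 r2 / (M + 1).
have t0 : 0 < t by rewrite divr_gt0 ?lt_min ?r10// ltr_wpDl.
pose th := fun w => t * h w + 0.
have c0 : slab_continuous ((fun=> 0) : ST -> R) by exact: slab_continuous_cst.
have thc : slab_continuous th.
  by apply: slab_continuousD => //; apply: slab_continuousM => //; exact: slab_continuous_cst.
have thm : slab_bounded (t * (M + 1)) th.
  move=> w ws; rewrite /th addr0 normrM gtr0_norm// ler_pM2l//.
  by rewrite (le_trans (HM w ws))// lerDl.
have tM : t * (M + 1) = Num.min r1 r2 by rewrite divfK// gt_eqF// ltr_wpDl.
have b1 := H1 _ _ thc thm _ z zs; have b2 := H2 _ _ thc thm _ z zs.
move: b1 b2; rewrite tM !ge_min !lexx orbT => /(_ isT) b1 /(_ isT) b2.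
have E (K : (ST -> R) -> ST -> R) :
    (forall c h1 h2 z, slab_continuous h1 -> slab_continuous h2 ->
      slab R d z -> K (fun w => c * h1 w + h2 w) z = c * K h1 z + K h2 z) ->
    K th z = t * K h z.
  move=> Kl; rewrite /th Kl//; have := Kl 1 _ _ z c0 c0 zs.
  have -> : (fun w : ST => 1 * 0 + 0 : R) = fun=> 0 by apply/funext => w; rewrite mul1r addr0.
  by rewrite mul1r => /eqP; rewrite -subr_eq0 opprD addrA subrr sub0r oppr_eq0 => /eqP ->; rewrite addr0.
rewrite E in b1 => //; rewrite E in b2; last exact: fd_lin D.
set A := frechet Y Z Zt a h z in b1 *; set B := L h z in b2 *.
have : t * `|A - B| <= t * e.
  rewrite -[X in X * `|_|](gtr0_norm t0) -normrM.
  set y := Y (perturb a th Z) Zt z - Y Z Zt z in b1 b2.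
  rewrite (_ : t * (A - B) = (y - t * B) - (y - t * A)); last by ring.
  rewrite (le_trans (ler_normB _ _))// (le_trans (lerD b2 b1))//.
  rewrite -tM (_ : _ + _ = t * e)//; field.
  by rewrite gt_eqF// ltr_wpDl.
by rewrite ler_pM2l.
Qed.

End Calculus.

(** * Derivatives of the nonlinearities *)

Section Schwarz.
Variables (R : realType) (d : nat).
Local Notation ST := (spacetime R d).
Implicit Types (N : ST -> R).

(** The mean value theorem, once in each direction. *)
Lemma second_difference N i j (u : ST) (s t : R) : smooth_on setT N ->
  exists c e : R, [/\ `|c| <= `|s|, `|e| <= `|t| &
    N (s *: delta_mx 0 i + (t *: delta_mx 0 j + u)) - N (s *: delta_mx 0 i + u) -
    (N (t *: delta_mx 0 j + u) - N u) =
    pderiv j (pderiv i N) (e *: delta_mx 0 j + (c *: delta_mx 0 i + u)) * t * s].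
Proof.
move=> Ns.
have N1s : smooth_on setT (pderiv i N) by exact: (@smooth_on_pderivs R d setT N [:: i] Ns).
have D (x : R) : is_derive (x : R) 1
    (fun x : R => N (x *: delta_mx 0 i + (t *: delta_mx 0 j + u)) - N (x *: delta_mx 0 i + u))
    (pderiv i N (x *: delta_mx 0 i + (t *: delta_mx 0 j + u)) -
     pderiv i N (x *: delta_mx 0 i + u)).
  exact: (is_deriveB (is_derive_dir (t *: delta_mx 0 j + u) i x Ns) (is_derive_dir u i x Ns)).
have [c cs E] := mvt_abs s D.
have [e et E2] := mvt_abs t (fun x => is_derive_dir (c *: delta_mx 0 i + u) j x N1s).
exists c, e; split => //.
move: E E2 => /=; rewrite !scale0r !add0r => E E2.
have E0 : c *: delta_mx 0 i + (t *: delta_mx 0 j + u) =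
    t *: delta_mx 0 j + (c *: delta_mx 0 i + u) :> ST by exact: addrCA.
by apply: (etrans E); rewrite E0; congr (_ * s); exact: E2.
Qed.

(** Schwarz' theorem.  The mixed second difference is symmetric in [i] and [j], and
    by [second_difference] it is a value, near [u], of either mixed derivative. *)
Lemma pderivC N i j : smooth_on setT N ->
  pderiv i (pderiv j N) = pderiv j (pderiv i N).
Proof.
move=> Ns; apply/funext => u.
have sm p q : smooth_on setT (pderiv q (pderiv p N)).
  exact: (@smooth_on_pderivs R d setT N [:: q; p] Ns).
have near_small p q e : 0 < e -> exists2 r, 0 < r & forall c k : R,
    `|c| < r -> `|k| < r ->
    `|pderiv q (pderiv p N) u -
      pderiv q (pderiv p N) (k *: delta_mx 0 q + (c *: delta_mx 0 p + u))| < e.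
  move=> e0; have C := (sm p q [::] u I).1.
  have [del /= del0 H] := proj1 (nbhs_ballP _ _)
    (proj1 (@cvgrPdist_lt _ _ _ (nbhs u) _ _ _) C e e0).
  exists (del / 2); first by rewrite /= divr_gt0.
  move=> c k cr kr; apply: H; rewrite -ball_normE /=.
  have -> : u - (k *: delta_mx 0 q + (c *: delta_mx 0 p + u)) =
      - (k *: delta_mx 0 q) - c *: delta_mx 0 p :> ST.
    by rewrite addrA [_ + u]addrC opprD addrA subrr sub0r opprD.
  rewrite (le_lt_trans (ler_normB _ _))// normrN.
  have nd (x : R) (m : 'I_d.+1) : `|x| < del / 2 -> `|x *: delta_mx 0 m : ST| < del / 2.
    move=> xd; rewrite [ltLHS]mx_normrE; apply/bigmax_ltP; split.
      exact: divr_gt0.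
    move=> [i' m'] _ /=; rewrite !mxE normrM ord1 eqxx /=.
    by case: (m' == m); rewrite ?normr1 ?mulr1// normr0 mulr0 divr_gt0.
  by rewrite [ltRHS]splitr ltrD// nd.
apply/eqP; rewrite -subr_eq0 -normr_le0; apply/ler_addgt0Pr => e e0; rewrite add0r.
have e20 : 0 < e / 2 by rewrite divr_gt0.
have tri (p q w : R) : `|p - w| < e / 2 -> `|q - w| < e / 2 -> `|p - q| <= e.
  move=> hp hq; have -> : p - q = (p - w) - (q - w) by ring.
  by rewrite (le_trans (ler_normB _ _))// [leRHS]splitr lerD// ltW.
have [r1 r10 H1] := near_small i j _ e20.
have [r2 r20 H2] := near_small j i _ e20.
pose s := Num.min r1 r2 / 2.
have s0 : 0 < s by rewrite divr_gt0// lt_min r10.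
have ss : `|s| < r1 /\ `|s| < r2.
  have s1 : s < Num.min r1 r2 by rewrite ltr_pdivrMr// mulr_natr mulr2n ltrDl lt_min r10.
  by rewrite gtr0_norm//; move: s1; rewrite lt_min => /andP[].
have [c [k [cs ks E]]] := second_difference i j u s s Ns.
have [c' [k' [cs' ks' E']]] := second_difference j i u s s Ns.
have EE : pderiv j (pderiv i N) (k *: delta_mx 0 j + (c *: delta_mx 0 i + u)) =
   pderiv i (pderiv j N) (k' *: delta_mx 0 i + (c' *: delta_mx 0 j + u)).
  have sn0 : s != 0 by rewrite gt_eqF.
  have swap (A1 A2 A3 A4 : R) : A1 - A2 - (A3 - A4) = A1 - A3 - (A2 - A4) by ring.
  have E0 : s *: delta_mx 0 j + (s *: delta_mx 0 i + u) =
    s *: delta_mx 0 i + (s *: delta_mx 0 j + u) :> ST by exact: addrCA.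
  apply: (mulIf sn0); apply: (mulIf sn0).
  apply: (etrans (esym E)); apply: (etrans _ E'); rewrite E0; exact: swap.
have h1 := H1 c k (le_lt_trans cs ss.1) (le_lt_trans ks ss.1).
have h2 := H2 c' k' (le_lt_trans cs' ss.2) (le_lt_trans ks' ss.2).
rewrite EE in h1.
exact: tri h2 h1.
Qed.

Lemma pderivs_move N s1 s2 i : smooth_on setT N ->
  pderivs (s1 ++ i :: s2) N = pderivs (i :: s1 ++ s2) N.
Proof.
move=> Ns; elim: s1 => [|j s1 IH]; first by [].
have C := pderivC j i (smooth_on_pderivs (s1 ++ s2) Ns).
by apply: etrans C; rewrite cat_cons; congr (pderiv j _); exact: IH.
Qed.

Lemma pderivs_perm N s s' : smooth_on setT N -> perm_eq s s' -> pderivs s N = pderivs s' N.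
Proof.
move=> Ns; elim: s s' => [|i s IH] s' ss'.
  by move: ss' => /perm_size/esym/size0nil ->.
have [s1 [s2 E]] : exists s1 s2, s' = s1 ++ i :: s2.
  have : i \in s' by rewrite -(perm_mem ss') mem_head.
  by case/splitPr => s1 s2; exists s1, s2.
have ss2 : perm_eq s (s1 ++ s2).
  by rewrite -(perm_cons i) (perm_trans ss')// E perm_catC /= perm_cons perm_catC.
by rewrite E pderivs_move//= (IH _ ss2).
Qed.

End Schwarz.

Lemma fsum_seq (V : nmodType) (T : choiceType) (r : seq T) (F : T -> V) : uniq r ->
  (forall a, a \notin r -> F a = 0) ->
  \sum_(a \in [set: T]) F a = \sum_(a <- r) F a.
Proof.
move=> ur Fr; rewrite [RHS]fsbig_seq//; apply: esym.
apply: (fsbig_widen [set` r] [set: T]) => // a [_ ar].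
by apply: Fr; exact/negP.
Qed.

Section Jets.
Variables (R : realType) (d : nat) (S : setting R d).
Hypothesis Ssm : forall l, smooth_on setT (nonlin S l).
Implicit Types (l : bool) (js : seq 'I_d.+1) (bs : seq (mindex d)) (Z : jet R d)
  (a : mindex d).

Definition node_fun l bs : jet R d -> R := foldr (@Dvar R d) (Upsilon S l) bs.

Lemma Dvar_node_fun a l bs : Dvar a (node_fun l bs) = node_fun l (a :: bs).
Proof. by []. Qed.

Lemma node_fun_idx l js :
  node_fun l [seq idx i | i <- js] = fun Z => pderivs js (nonlin S l) (row_jet Z).
Proof.
elim: js => [//|i js IH]; rewrite map_cons -Dvar_node_fun IH; apply/funext => Z.
rewrite /Dvar derive1E.
have -> : (fun s : R => pderivs js (nonlin S l) (row_jet (shift_jet (idx i) s Z))) =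
   fun s : R => pderivs js (nonlin S l) (s *: delta_mx 0 i + row_jet Z).
  apply/funext => s; congr (pderivs _ _); apply/rowP => k.
  rewrite !mxE /shift_jet (inj_eq (@idx_inj d)) eqxx /=.
  by case: eqP => _; rewrite ?mulr1 ?mulr0 ?add0r// addrC.
have Ns := smooth_on_pderivs js (Ssm l).
have [_ ->] := is_derive_dir (row_jet Z) i 0 Ns.
by rewrite scale0r add0r.
Qed.

Lemma Dvar0 a : Dvar a (fun _ : jet R d => 0 : R) = fun=> 0.
Proof. by apply/funext => Z; rewrite /Dvar derive1E; exact: (derive_cst (0 : R)). Qed.

(** [\Upsilon^l] only depends on the variables of index [idx i]. *)
Lemma node_fun_out l bs : ~~ all (fun b => sdeg b < 2)%N bs -> node_fun l bs = fun=> 0.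
Proof.
elim: bs => // b bs IH; rewrite [all _ _]/= negb_and -Dvar_node_fun.
  case: (boolP (all _ bs)) => [bsb|/IH ->].
  rewrite orbF => bb.
  have [js ->] : exists js, bs = [seq idx i | i <- js].
    elim: bs bsb {IH} => [|c bs IHc] /=; first by exists [::].
    by move=> /andP[/sdeg_lt2P[i ->] /IHc[js ->]]; exists (i :: js).
  rewrite node_fun_idx; apply/funext => Z; rewrite /Dvar derive1E.
  have -> : (fun s : R => pderivs js (nonlin S l) (row_jet (shift_jet b s Z))) =
      cst (pderivs js (nonlin S l) (row_jet Z)).
    apply/funext => s; congr (pderivs _ _); apply/rowP => k; rewrite !mxE /shift_jet.
    by case: eqP => // kb; move: bb; rewrite -kb sdeg_idx.
  exact: derive_cst.
by move=> _; exact: Dvar0.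
Qed.

Lemma node_funP l bs :
  (exists js, bs = [seq idx i | i <- js]) \/
  (~~ all (fun b => sdeg b < 2)%N bs /\ node_fun l bs = fun=> 0).
Proof.
case: (boolP (all (fun b => sdeg b < 2)%N bs)) => H; last first.
  by right; split => //; exact: node_fun_out.
left; elim: bs H => [|c bs IHc] /=; first by exists [::].
by move=> /andP[/sdeg_lt2P[i ->] /IHc[js ->]]; exists (i :: js).
Qed.

Lemma node_fun_perm l bs bs' : perm_eq bs bs' -> node_fun l bs = node_fun l bs'.
Proof.
move=> pb; have [[js E]|[n0 ->]] := node_funP l bs; last first.
  by rewrite node_fun_out// -(perm_all _ pb).
have [[js' E']|[n0 _]] := node_funP l bs'; last first.
  move: n0; rewrite -(perm_all _ pb) E => /negP[].
  by rewrite all_map; apply/allP => i _ /=; exact: sdeg_idx.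
rewrite E E' !node_fun_idx; apply/funext => Z.
rewrite (@pderivs_perm _ _ _ js js')//.
by move: pb; rewrite E E' => /perm_map_inj -> //; exact: idx_inj.
Qed.

Lemma total_deriv_node i l bs Z :
  total_deriv i (node_fun l bs) Z =
  \sum_j Z (idx j + unit_index i) * node_fun l (idx j :: bs) Z.
Proof.
rewrite /total_deriv (@fsum_seq _ _ [seq idx j | j <- enum 'I_d.+1]).
- by rewrite big_map big_enum.
- by rewrite map_inj_uniq ?enum_uniq//; exact: idx_inj.
- move=> a na; rewrite Dvar_node_fun node_fun_out ?mulr0//=.
  apply/negP => /andP[/sdeg_lt2P[i' ai'] _].
  by move: na; rewrite ai' map_f// mem_enum.
Qed.

(** [\partial^k F] for [F = D_bs Upsilon^l] and [k = idx i]. *)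
Definition node_val i l bs Z : R :=
  if i == ord0 then node_fun l bs Z
  else \sum_j Z (idx j + unit_index i) * node_fun l (idx j :: bs) Z.

Lemma total_derivs_idx i l bs Z :
  total_derivs (idx i) (node_fun l bs) Z = node_val i l bs Z.
Proof.
rewrite /total_derivs index_seq_idx /node_val; case: eqP => // _.
exact: total_deriv_node.
Qed.

(** The chain rule for [node_val]. *)
Definition node_dval i l bs Z (H : mindex d -> R) : R :=
  if i == ord0 then \sum_j node_fun l (idx j :: bs) Z * H (idx j)
  else \sum_j (H (idx j + unit_index i) * node_fun l (idx j :: bs) Z +
    Z (idx j + unit_index i) *
    \sum_m node_fun l (idx m :: idx j :: bs) Z * H (idx m)).

Lemma gdiff_node_fun (Z : jetfield R d) l bs : slab_field Z ->
  gdiff Z (fun W z => node_fun l bs (W^~ z))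
    (fun H z => \sum_j node_fun l (idx j :: bs) (Z^~ z) * H (idx j) z).
Proof.
move=> Zc; have [[js ->]|[n0 n00]] := node_funP l bs; last first.
  apply: (@gdiff_ext _ _ _ (fun _ _ => 0) _ (fun _ _ => 0)).
  - by move=> Z' z; rewrite n00.
  - move=> H z; rewrite big1// => j _; rewrite node_fun_out ?mul0r//=.
    by rewrite negb_and n0 orbT.
  - exact/gdiff_cst/slab_continuous_cst.
apply: gdiff_ext (gdiff_smooth Zc (smooth_on_pderivs js (Ssm l))).
  by move=> Z' z; rewrite node_fun_idx.
move=> H z; apply: eq_bigr => j _; congr (_ * _).
by have -> := node_fun_idx l (j :: js).
Qed.

Lemma gdiff_node_val (Z : jetfield R d) i l bs : slab_field Z ->
  gdiff Z (fun W z => node_val i l bs (W^~ z))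
    (fun H z => node_dval i l bs (Z^~ z) (H^~ z)).
Proof.
move=> Zc; rewrite /node_val /node_dval; case: eqP => [_|/eqP i0].
  exact: gdiff_node_fun.
apply: gdiff_sum => j _; apply: gdiffM => //; last exact: gdiff_node_fun.
have -> : unit_index i = idx i :> mindex d by rewrite /idx (negbTE i0).
exact: gdiff_coord (box2_add _ _).
Qed.

End Jets.

(** * Root extraction and localisation as finite lists *)

Section Trees.
Variable d : nat.
Local Notation edge := (bool * mindex d * tree d)%type.
Implicit Types (t s T : tree d) (ch : seq edge) (p : tree2 d).

Fixpoint all_subtrees (P : tree d -> Prop) ch : Prop :=
  if ch is c :: ch' then P c.2 /\ all_subtrees P ch' else True.

Lemma tree_nested_ind (P : tree d -> Prop) :
  (forall l k v ch gr, all_subtrees P ch -> P (Node l k v ch gr)) -> forall t, P t.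
Proof.
move=> H; fix IH 1 => -[l k v ch gr]; apply: H.
elim: ch => [|c ch IHch]; first exact: Logic.I.
split; [exact: IH|exact: IHch].
Qed.

(** The recursion pattern shared by [graft] and by [mark_to_grey] below, which
    both act on exactly one node of the tree. *)
Fixpoint one_child (f : tree d -> seq (tree d)) ch : seq (seq edge) :=
  if ch is c :: ch' then
    [seq (c.1, t) :: ch' | t <- f c.2] ++ [seq c :: r | r <- one_child f ch']
  else [::].

Lemma graftE (a : mindex d) s l k v ch gr :
  graft a s (Node l k v ch gr) =
  (if v && ~~ null_planted s then [:: Node l k false ((true, a, s) :: ch) gr] else [::]) ++
  [seq Node l k v r gr | r <- one_child (graft a s) ch].
Proof.
rewrite /=; congr (_ ++ _).
set F := (fix graft_edges (pre post : seq edge) {struct post} : seq (tree d) := _).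
have H pre post : F pre post = [seq Node l k v (pre ++ r) gr | r <- one_child (graft a s) post].
  elim: post pre => //= c post IH pre; rewrite map_cat -!map_comp IH.
  by congr (_ ++ _); apply: eq_map => r /=; rewrite ?cat_rcons.
exact: H.
Qed.

(** A marked node gives its mark for the grey edge [(a, j)], which is what
    remains in the extracted tree of the edge [I'_a] grafted on that node. *)
Fixpoint mark_to_grey (a j : mindex d) T : seq (tree d) :=
  let: Node l k v ch gr := T in
  (if v then [:: Node l k false ch ((a, j) :: gr)] else [::]) ++
  [seq Node l k v r gr | r <- one_child (mark_to_grey a j) ch].

(** What remains true of the trees of [T_0] when trees are grafted on them. *)
Fixpoint plain t : bool :=
  let: Node l k v ch gr := t in
  [&& ~~ is_grey_noise l, k == 0, nilp gr & all (fun c => plain c.2) ch].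

(** The trees that [Delta] and [Mloc] produce with nonzero coefficients respect
    the convention on null planted trees. *)
Fixpoint left_wf T : bool :=
  let: Node l k v ch gr := T in
  all (fun c => [&& ~~ c.1.1, ~~ null_planted c.2 & left_wf c.2]) ch.

Fixpoint no_poly_dec T : bool :=
  let: Node l k v ch gr := T in (k == 0) && all (fun c => no_poly_dec c.2) ch.

(** Power counting will show that only these trees contribute.  The sum of
    decorations is the one that [down] forms at the node, and the indices
    [g.1 + g.2] are those of the edges cut off opposite a grey edge [g]. *)
Fixpoint tame T : bool :=
  let: Node l k v ch gr := T in
  [&& (sdeg (k + \sum_(g <- gr) g.2)%R < 2)%N,
      all (fun g => (sdeg (g.1 + g.2)%R < 2)%N) gr & all (fun c => tame c.2) ch].

Lemma left_wf_mul s t : left_wf (tree_mul s t) = left_wf s && left_wf t.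
Proof. by case: s => *; case: t => * /=; rewrite all_cat. Qed.

Lemma no_poly_dec_mul s t : no_poly_dec s -> no_poly_dec t -> no_poly_dec (tree_mul s t).
Proof.
case: s => ? ? ? ? ?; case: t => ? ? ? ? ? /= /andP[/eqP -> h1] /andP[/eqP -> h2].
by rewrite addr0 eqxx all_cat h1.
Qed.

Lemma tame_mul s t : tame (tree_mul s t) -> tame s /\ tame t.
Proof.
case: s => l k v ch gr; case: t => l' k' v' ch' gr' /=.
rewrite !all_cat => /and3P[+ /andP[-> ->] /andP[-> ->]]; rewrite !andbT.
rewrite big_cat /= addrACA => h; rewrite sdegD in h.
by split; [apply: leq_ltn_trans h; exact: leq_addr|apply: leq_ltn_trans h; exact: leq_addl].
Qed.

Definition noise_terms (l : noise_edge) : seq (tree2 d) :=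
  let edge l : tree d := Node l 0 false [::] [::] in
  match l with
  | Noise => [:: (edge GreyNoise, edge Noise); (edge Noise, tree_one d)]
  | l => [:: (edge l, tree_one d)]
  end.

Definition cut_terms (c : edge) : seq (tree2 d) :=
  [seq (grey_edge c.1.2 (idx j), planted c.1.1 (c.1.2 + idx j) c.2) | j <- enum 'I_d.+1].

Definition keep_terms (c : edge) (u : seq (tree2 d)) : seq (tree2 d) :=
  if c.1.1 then [::]
  else [seq (planted false c.1.2 p.1, p.2) | p <- [seq p <- u | ~~ null_planted p.1]].

Definition mul_terms (u w : seq (tree2 d)) : seq (tree2 d) :=
  [seq tree2_mul p q | p <- u, q <- w].

Definition root_terms l k v gr : seq (tree2 d) :=
  mul_terms [:: (Node NoNoise k v [::] gr, tree_one d)] (noise_terms l).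

(** The terms of [Delta t] whose sums over multi-indices are restricted to the
    image of [idx], where the coefficients [1/k!] are equal to one. *)
Fixpoint extractions t : seq (tree2 d) :=
  let: Node l k v ch gr := t in
  foldr (fun c u => mul_terms (keep_terms c (extractions c.2) ++ cut_terms c) u)
    (root_terms l k v gr) ch.

Definition edge_terms (c : edge) := keep_terms c (extractions c.2) ++ cut_terms c.

Definition children_terms ch u := foldr (fun c u => mul_terms (edge_terms c) u) u ch.

Lemma extractionsE l k v ch gr :
  extractions (Node l k v ch gr) = children_terms ch (root_terms l k v gr).
Proof. by []. Qed.

Fixpoint localisations T : seq (tree d) :=
  let: Node l j v ch gr := T in
  foldr (fun c u => [seq tree_mul (planted false c.1.2 t) w | t <- localisations c.2, w <- u])
    [seq Node l (j + idx i) v [::] gr | i <- enum 'I_d.+1] ch.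

Fixpoint children_localisations ch : seq (seq edge) :=
  if ch is c :: ch' then
    [seq ((false, c.1.2), t) :: r | t <- localisations c.2, r <- children_localisations ch']
  else [:: [::]].

Lemma sum_localisations (V : nmodType) (F : tree d -> V) l j v ch gr :
  \sum_(t <- localisations (Node l j v ch gr)) F t =
  \sum_(r <- children_localisations ch) \sum_i F (Node l (j + idx i) v r gr).
Proof.
elim: ch F => [|c ch IH] F.
  by rewrite /= big_map big_enum big_seq1.
rewrite [LHS]/= big_allpairs_dep [RHS]/= big_allpairs_dep; apply: eq_bigr => t _.
rewrite (IH (fun w => F (tree_mul (planted false c.1.2 t) w))).
by apply: eq_bigr => r _; apply: eq_bigr => i _ /=; rewrite add0r.
Qed.

End Trees.

HB.instance Definition _ (d : nat) := gen_eqMixin (tree d).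

Section Localisations.
Variable d : nat.
Implicit Types (t T : tree d).

Lemma allpairs_assoc (A B C D E F : Type) (f : A -> D -> F) (g : B -> C -> D)
    (h : A -> B -> E) (k : E -> C -> F) (s1 : seq A) (s2 : seq B) (s3 : seq C) :
  (forall a b c, f a (g b c) = k (h a b) c) ->
  [seq f x w | x <- s1, w <- [seq g y z | y <- s2, z <- s3]] =
  [seq k e z | e <- [seq h x y | x <- s1, y <- s2], z <- s3].
Proof.
move=> H; elim: s1 => //= a s1 IH; rewrite IH allpairs_cat; congr (_ ++ _).
rewrite map_allpairs allpairs_mapl; congr flatten; apply: eq_map => y.
by apply: eq_map => z; exact: H.
Qed.

Lemma localisationsE l j v ch gr : localisations (Node l j v ch gr) =
  [seq Node l (j + idx i) v r gr | r <- children_localisations ch, i <- enum 'I_d.+1].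
Proof.
elim: ch => [|c ch IH]; first by rewrite /= cats0.
rewrite [RHS]/= -(@allpairs_assoc _ _ _ _ _ _ (fun t w => tree_mul (planted false c.1.2 t) w)
  (fun r i => Node l (j + idx i) v r gr)); first by rewrite -IH.
by move=> t r i /=; rewrite add0r.
Qed.

Lemma mem_localisations T t : t \in localisations T ->
  [/\ has_grey_noise t = has_grey_noise T,
      no_poly_dec T -> grey_only t -> grey_only T &
      left_wf T -> no_poly_dec T -> left_wf t].
Proof.
elim/tree_nested_ind: T t => l k v ch gr IH t.
rewrite localisationsE => /allpairsP[[r i] [/= rch _ ->]].
have [E1 E2 E3] : [/\ has (fun c => has_grey_noise c.2) r = has (fun c => has_grey_noise c.2) ch,
    nilp r = nilp ch & left_wf (Node l k v ch gr) -> no_poly_dec (Node l k v ch gr) ->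
    left_wf (Node l k v r gr)].
  elim: ch r IH rch => [r _|c ch IHch _ [IHc /IHch {}IHch] /allpairsP[[t' r'] [/= tc rch ->]]].
    by rewrite /= mem_seq1 => /eqP ->.
  have [h1 h2 h3] := IHch _ rch; have [g1 g2 g3] := IHc _ tc.
  rewrite /= h1 g1; split => // /andP[/and3P[c1 cn cw] chw] /and3P[k0 cp chp].
  have {}h3 := h3 chw (introT andP (conj k0 chp)).
  rewrite [all _ r']h3 andbT g3//= andbT.
  move: cn; rewrite /null_planted !negb_or g1 => /andP[cg ->]; rewrite andbT.
  by apply: contra cg; exact: g2.
split=> /=.
- by rewrite E1.
- by move=> /andP[/eqP -> _]; rewrite E2 eqxx => /and3P[-> _ ->].
- exact: E3.
Qed.

Lemma null_localisations T t : no_poly_dec T -> ~~ null_planted T ->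
  t \in localisations T -> ~~ null_planted t.
Proof.
move=> Tp + /mem_localisations[h1 h2 _].
by rewrite /null_planted !negb_or h1 => /andP[Tg ->]; rewrite andbT (contra _ Tg)//; exact: h2.
Qed.

End Localisations.

Section Representation.
Variables (R : realType) (d : nat).
Implicit Types (t T : tree d) (p : tree2 d).

(** Only the terms that satisfy [P] matter.  For [P] the tame trees, this turns
    the sums over all multi-indices into lists. *)
Definition rep (A : Type) (P : A -> Prop) (u : fsum R A) (s : seq A) : Prop :=
  exists r : seq (fidx u), [/\ uniq r, [seq fterm i | i <- r] = s,
    (forall i, i \in r -> fcoef i = 1) &
    (forall i, P (fterm i) -> i \notin r -> fcoef i = 0)].

Lemma rep_eval (A : Type) (P : A -> Prop) (u : fsum R A) (s : seq A) (F : A -> R) :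
  rep P u s -> (forall i : fidx u, fcoef i != 0 -> F (fterm i) != 0 -> P (fterm i)) ->
  fsum_eval u F = \sum_(x <- s) F x.
Proof.
move=> [r [ur <- r1 r0]] FP; rewrite /fsum_eval (fsum_seq ur).
  by rewrite big_map !big_seq; apply: eq_bigr => i /r1 ->; rewrite mul1r.
move=> i ir; have [->|F0] := eqVneq (F (fterm i)) 0; first by rewrite mulr0.
have [->|c0] := eqVneq (fcoef i) 0; first by rewrite mul0r.
by rewrite r0 ?mul0r//; exact: FP.
Qed.

Lemma rep_one (A : Type) (P : A -> Prop) x : rep P (fsum_one R x) [:: x].
Proof. by exists [:: tt]; split => // -[]. Qed.

Lemma rep_add (A : Type) (P : A -> Prop) (u w : fsum R A) s s' :
  rep P u s -> rep P w s' -> rep P (fsum_add u w) (s ++ s').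
Proof.
move=> [r [ur <- r1 r0]] [r' [ur' <- r1' r0']].
exists ([seq inl i | i <- r] ++ [seq inr i | i <- r']); split.
- rewrite cat_uniq !map_inj_uniq ?ur ?ur' ?andbT /=; [|by move=> ? ? [] ..].
  by apply/hasPn => _ /mapP[i _ ->]; apply/mapP => -[].
- by rewrite map_cat -!map_comp.
- move=> i; rewrite mem_cat => /orP[] /mapP[j jr ->] /=; [exact: r1|exact: r1'].
- move=> [i|i] /=; rewrite mem_cat negb_or => Pi /andP[h1 h2].
    by apply: r0 => //; apply: contra h1 => ir; rewrite map_f.
  by apply: r0' => //; apply: contra h2 => ir; rewrite map_f.
Qed.

Lemma rep_mul (A : Type) (P : A -> Prop) mul (u w : fsum R A) s s' :
  (forall x y, P (mul x y) -> P x /\ P y) -> rep P u s -> rep P w s' ->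
  rep P (fsum_mul mul u w) [seq mul x y | x <- s, y <- s'].
Proof.
move=> Pm [r [ur <- r1 r0]] [r' [ur' <- r1' r0']].
exists [seq (i, j) | i <- r, j <- r']; split.
- by apply: allpairs_uniq => // -[? ?] [? ?].
- by rewrite map_allpairs allpairs_mapl allpairs_mapr.
- by move=> _ /allpairsP[[i j] [/= ir jr ->]] /=; rewrite r1// r1'// mulr1.
- move=> [i j] /= /Pm[Pi Pj] ijr.
  have [ir|/r0 -> //] := boolP (i \in r); last by rewrite mul0r.
  have [jr|/r0' -> //] := boolP (j \in r'); last by rewrite mulr0.
  by move: ijr; rewrite allpairs_f.
Qed.

Lemma rep_taylor (A : Type) (P : A -> Prop) (F : mindex d -> A) :
  (forall k, P (F k) -> (sdeg k < 2)%N) ->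
  rep P (fsum_taylor R F) [seq F (idx i) | i <- enum 'I_d.+1].
Proof.
move=> PF; exists [seq idx i | i <- enum 'I_d.+1]; split.
- by rewrite map_inj_uniq ?enum_uniq//; exact: idx_inj.
- by rewrite -map_comp.
- by move=> _ /mapP[i _ ->] /=; rewrite mfact_idx invr1.
- move=> k /PF /sdeg_lt2P[i ->] /negP[].
  by rewrite map_f// mem_enum.
Qed.

Lemma rep_plant (A : Type) (P Q : A -> Prop) a (get : A -> tree d) put (u : fsum R A) s :
  (forall x, Q (put x (planted false a (get x))) -> P x) -> rep P u s ->
  rep Q (fsum_plant a get put u)
    [seq put x (planted false a (get x)) | x <- [seq x <- s | ~~ null_planted (get x)]].
Proof.
move=> QP [r [ur <- r1 r0]].
exists [seq i <- r | ~~ null_planted (get (fterm i))]; split.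
- exact: filter_uniq.
- by rewrite filter_map -map_comp.
- by move=> i; rewrite mem_filter => /andP[/negbTE /= -> /r1].
- move=> i /= /QP Pi; rewrite mem_filter negb_and.
  by case: ifP => //= _; exact: r0.
Qed.

Lemma tame_mul2 p q : tame (tree2_mul p q).1 -> tame p.1 /\ tame q.1.
Proof. exact: tame_mul. Qed.

Lemma Delta_rep t : rep (fun p => tame p.1) (Delta R t) (extractions t).
Proof.
elim/tree_nested_ind: t => l k v ch gr IH /=.
elim: ch IH => [_|c ch IHch [IHc /IHch {}IHch]] /=.
  apply: (rep_mul tame_mul2); first exact: rep_one.
  case: l; [exact: rep_one| |exact: rep_one].
  exact: (rep_add (rep_one _ _) (rep_one _ _)).
apply: (rep_mul tame_mul2 _ IHch).
have cutr : rep (fun p : tree2 d => tame p.1) (fsum_taylor R (fun j : mindex d =>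
    (grey_edge c.1.2 j, planted c.1.1 (c.1.2 + j) c.2))) (cut_terms c).
  apply: rep_taylor => j /= /andP[+ _].
  by rewrite big_cons big_nil addr0 add0r.
rewrite /keep_terms; case: c.1.1 cutr => cutr; first exact: cutr.
apply: rep_add => //.
apply: (@rep_plant _ (fun p : tree2 d => tame p.1)); last exact: IHc.
by move=> x /=; rewrite ?andbT => /andP[_].
Qed.

Lemma mulf_neq0P (x y : R) : x * y != 0 -> x != 0 /\ y != 0.
Proof. by rewrite mulf_eq0 negb_or => /andP[]. Qed.

Lemma left_wf_planted b a t :
  left_wf (planted b a t) = [&& ~~ b, ~~ null_planted t & left_wf t].
Proof. by rewrite /= andbT. Qed.

Lemma Delta_left_wf t : plain t -> forall i : fidx (Delta R t), fcoef i != 0 ->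
  left_wf (fterm i).1 /\ no_poly_dec (fterm i).1.
Proof.
elim/tree_nested_ind: t => l k v ch gr IH /= /and4P[lg /eqP k0 gr0 chp].
elim: ch IH chp => [_ _|c ch IHch [IHc /IHch {}IHch]] /=.
  by move=> [[] i] _; case: l lg i => [_ []|_ [[]|[]]|//] /=; rewrite k0 addr0 eqxx.
move=> /andP[cp /IHch {}IHch] [i j] /= /mulf_neq0P[i0 /IHch[w1 w2]].
suff [e1 e2] : left_wf (fterm i).1 /\ no_poly_dec (fterm i).1.
  by split; [rewrite left_wf_mul e1|exact: no_poly_dec_mul].
case: c.1.1 i i0 => [i _|[i|i]] /=; [by rewrite eqxx| |by rewrite eqxx].
case: ifP => [|/negbT nn]; first by rewrite eqxx.
move=> /(IHc cp)[h1 h2].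
by rewrite h1 h2 eqxx.
Qed.

Lemma Mloc_left_wf T : left_wf T -> forall i : fidx (Mloc R T), fcoef i != 0 ->
  left_wf (fterm i).
Proof.
elim/tree_nested_ind: T => l k v ch gr IH /=.
elim: ch IH => [//|c ch IHch [IHc /IHch {}IHch]] /= /andP[/and3P[c1 cn cw] /IHch {}IHch].
move=> [i j] /= /mulf_neq0P[+ /IHch w].
case: ifP => [|/negbT nn]; first by rewrite eqxx.
move=> /(IHc cw) h1.
suff : left_wf (tree_mul (planted false c.1.2 (fterm i)) (fterm j)) by [].
by rewrite left_wf_mul w andbT left_wf_planted nn h1.
Qed.

Lemma Mloc_tame T : forall i : fidx (Mloc R T), tame (fterm i) -> tame T.
Proof.
elim/tree_nested_ind: T => l k v ch gr IH /=.
elim: ch IH => [_|c ch IHch [IHc /IHch {}IHch]] /=.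
  move=> i /and3P[h -> _]; rewrite !andbT; apply: leq_ltn_trans h.
  by rewrite -addrA addrCA [leqRHS]sdegD leq_addl.
move=> [i j] ij.
have /tame_mul[+ /IHch/and3P[-> -> ->]] :
  tame (tree_mul (planted false c.1.2 (fterm i)) (fterm j)) by [].
by rewrite /= andbT => /andP[_ /IHc ->].
Qed.

Lemma Mloc_rep T : left_wf T -> no_poly_dec T -> rep (fun t => tame t) (Mloc R T) (localisations T).
Proof.
elim/tree_nested_ind: T => l k v ch gr IH /=.
elim: ch IH => [_ _|c ch IHch [IHc /IHch {}IHch]] /=.
  move=> /andP[k0 _]; apply: rep_taylor => j /and3P[h _ _]; apply: leq_ltn_trans h.
  by rewrite -addrA addrCA [leqRHS]sdegD leq_addr.
move=> /andP[/and3P[c1 cn cw] chw] /and3P[k0 cp chp].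
have {}IHch := IHch chw (introT andP (conj k0 chp)).
have := @rep_plant _ (fun t => tame t) (fun t => tame t) c.1.2 id (fun _ t' => t') (Mloc R c.2) _ _ (IHc cw cp).
have -> : [seq x <- localisations c.2 | ~~ null_planted x] = localisations c.2.
  by apply/all_filterP/allP => t; exact: null_localisations.
move=> H.
have := @rep_mul _ (fun t => tame t) (@tree_mul d) _ _ _ _ (@tame_mul d) (H _) IHch.
by rewrite allpairs_mapl; apply => x /=; rewrite andbT => /andP[].
Qed.

Definition located_extractions t : seq (tree2 d) :=
  [seq (T, p.2) | p <- extractions t, T <- localisations p.1].

Lemma Mloc_Delta_rep t : plain t ->
  rep (fun p => tame p.1) (Mloc_Delta R t) (located_extractions t).
Proof.
move=> tp; have [r [ur rE r1 r0]] := Delta_rep t.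
have Hr (i : fidx (Delta R t)) : exists q : seq (fidx (Mloc R (fterm i).1)),
    i \in r -> [/\ uniq q, [seq fterm j | j <- q] = localisations (fterm i).1,
      (forall j, j \in q -> fcoef j = 1) &
      (forall j, tame (fterm j) -> j \notin q -> fcoef j = 0)].
  have [ir|_] := boolP (i \in r); last by exists [::].
  have [w1 w2] : left_wf (fterm i).1 /\ no_poly_dec (fterm i).1.
    by apply: Delta_left_wf => //; rewrite r1// oner_neq0.
  by have [q Hq] := Mloc_rep w1 w2; exists q.
have {Hr}[q Hq] : exists q : forall i : fidx (Delta R t), seq (fidx (Mloc R (fterm i).1)),
    forall i, i \in r -> [/\ uniq (q i), [seq fterm j | j <- q i] = localisations (fterm i).1,
      (forall j, j \in q i -> fcoef j = 1) &
      (forall j, tame (fterm j) -> j \notin q i -> fcoef j = 0)].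
  by exists (fun i => projT1 (cid (Hr i))) => i; exact: (projT2 (cid (Hr i))).
exists [seq Tagged (fun i => fidx (Mloc R (fterm i).1)) j | i <- r, j <- q i]; split.
- apply: allpairs_uniq_dep => //; last by move=> [? ?] [? ?].
  by move=> i /Hq[].
- rewrite /located_extractions -rE allpairs_mapl map_allpairs /=.
  congr flatten; apply/eq_in_map => i /Hq[_ <- _ _].
  by rewrite -map_comp.
- move=> _ /allpairsPdep[i [j [ir jq ->]]] /=.
  by have [_ _ H _] := Hq i ir; rewrite r1// mul1r; exact: H.
- move=> [i j] /= tj; have [ir|ir] := boolP (i \in r); last first.
    by move=> _; rewrite r0 ?mul0r//; exact: Mloc_tame tj.
  have [_ _ _ H] := Hq i ir => ij; rewrite (H j) ?mulr0//.
  apply: contra ij => jq.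
  by apply/allpairsPdep; exists i, j.
Qed.

Lemma Mloc_Delta_left_wf t : plain t -> forall i : fidx (Mloc_Delta R t),
  fcoef i != 0 -> left_wf (fterm i).1.
Proof.
move=> tp [i j] /= /mulf_neq0P[i0 j0].
by apply: Mloc_left_wf => //; exact: (Delta_left_wf tp i0).1.
Qed.

End Representation.

(** * Power counting *)

Section PowerCounting.
Variables (R : realType) (d : nat) (S : setting R d).
Hypothesis HS : admissible S.
Implicit Types (T : tree d) (Z Zt : jet R d) (bs : seq (mindex d)).
Local Notation D := (deg_noise S).

Let Ssm : forall l, smooth_on setT (nonlin S l). Proof. exact: adm_nonlin HS. Qed.

Lemma deg_noise_bounds : -2 < D < 0.
Proof.
have /andP[a0 a1] := adm_alpha HS; have /andP[k0 ka] := adm_kappa HS.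
rewrite /deg_noise; apply/andP; split; lra.
Qed.

Lemma total_derivs0 (k : mindex d) :
  total_derivs k (fun _ : jet R d => 0 : R) = fun=> 0.
Proof.
rewrite /total_derivs; elim: (index_seq k) => //= i s ->; apply/funext => Z.
rewrite /total_deriv (@fsum_seq _ _ [::]) ?big_nil//.
by move=> a _; rewrite Dvar0 mulr0.
Qed.

Lemma node_fun_sub l cs cs' : node_fun S l (cs ++ cs') <> (fun=> 0) ->
  node_fun S l cs' <> (fun=> 0).
Proof.
move=> + E; apply; elim: cs => // a cs IH; rewrite cat_cons.
by rewrite -Dvar_node_fun IH Dvar0.
Qed.

Definition homogeneity bs : R := \sum_(b <- bs) (D + 2 - (sdeg b)%:R).

Lemma subcritical_node l bs : node_fun S l bs <> (fun=> 0) -> ~~ l || ~~ nilp bs ->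
  D < (if l then D else 0) + homogeneity bs.
Proof.
move=> F0; have [Z FZ] : exists Z, node_fun S l bs Z != 0.
  apply: contrapT => H; apply: F0; apply/funext => Z; apply/eqP.
  by apply/negPn/negP => HZ; apply: H; exists Z.
exact: (adm_subcritical HS FZ).
Qed.

Definition noise_on (l : noise_edge) := is_noise l || is_grey_noise l.

Definition node_indices (ch : seq (bool * mindex d * tree d)) gr : seq (mindex d) :=
  [seq c.1.2 | c <- ch] ++ [seq g.1 | g : mindex d * mindex d <- gr].

Lemma UpsilonTE l k v ch gr Z Zt :
  UpsilonT S (Node l k v ch gr) Z Zt =
  total_derivs k (node_fun S (noise_on l) (node_indices ch gr)) (if v then Z else Zt) *
  \prod_(c <- ch) UpsilonT S c.2 Z Zt.
Proof. by rewrite /= unlock. Qed.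

Lemma degE l k v ch gr : left_wf (Node l k v ch gr) ->
  deg S (down (Node l k v ch gr)) =
  (if is_noise l then D else 0) + (sdeg (k + \sum_(g <- gr) g.2))%:R +
  \sum_(c <- ch) (deg S (down c.2) + 2 - (sdeg c.1.2)%:R).
Proof.
rewrite /= => chw; congr (_ + _ + _); first by case: l.
elim: ch chw => [|c ch IH] /=; first by rewrite big_nil.
move=> /andP[/and3P[/negbTE -> _ _] /IH ->].
by rewrite big_cons subr0.
Qed.

Lemma down_grey_noise T : has_grey_noise (down T) = false.
Proof.
elim/tree_nested_ind: T => l k v ch gr IH /=; apply/negbTE; rewrite negb_or.
apply/andP; split; first by case: l.
by elim: ch IH => //= c ch IHch [-> /IHch].
Qed.

Lemma down_grey_only T : grey_only (down T) -> grey_only T.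
Proof.
case: T => l k v ch gr /= /and3P[l0 k0 c0]; apply/and3P; split.
- by case: l l0.
- by move: k0; rewrite -!sdeg_eq0 sdegD addn_eq0 => /andP[].
- by case: ch c0.
Qed.

Lemma down_in_T0X T : left_wf T -> in_T0X (down T).
Proof.
elim/tree_nested_ind: T => l k v ch gr IH /= chw; apply/andP; split.
  by case: l.
elim: ch IH chw => //= c ch IHch [IHc /IHch {}IHch] /andP[/and3P[-> cn /IHc ->] /IHch ->].
rewrite /= !andbT; apply: contra cn.
by rewrite /null_planted down_grey_noise orbF => /down_grey_only ->.
Qed.

Lemma sdeg_sum (gr : seq (mindex d * mindex d)) :
  sdeg (\sum_(g <- gr) g.2) = (\sum_(g <- gr) sdeg g.2)%N.
Proof.
elim: gr => [|g gr IH]; first by rewrite !big_nil sdeg0.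
by rewrite !big_cons sdegD IH.
Qed.

Lemma children_deg ch Z Zt :
  all_subtrees (fun T => left_wf T -> ~~ has_grey_noise T -> forall Z Zt,
    UpsilonT S T Z Zt != 0 -> D <= deg S (down T) /\ (~~ tame T -> 0 <= deg S (down T))) ch ->
  all (fun c => [&& ~~ c.1.1, ~~ null_planted c.2 & left_wf c.2]) ch ->
  \prod_(c <- ch) UpsilonT S c.2 Z Zt != 0 ->
  homogeneity [seq c.1.2 | c <- ch] <=
    \sum_(c <- ch) (deg S (down c.2) + 2 - (sdeg c.1.2)%:R) /\
  (~~ all (fun c => tame c.2) ch -> homogeneity [seq c.1.2 | c <- ch] - D <=
    \sum_(c <- ch) (deg S (down c.2) + 2 - (sdeg c.1.2)%:R)).
Proof.
rewrite /homogeneity.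
elim: ch => [|c ch IHch] /=; first by rewrite !big_nil.
move=> [IHc /IHch {}IHch] /andP[/and3P[_ cn cw] /IHch {}IHch].
rewrite !big_cons mulf_eq0 negb_or => /andP[c0 /IHch[h1 h2]].
have cg : ~~ has_grey_noise c.2 by move: cn; rewrite negb_or => /andP[].
have [g1 g2] := IHc cw cg _ _ c0.
set a := (sdeg c.1.2)%:R; set b := \sum_(j <- [seq c.1.2 | c <- ch]) _ in h1 h2 *.
set e := \sum_(j <- ch) _ in h1 h2 *.
split; first by clear -g1 h1; lra.
rewrite negb_and => /orP[/g2 h|/h2 h]; clear -g1 h1 h; lra.
Qed.

Lemma node_fun_of_UpsilonT l k v ch gr Z Zt : UpsilonT S (Node l k v ch gr) Z Zt != 0 ->
  node_fun S (noise_on l) (node_indices ch gr) <> (fun=> 0) /\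
  \prod_(c <- ch) UpsilonT S c.2 Z Zt != 0.
Proof.
rewrite UpsilonTE mulf_eq0 negb_or => /andP[h1 h2]; split => // E.
by move: h1; rewrite E total_derivs0 eqxx.
Qed.

(** Replacing each subtree by its lower bound [D], the degree of [T] is at least
    that of a monomial of the right-hand side, which subcriticality compares with
    [D].  A decoration of scaled degree at least two adds more than [- D].  For a
    grey edge [Ibar_b(X^j)], the derivative [D_b] enters the monomial with
    [D + 2 - |b|] and [X^j] adds [|j|] to the degree. *)
Lemma deg_lower_bound T : left_wf T -> ~~ has_grey_noise T -> forall Z Zt,
  UpsilonT S T Z Zt != 0 -> D <= deg S (down T) /\ (~~ tame T -> 0 <= deg S (down T)).
Proof.
have /andP[D2 D0] := deg_noise_bounds.
elim/tree_nested_ind: T => l k v ch gr IH Tw Tg Z Zt /node_fun_of_UpsilonT[F0 ch0].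
have [C1 C2] := children_deg IH Tw ch0.
rewrite degE//.
have lE : noise_on l = is_noise l by case: l Tg {F0 Tw}.
rewrite lE in F0.
set as_ := [seq c.1.2 | c <- ch] in C1 C2.
set m := sdeg _; set e := \sum_(c <- ch) _ in C1 C2 *.
have m0 : 0 <= m%:R :> R by rewrite ler0n.
have H1 : D <= (if is_noise l then D else 0) + homogeneity as_.
  have [h|] := boolP (~~ is_noise l || ~~ nilp as_).
    apply/ltW/subcritical_node => //; apply: (@node_fun_sub _ [seq g.1 | g <- gr]).
    by rewrite (node_fun_perm Ssm _ (bs' := node_indices ch gr))// perm_catC.
  rewrite negb_or !negbK => /andP[-> /nilP ->].
  by rewrite /homogeneity big_nil addr0.
split; first by clear -H1 C1 m0; lra.
rewrite /= !negb_and => /orP[|/orP[]].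
- rewrite -leqNgt => m2; have : 2 <= m%:R :> R by rewrite (ler_nat _ 2).
  by clear -H1 C1 D2; move=> ?; lra.
- move=> /allPn[g ggr]; rewrite -leqNgt => g2.
  have [r1 [r2 E]] : exists r1 r2, gr = r1 ++ g :: r2.
    by case/splitPr: ggr => r1 r2; exists r1, r2.
  have : D < (if is_noise l then D else 0) + homogeneity (g.1 :: as_).
    apply: subcritical_node; last by rewrite orbT.
    apply: (@node_fun_sub _ ([seq g.1 | g <- r1] ++ [seq g.1 | g <- r2])).
    rewrite (node_fun_perm Ssm _ (bs' := node_indices ch gr))//.
    apply/permP => x; rewrite /node_indices E !count_cat map_cat count_cat /=.
    by rewrite [RHS]addnC -!addnA; congr (_ + _)%N; rewrite [RHS]addnCA.
  rewrite /homogeneity big_cons -/(homogeneity as_).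
  have gm : (sdeg g.2 <= m)%N.
    rewrite /m sdegD sdeg_sum E big_cat big_cons /=.
    by rewrite addnA addnCA leq_addr.
  move: g2; rewrite sdegD => g2.
  have : 2 <= (sdeg g.1)%:R + m%:R :> R.
    by rewrite -natrD (ler_nat _ 2) (leq_trans g2)// leq_add2l.
  by clear -C1 D2; move=> ? ?; lra.
- by move=> /C2 h; clear -h H1 m0; lra.
Qed.

Lemma bare_tame T Z Zt : is_bare (down T) -> UpsilonT S T Z Zt != 0 -> tame T.
Proof.
case: T => l k v ch gr /= /and5P[_ _ kg chn _] /node_fun_of_UpsilonT[F0 _].
have ch0 : ch = [::] by case: ch chn {F0}.
move: kg; rewrite -sdeg_eq0 => /eqP kg; rewrite kg ch0 /= andbT.
have g0 g : g \in gr -> sdeg g.2 = 0%N.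
  move=> ggr; have [r1 [r2 E]] : exists r1 r2, gr = r1 ++ g :: r2.
    by case/splitPr: ggr => r1 r2; exists r1, r2.
  move: kg; rewrite sdegD sdeg_sum E big_cat big_cons /= => kg.
  apply/eqP; rewrite -leqn0 -kg addnA addnCA; exact: leq_addr.
apply/allP => g ggr; rewrite sdegD g0// addn0.
apply: contrapT => /negP gn; apply: F0; apply: (node_fun_out Ssm).
by apply/allPn; exists g.1; rewrite // /node_indices mem_cat map_f ?orbT.
Qed.

(** [ell (down T)] is only nonzero for [Y^v] or in negative degree.  A grey noise
    can only sit at the root of [T], where it contributes a derivative of
    [\Upsilon^1] but not the degree of the noise: the degree is then
    non-negative. *)
Lemma tame_of_nonzero T Z Zt : left_wf T ->
  ell S (down T) * UpsilonT S T Z Zt != 0 -> tame T.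
Proof.
move=> Tw; rewrite mulf_eq0 negb_or => /andP[l0 u0].
have [Tb|Tb] := boolP (is_bare (down T)); first exact: bare_tame Tb u0.
have degT : deg S (down T) < 0.
  rewrite ltNge; apply: contra l0 => d0.
  by rewrite (ell_deg (adm_ell HS))//; exact: down_in_T0X.
have [Tg|Tg] := boolP (has_grey_noise T); last first.
  have [_ H] := deg_lower_bound Tw Tg u0.
  by apply: contraLR degT => /H; rewrite -leNgt.
case: T Tw {l0} u0 Tb degT Tg => l k v ch gr Tw u0 Tb.
rewrite degE// => degT /= Tg.
have cg : ~~ has (fun c => has_grey_noise c.2) ch.
  apply/hasPn => c cch; have /and3P[_ + _] := allP Tw c cch.
  by rewrite negb_or => /andP[].
rewrite (negbTE cg) orbF in Tg.
have lN : is_noise l = false by case: l Tg {Tw u0 Tb degT}.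
have lT : noise_on l = true by rewrite /noise_on Tg orbT.
have [F0 ch0] := node_fun_of_UpsilonT u0.
have IH : all_subtrees (fun T => left_wf T -> ~~ has_grey_noise T -> forall Z Zt,
    UpsilonT S T Z Zt != 0 -> D <= deg S (down T) /\ (~~ tame T -> 0 <= deg S (down T))) ch.
  by elim: (ch) => //= c ch' IH; split => //; exact: deg_lower_bound.
have [C1 _] := children_deg IH Tw ch0.
move: degT; rewrite lN add0r; case: (boolP (nilp ch)) => [/nilP ->|chn].
  by rewrite big_nil addr0 ltNge ler0n.
have : D < D + homogeneity [seq c.1.2 | c <- ch].
  have := @subcritical_node true [seq c.1.2 | c <- ch]; apply.
    apply: (@node_fun_sub _ [seq g.1 | g <- gr]).
    by rewrite -lT (node_fun_perm Ssm _ (bs' := node_indices ch gr))// perm_catC.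
  by case: (ch) chn.
have : 0 <= (sdeg (k + \sum_(g <- gr) g.2))%:R :> R by rewrite ler0n.
by clear -C1 => ? ? ?; exfalso; lra.
Qed.

End PowerCounting.

(** * Grafting and root extraction *)

Section GraftExtraction.
Variables (R : realType) (d : nat).
Local Notation edge := (bool * mindex d * tree d)%type.
Implicit Types (t T : tree d) (ch r : seq edge) (p q e : tree2 d) (u : seq (tree2 d))
  (W : tree d -> R).

Variables (xi : R) (E : edge -> R).

(** [xi] and [E] stand for the values of [Xi] and of the planted trees. *)
Definition prod_val t : R :=
  let: Node l k v ch gr := t in (if is_noise l then xi else 1) * \prod_(c <- ch) E c.

Definition root_noise t := let: Node l k v ch gr := t in l.
Definition root_mark t := let: Node l k v ch gr := t in v.
Definition unmark_root t := let: Node l k v ch gr := t in Node l k false ch gr.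
Definition no_noise t := if root_noise t is NoNoise then true else false.

Lemma prod_val_mul t T : no_noise t -> prod_val (tree_mul t T) = prod_val t * prod_val T.
Proof.
case: t => l k v ch gr; case: T => l' k' v' ch' gr'; case: l => //= _.
by rewrite big_cat /= mul1r mulrCA.
Qed.

Definition child_map (f : tree d -> seq (tree d)) t : seq (tree d) :=
  let: Node l k v ch gr := t in [seq Node l k v r gr | r <- one_child f ch].

Lemma one_child_cat f ch1 ch2 : one_child f (ch1 ++ ch2) =
  [seq r ++ ch2 | r <- one_child f ch1] ++ [seq ch1 ++ r | r <- one_child f ch2].
Proof.
elim: ch1 => [|c ch1 IH] /=; first by rewrite map_id.
by rewrite IH !map_cat -!map_comp catA.
Qed.

Lemma child_map_mul f t T : child_map f (tree_mul t T) =
  [seq tree_mul x T | x <- child_map f t] ++ [seq tree_mul t x | x <- child_map f T].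
Proof.
case: t => l k v ch gr; case: T => l' k' v' ch' gr' /=.
by rewrite one_child_cat map_cat -!map_comp.
Qed.

Lemma no_noise_child_map f t : no_noise t -> forall x, x \in child_map f t -> no_noise x.
Proof. by case: t => l k v ch gr /= lN x /mapP[r _ ->]. Qed.

Definition dprod_val f t : R := \sum_(x <- child_map f t) prod_val x.

Lemma dprod_val_mul f t T : no_noise t ->
  dprod_val f (tree_mul t T) = dprod_val f t * prod_val T + prod_val t * dprod_val f T.
Proof.
move=> tn; rewrite /dprod_val child_map_mul big_cat !big_map mulr_suml mulr_sumr.
congr (_ + _); first by rewrite !big_seq; apply: eq_bigr => x /(no_noise_child_map tn) xn;
  rewrite prod_val_mul.
by apply: eq_bigr => x _; rewrite prod_val_mul.
Qed.

Variables (a : mindex d) (s : tree d).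
Hypothesis s_planted : ~~ null_planted s.

Let H (i : 'I_d.+1) := E (true, a + idx i, s).
Let f := graft a s.
Let g i := mark_to_grey a (idx i).

(** [dgrey] is the contribution of the graftings on the nodes of the extracted
    tree; [dgrey_below] leaves out its root, which in an induction over the
    children is shared by all of them. *)
Definition dgrey W T : R := \sum_i H i * \sum_(x <- g i T) W x.
Definition dgrey_below W T : R := \sum_i H i * \sum_(x <- child_map (g i) T) W x.

Definition eval_terms W u : R := \sum_(p <- u) W p.1 * prod_val p.2.
Definition deval_terms (D : (tree d -> R) -> tree d -> R) W u : R :=
  \sum_(p <- u) (D W p.1 * prod_val p.2 + W p.1 * dprod_val f p.2).

Lemma eval_terms_cat W u (x : seq (tree2 d)) : eval_terms W (u ++ x) = eval_terms W u + eval_terms W x.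
Proof. exact: big_cat. Qed.

Lemma deval_terms_cat D W u (x : seq (tree2 d)) : deval_terms D W (u ++ x) = deval_terms D W u + deval_terms D W x.
Proof. exact: big_cat. Qed.

Lemma eval_terms_mul W (x : seq (tree2 d)) u : (forall e, e \in x -> no_noise e.2) ->
  eval_terms W (mul_terms x u) =
  \sum_(p <- u) eval_terms (fun T => W (tree_mul T p.1)) x * prod_val p.2.
Proof.
move=> xn; rewrite /eval_terms big_allpairs_dep exchange_big /=.
apply: eq_bigr => p _; rewrite mulr_suml !big_seq; apply: eq_bigr => e /xn en.
by rewrite prod_val_mul// mulrA.
Qed.

Lemma dgrey_below_mul W t T : dgrey_below W (tree_mul t T) =
  dgrey_below (fun x => W (tree_mul x T)) t + dgrey_below (fun x => W (tree_mul t x)) T.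
Proof.
rewrite /dgrey_below -big_split; apply: eq_bigr => i _ /=.
by rewrite child_map_mul big_cat !big_map mulrDr.
Qed.

Lemma deval_terms_mul W (x : seq (tree2 d)) u : (forall e, e \in x -> no_noise e.2) ->
  deval_terms dgrey_below W (mul_terms x u) =
  \sum_(p <- u) deval_terms dgrey_below (fun T => W (tree_mul T p.1)) x * prod_val p.2 +
  \sum_(e <- x) prod_val e.2 * deval_terms dgrey_below (fun T => W (tree_mul e.1 T)) u.
Proof.
move=> xn; rewrite /deval_terms big_allpairs_dep.
have -> : \sum_(p <- u) (\sum_(e <- x) (dgrey_below (fun T => W (tree_mul T p.1)) e.1 * prod_val e.2 +
    W (tree_mul e.1 p.1) * dprod_val f e.2)) * prod_val p.2 =
   \sum_(e <- x) \sum_(p <- u) (dgrey_below (fun T => W (tree_mul T p.1)) e.1 * prod_val e.2 +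
    W (tree_mul e.1 p.1) * dprod_val f e.2) * prod_val p.2.
  by rewrite exchange_big; apply: eq_bigr => p _; rewrite mulr_suml.
rewrite -big_split !big_seq; apply: eq_bigr => e /xn en /=.
rewrite mulr_sumr -big_split; apply: eq_bigr => p _ /=.
by rewrite dgrey_below_mul prod_val_mul// dprod_val_mul//; ring.
Qed.

Lemma null_mark_to_grey j t T : T \in mark_to_grey a j t -> null_planted T = null_planted t.
Proof.
suff P : forall T, T \in mark_to_grey a j t ->
    grey_only T = grey_only t /\ has_grey_noise T = has_grey_noise t.
  by move=> /P[h1 h2]; rewrite /null_planted h1 h2.
elim/tree_nested_ind: t {T} => l k v ch gr IH T /=; rewrite mem_cat => /orP[|].
  by case: v => //; rewrite mem_seq1 => /eqP ->.
move=> /mapP[r rch ->] /=.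
suff [-> ->] : nilp r = nilp ch /\
    has (fun c => has_grey_noise c.2) r = has (fun c => has_grey_noise c.2) ch by [].
elim: ch IH r rch => //= c ch IHch [IHc /IHch {}IHch] r; rewrite mem_cat => /orP[].
  by move=> /mapP[t /IHc[_ ht] ->] /=; rewrite ht.
by move=> /mapP[r' /IHch[_ h2] ->] /=; rewrite h2.
Qed.

Lemma no_noise_edge_terms (c : edge) : plain c.2 ->
  (forall p, p \in extractions c.2 -> has_grey_noise p.1 || no_noise p.2) ->
  forall e, e \in edge_terms c -> no_noise e.2.
Proof.
move=> cp Hc e; rewrite mem_cat => /orP[|/mapP[i _ ->]//].
rewrite /keep_terms; case: c.1.1 => // /mapP[p].
rewrite mem_filter negb_or => /andP[/andP[_ pg] /Hc]; rewrite (negbTE pg) /= => + ->.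
by [].
Qed.

Lemma edge_terms_root (c : edge) e : e \in edge_terms c ->
  no_noise e.1 && ~~ root_mark e.1.
Proof.
rewrite mem_cat => /orP[|/mapP[i _ ->]//].
by rewrite /keep_terms; case: c.1.1 => // /mapP[p _ ->].
Qed.

(** [Xi] stays at the root of the right component only against a grey noise on the
    left, and such a component is never planted.  Hence the products of right
    components never merge two noises, and [prod_val] is multiplicative on them. *)
Lemma no_noise_extractions t : plain t ->
  forall p, p \in extractions t -> has_grey_noise p.1 || no_noise p.2.
Proof.
elim/tree_nested_ind: t => l k v ch gr IH /and4P[lg k0 gr0 chp]; rewrite extractionsE.
elim: ch IH chp => [_ _ p|c ch IHch [IHc /IHch {}IHch] /= /andP[cp /IHch {}IHch] p].
  rewrite /= /root_terms /mul_terms /= cats0 => /mapP[q + ->].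
  case: l lg => //= _; first by rewrite mem_seq1 => /eqP ->.
  by rewrite in_cons mem_seq1 => /orP[] /eqP ->.
move=> /allpairsP[[e q] [/= ec /IHch qn ->]] /=.
have en := no_noise_edge_terms cp (IHc cp) ec.
have /andP[e1n _] := edge_terms_root ec.
case: e en e1n {ec} => [[l3 k3 v3 ch3 gr3] [le ke ve che gre]] /=; case: le => // _.
case: q qn => [[l1 k1 v1 ch1 gr1] [l2 k2 v2 ch2 gr2]] /=; case: l3 => // + _.
rewrite /no_noise /= has_cat => /orP[/orP[->|->]|->]; rewrite ?orbT//.
Qed.

Lemma deval_cut (c : edge) W :
  deval_terms dgrey_below W (cut_terms c) =
  \sum_(t <- f c.2) eval_terms W (cut_terms (c.1, t)).
Proof.
rewrite /deval_terms /eval_terms /cut_terms big_map.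
under [RHS]eq_bigr => t _ do rewrite big_map.
rewrite exchange_big /=; apply: eq_bigr => j _.
rewrite /dgrey_below big1 ?mul0r ?add0r => [|i _]; last by rewrite big_nil mulr0.
rewrite -mulr_sumr /dprod_val /=; congr (_ * _).
by rewrite cats0 !big_map; apply: eq_bigr => t _.
Qed.

Lemma deval_keep (c : edge) W :
  (forall W, \sum_(t <- f c.2) eval_terms W (extractions t) =
    deval_terms dgrey W (extractions c.2)) ->
  deval_terms dgrey_below W (keep_terms c (extractions c.2)) =
  \sum_(t <- f c.2) eval_terms W (keep_terms (c.1, t) (extractions t)).
Proof.
move=> IH; rewrite /keep_terms /=; case: c.1.1.
  by rewrite /deval_terms big_nil big1// => t _; rewrite /eval_terms big_nil.
pose W' T := if ~~ null_planted T then W (planted false c.1.2 T) else 0.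
have E1 t : eval_terms W [seq (planted false c.1.2 p.1, p.2) |
    p <- [seq p <- extractions t | ~~ null_planted p.1]] = eval_terms W' (extractions t).
  rewrite /eval_terms big_map big_filter big_mkcond; apply: eq_bigr => p _.
  by rewrite /W'; case: ifP => // _; rewrite mul0r.
under [RHS]eq_bigr => t _ do rewrite E1.
rewrite IH /deval_terms big_map big_filter big_mkcond; apply: eq_bigr => p _.
rewrite /W'; case: (boolP (null_planted p.1)) => pn /=.
  rewrite mul0r addr0 /dgrey big1 ?mul0r// => i _.
  rewrite big_seq big1 ?mulr0// => T /null_mark_to_grey ->.
  by rewrite pn.
congr (_ * _ + _); apply: eq_bigr => i _; congr (_ * _).
rewrite /= cats0 !big_map !big_seq; apply: eq_bigr => T /null_mark_to_grey ->.
by rewrite pn.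
Qed.

Lemma edge_termsE (b : bool * mindex d) t :
  edge_terms (b, t) = keep_terms (b, t) (extractions t) ++ cut_terms (b, t).
Proof. by []. Qed.

Lemma plain_graft : plain s -> forall t, plain t -> forall x, x \in graft a s t -> plain x.
Proof.
move=> sp; elim/tree_nested_ind => l k v ch gr IH /and4P[lg k0 gr0 chp] x.
rewrite graftE mem_cat => /orP[|/mapP[r rch ->]].
  by case: ifP => // _; rewrite mem_seq1 => /eqP ->; rewrite /= lg k0 gr0 sp chp.
rewrite /= lg k0 gr0 /= => {lg k0 gr0}.
elim: ch IH chp r rch => //= c ch IHch [IHc /IHch {}IHch] /andP[cp chp] r.
rewrite mem_cat => /orP[/mapP[t tc ->]|/mapP[r' rr ->]] /=.
  by apply/andP; split; [exact: IHc cp _ tc|exact: chp].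
by apply/andP; split; [exact: cp|exact: IHch chp _ rr].
Qed.

Hypothesis s_plain : plain s.

Lemma graft_children ch u :
  all_subtrees (fun t => plain t -> forall W,
    \sum_(x <- f t) eval_terms W (extractions x) = deval_terms dgrey W (extractions t)) ch ->
  all (fun c => plain c.2) ch ->
  (forall W, deval_terms dgrey_below W u = 0) -> forall W,
  \sum_(r <- one_child f ch) eval_terms W (children_terms r u) =
  deval_terms dgrey_below W (children_terms ch u).
Proof.
move=> + + u0; elim: ch => [_ _ W|c ch IHch [IHc /IHch {}IHch] /= /andP[cp /IHch {}IHch] W].
  by rewrite /= big_nil u0.
have nn := no_noise_edge_terms cp (no_noise_extractions cp).
rewrite big_cat !big_map deval_terms_mul//; congr (_ + _).
  transitivity (\sum_(t <- f c.2) \sum_(p <- children_terms ch u)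
      eval_terms (fun T => W (tree_mul T p.1)) (edge_terms (c.1, t)) * prod_val p.2).
    rewrite !big_seq; apply: eq_bigr => t tc; apply: eval_terms_mul.
    have tp := plain_graft s_plain cp tc.
    exact: (@no_noise_edge_terms (c.1, t) tp (no_noise_extractions tp)).
  rewrite exchange_big; apply: eq_bigr => p _; rewrite -mulr_suml; congr (_ * _).
  rewrite deval_terms_cat deval_cut deval_keep -?big_split; last by move=> W'; exact: IHc.
  by apply: eq_bigr => t _; rewrite edge_termsE eval_terms_cat.
transitivity (\sum_(r <- one_child f ch) \sum_(e <- edge_terms c)
    prod_val e.2 * eval_terms (fun T => W (tree_mul e.1 T)) (children_terms r u)).
  apply: eq_bigr => r _; rewrite /= eval_terms_mul// /eval_terms.
  rewrite (eq_bigr _ (fun p _ => mulr_suml _ _ _ _)).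
  rewrite exchange_big; apply: eq_bigr => e _; rewrite mulr_sumr; apply: eq_bigr => p _.
  by rewrite [RHS]mulrCA mulrA.
by rewrite exchange_big; apply: eq_bigr => e _; rewrite -mulr_sumr IHch.
Qed.

Lemma deval_root W l k v gr : deval_terms dgrey_below W (root_terms l k v gr) = 0.
Proof.
have D0 T : dgrey_below W (tree_mul (Node NoNoise k v [::] gr) (Node l 0 false [::] [::])) = 0 /\
    dgrey_below W (tree_mul (Node NoNoise k v [::] gr) (Node GreyNoise 0 false [::] [::])) = 0.
  by split; rewrite /dgrey_below big1// => i _; rewrite big_nil mulr0.
have [D1 D2] := D0 s.
rewrite /deval_terms /root_terms /mul_terms /= cats0 big_map.
by case: l D1 {D0} => /= D1; rewrite ?big_cons big_nil /= ?D1 ?D2 /dprod_val !big_nil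
  !mul0r !mulr0 !addr0.
Qed.

Lemma children_terms_mark l k v gr ch p :
  p \in children_terms ch (root_terms l k v gr) -> root_mark p.1 = v.
Proof.
elim: ch p => [p|c ch IH p] /=.
  by rewrite /root_terms /mul_terms /= cats0 => /mapP[q + ->];
    case: l => /=; rewrite !inE; do ?[move=> /orP[]]; move=> /eqP -> /=; rewrite orbF.
move=> /allpairsP[[e q] [/= /edge_terms_root/andP[_ e0] /IH qv ->]] /=.
by case: e e0 => [[l1 k1 v1 ch1 gr1] e2]; case: q qv => [[l2 k2 v2 ch2 gr2] q2] /= -> /negbTE ->.
Qed.

Lemma unmark_root_mul t T : ~~ root_mark t ->
  unmark_root (tree_mul t T) = tree_mul t (unmark_root T).
Proof. by case: t => l k v ch gr; case: T => l' k' v' ch' gr' /= /negbTE ->. Qed.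

Lemma children_terms_unmark l k v gr ch :
  children_terms ch (root_terms l k false gr) =
  [seq (unmark_root p.1, p.2) | p <- children_terms ch (root_terms l k v gr)].
Proof.
elim: ch => [|c ch IH] /=; first by case: l.
rewrite map_allpairs IH /mul_terms allpairs_mapr.
apply/eq_in_allpairs => e p /edge_terms_root/andP[_ e0] _.
by rewrite /tree2_mul /= unmark_root_mul.
Qed.

(** A grafting on [t] is seen by root extraction either on a node of the extracted
    tree, where it leaves a grey edge against a factor [H i], or inside one of the
    subtrees that were cut off. *)
Lemma graft_extractions t : plain t -> forall W,
  \sum_(x <- graft a s t) eval_terms W (extractions x) =
  deval_terms dgrey W (extractions t).
Proof.
elim/tree_nested_ind: t => l k v ch gr IH /and4P[lg k0 gr0 chp] W.
rewrite graftE big_cat big_map s_planted andbT.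
have -> : \sum_(r <- one_child (graft a s) ch) eval_terms W (extractions (Node l k v r gr)) =
    deval_terms dgrey_below W (extractions (Node l k v ch gr)).
  by apply: (graft_children IH chp) => W'; exact: deval_root.
rewrite /deval_terms extractionsE.
set u := children_terms ch _.
transitivity (\sum_(p <- u) (\sum_i H i *
    (if root_mark p.1 then W (tree_mul (grey_edge a (idx i)) (unmark_root p.1)) else 0)) * prod_val p.2 +
    \sum_(p <- u) (dgrey_below W p.1 * prod_val p.2 + W p.1 * dprod_val f p.2)).
  congr (_ + _).
  transitivity (\sum_(p <- u) (\sum_i H i *
    (if v then W (tree_mul (grey_edge a (idx i)) (unmark_root p.1)) else 0)) * prod_val p.2); last first.
    by rewrite !big_seq; apply: eq_bigr => p /children_terms_mark ->.
  case: (v) @u => u; last first.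
    by rewrite big_nil big1// => p _; rewrite big1 ?mul0r// => i _; rewrite mulr0.
  rewrite big_seq1 extractionsE /= (children_terms_unmark l k true gr ch) -/u.
  rewrite [edge_terms _]/= eval_terms_mul; last by move=> e /mapP[i _ ->].
  rewrite big_map; apply: eq_bigr => p _; congr (_ * _).
  rewrite /eval_terms big_map big_enum; apply: eq_bigr => i _ /=.
  by rewrite big_seq1 mul1r mulrC.
rewrite -big_split; apply: eq_bigr => p _ /=.
rewrite addrA -mulrDl; congr (_ * _ + _).
rewrite /dgrey /dgrey_below -big_split; apply: eq_bigr => i _ /=.
rewrite -mulrDr; congr (_ * _); case: p.1 => l1 k1 v1 ch1 gr1 /=.
by rewrite big_cat /=; congr (_ + _); case: v1; rewrite ?big_seq1 ?big_nil// add0r.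
Qed.

End GraftExtraction.

Section Expansion.
Variables (R : realType) (d : nat) (S : setting R d) (eps mu : R).
Hypothesis HS : admissible S.
Implicit Types (t T : tree d) (Z Zt : jetfield R d) (z : spacetime R d).

Definition edge_val Z Zt z (c : bool * mindex d * tree d) : R :=
  edge_op S mu c.1.1 c.1.2 (PiTilde S eps mu c.2 Z Zt) z.

Definition left_val Z Zt z T : R := ell S (down T) * UpsilonT S T (Z^~ z) (Zt^~ z).

Definition located_val Z Zt z T : R := \sum_(t <- localisations T) left_val Z Zt z t.

Lemma PiTimesE t Z Zt z :
  PiTimes S eps mu t Z Zt z = prod_val (noise S eps z) (edge_val Z Zt z) t.
Proof. by case: t => l k v ch gr; rewrite /PiTimes /PiTimes_of /prod_val unlock. Qed.

Lemma PiTildeE' t Z Zt z : plain t ->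
  PiTilde S eps mu t Z Zt z =
  eval_terms (noise S eps z) (edge_val Z Zt z) (located_val Z Zt z) (extractions t).
Proof.
move=> tp; rewrite PiTildeE /PiTilde_of (rep_eval (Mloc_Delta_rep R tp)).
  rewrite /located_extractions big_allpairs_dep; apply: eq_bigr => p _.
  rewrite -PiTimesE /located_val mulr_suml; apply: eq_bigr => T _.
  by rewrite /left_val.
move=> i /(Mloc_Delta_left_wf tp) iw; rewrite mulf_eq0 negb_or => /andP[h _].
exact: tame_of_nonzero iw h.
Qed.

End Expansion.

(** * Differentiating the extracted tree *)

Section NodeIdentity.
Variables (R : realType) (d : nat) (S : setting R d).
Hypothesis Ssm : forall l, smooth_on setT (nonlin S l).
Local Notation edge := (bool * mindex d * tree d)%type.
Implicit Types (t T : tree d) (ch r : seq edge) (X H : mindex d -> R).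

Lemma idx_lift (k : 'I_d) : idx (lift ord0 k) = unit_index (lift ord0 k).
Proof. by []. Qed.

Lemma node_val_perm i l bs bs' X : perm_eq bs bs' ->
  node_val S i l bs X = node_val S i l bs' X.
Proof.
move=> bb; rewrite /node_val; case: eqP => _; first by rewrite (node_fun_perm Ssm l bb).
apply: eq_bigr => m _; rewrite (@node_fun_perm _ _ _ Ssm l (idx m :: bs) (idx m :: bs'))//.
by rewrite perm_cons.
Qed.

(** Both sides are the derivative along [H] of [\sum_k e_k \partial^k F].  The left
    one uses the chain rule; on the right [k = m + i], and the commutation rule
    [[D_b, \partial^(e_i)] = D_(b - e_i)], read with [b = j + i], has moved [i] from
    the operator to the index of [H]. *)
Lemma node_identity (e : mindex d -> R) l bs X H :
  (forall q, (1 < sdeg q)%N -> e q = 0) ->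
  \sum_i e (idx i) * node_dval S i l bs X H =
  \sum_j \sum_i H (idx j + idx i) *
    \sum_i' e (idx i' + idx i) * node_val S i' l (idx j :: bs) X.
Proof.
move=> e0.
pose F js := node_fun S l ([seq idx j | j <- js] ++ bs) X.
have RHSj j : \sum_i H (idx j + idx i) *
    (\sum_i' e (idx i' + idx i) * node_val S i' l (idx j :: bs) X) =
  H (idx j) * (e 0 * F [:: j]) +
  H (idx j) * (\sum_(k < d) e (idx (lift ord0 k)) *
    \sum_m X (idx m + idx (lift ord0 k)) * F [:: m; j]) +
  \sum_(k < d) H (idx j + idx (lift ord0 k)) * (e (idx (lift ord0 k)) * F [:: j]).
  rewrite big_ord_recl big_ord_recl idx0 !addr0 -mulrDr; congr (_ * (_ + _) + _).
    by apply: eq_bigr => k _; rewrite addr0.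
  apply: eq_bigr => k _; rewrite big_ord_recl idx0 add0r big1 ?addr0// => k' _.
  by rewrite e0 ?mul0r// sdegD !idx_lift !sdeg_unit.
rewrite (eq_bigr _ (fun j _ => RHSj j)) !big_split /=.
rewrite big_ord_recl idx0 -addrA; congr (_ + _).
  rewrite /node_dval eqxx mulr_sumr; apply: eq_bigr => j _.
  by rewrite [RHS]mulrCA; congr (_ * _); rewrite mulrC.
have E k : e (idx (lift ord0 k)) * node_dval S (lift ord0 k) l bs X H =
  \sum_j H (idx j) * (e (idx (lift ord0 k)) *
    \sum_m X (idx m + idx (lift ord0 k)) * F [:: m; j]) +
  \sum_j H (idx j + idx (lift ord0 k)) * (e (idx (lift ord0 k)) * F [:: j]).
  rewrite /node_dval /= big_split /= mulrDr addrC; congr (_ + _); last first.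
    by rewrite mulr_sumr; apply: eq_bigr => j _; rewrite mulrCA.
  transitivity (e (idx (lift ord0 k)) * \sum_m \sum_j
      H (idx j) * (X (idx m + idx (lift ord0 k)) * F [:: m; j])).
    congr (_ * _); apply: eq_bigr => m _; rewrite mulr_sumr; apply: eq_bigr => j _.
    have -> : F [:: m; j] = node_fun S l (idx j :: idx m :: bs) X.
      rewrite /F (node_fun_perm Ssm l (bs' := idx j :: idx m :: bs))//.
      by apply/permP => x /=; rewrite addnCA.
    by rewrite [RHS]mulrCA [H _ * _]mulrC.
  rewrite exchange_big mulr_sumr; apply: eq_bigr => j _.
  by rewrite [RHS]mulrCA; congr (_ * _); rewrite mulr_sumr.
rewrite (eq_bigr _ (fun k _ => E k)) big_split /=; congr (_ + _).
  by rewrite exchange_big; apply: eq_bigr => j _; rewrite mulr_sumr.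
by rewrite exchange_big.
Qed.

(** [node_dval] as a function of the decoration, zero outside the image of
    [idx]. *)
Definition node_dval_dec (k : mindex d) l bs X H : R :=
  \sum_i (k == idx i)%:R * node_dval S i l bs X H.

Lemma node_dval_decE i l bs X H : node_dval_dec (idx i) l bs X H = node_dval S i l bs X H.
Proof.
rewrite /node_dval_dec (bigD1 i)//= eqxx mul1r big1 ?addr0// => j ji.
by rewrite (inj_eq (@idx_inj d)) eq_sym (negbTE ji) mul0r.
Qed.

(** Derivative of [UpsilonT S T] at [(X, Xt)] when the variables [X] move along
    [H]: only the marked nodes contribute. *)
Fixpoint dUpsilonT T X Xt H : R :=
  let: Node l k v ch gr := T in
  let bs := node_indices ch gr in
  (if v then node_dval_dec k (noise_on l) bs X H else 0) *
    \prod_(c <- ch) UpsilonT S c.2 X Xt +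
  total_derivs k (node_fun S (noise_on l) bs) (if v then X else Xt) *
  (fix dprod ch := if ch is c :: ch' then
     dUpsilonT c.2 X Xt H * \prod_(c <- ch') UpsilonT S c.2 X Xt +
     UpsilonT S c.2 X Xt * dprod ch' else 0) ch.

Fixpoint dUpsilon_prod ch X Xt H : R :=
  if ch is c :: ch' then
    dUpsilonT c.2 X Xt H * \prod_(c <- ch') UpsilonT S c.2 X Xt +
    UpsilonT S c.2 X Xt * dUpsilon_prod ch' X Xt H
  else 0.

Lemma dUpsilonTE l k v ch gr X Xt H :
  dUpsilonT (Node l k v ch gr) X Xt H =
  (if v then node_dval_dec k (noise_on l) (node_indices ch gr) X H else 0) *
    \prod_(c <- ch) UpsilonT S c.2 X Xt +
  total_derivs k (node_fun S (noise_on l) (node_indices ch gr)) (if v then X else Xt) *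
  dUpsilon_prod ch X Xt H.
Proof. by rewrite /=; congr (_ + _ * _); elim: ch => //= c ch ->. Qed.

(** The counterterm of a tree only depends on this one, which forgets the marks and
    merges the grey decorations with those of the nodes. *)
Definition ell_tree T := unmark (down T).

Definition ell_children ch : seq edge := [seq (c.1, ell_tree c.2) | c <- ch].

Lemma ell_treeE l k v ch gr : ell_tree (Node l k v ch gr) =
  Node (if is_grey_noise l then NoNoise else l) (k + \sum_(g <- gr) g.2) false
    (ell_children ch) [::].
Proof. by rewrite /ell_tree /= -map_comp. Qed.

Lemma tame_ell_tree l k ch : tame (Node l k false ch [::]) =
  (sdeg k < 2)%N && all (fun c => tame c.2) ch.
Proof. by rewrite /= big_nil addr0. Qed.

(** [node_identity] at each node in turn: moving the fields along [H] at a marked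
    node amounts to trading its mark for grey edges.  The weight [E] may depend on
    the tree through [ell_tree], since both sides then put the same total
    decoration on the node. *)
Lemma mark_to_grey_localisations X H T : no_poly_dec T -> forall E : tree d -> R,
  (forall t, ~~ tame t -> E t = 0) ->
  \sum_(t <- localisations T) E (ell_tree t) * dUpsilonT t X X H =
  \sum_j \sum_i H (idx j + idx i) *
    \sum_(x <- mark_to_grey (idx j) (idx i) T) \sum_(t <- localisations x)
      E (ell_tree t) * UpsilonT S t X X.
Proof.
elim/tree_nested_ind: T => l k v ch gr IH /= /andP[/eqP -> chp] E E0.
(* the induction hypothesis and Leibniz' rule, for a weight on lists of children *)
have children (K : seq edge -> R) : (forall r, ~~ all (fun c => tame c.2) r -> K r = 0) ->
  \sum_(r <- children_localisations ch) K (ell_children r) * dUpsilon_prod r X X H =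
  \sum_j \sum_i H (idx j + idx i) *
    \sum_(ch' <- one_child (mark_to_grey (idx j) (idx i)) ch)
    \sum_(r <- children_localisations ch')
      K (ell_children r) * \prod_(c <- r) UpsilonT S c.2 X X.
  elim: ch IH chp K {E E0} => [_ _ K K0|c ch IHch [IHc /IHch {}IHch] /andP[cp /IHch {}IHch] K K0].
    rewrite /= big_seq1 mulr0 big1// => j _; rewrite big1// => i _.
    by rewrite big_nil mulr0.
  rewrite big_allpairs_dep /=.
  have split1 : \sum_(t <- localisations c.2) \sum_(r <- children_localisations ch)
      K (ell_children ((false, c.1.2, t) :: r)) * dUpsilon_prod ((false, c.1.2, t) :: r) X X H =
    \sum_(r <- children_localisations ch) (\sum_(t <- localisations c.2)
      K ((false, c.1.2, ell_tree t) :: ell_children r) * dUpsilonT t X X H) *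
      \prod_(c <- r) UpsilonT S c.2 X X +
    \sum_(t <- localisations c.2) UpsilonT S t X X * \sum_(r <- children_localisations ch)
      K ((false, c.1.2, ell_tree t) :: ell_children r) * dUpsilon_prod r X X H.
    under [X in _ = X + _]eq_bigr => r _ do rewrite mulr_suml.
    rewrite [X in _ = X + _]exchange_big -big_split; apply: eq_bigr => t _ /=.
    rewrite mulr_sumr -big_split; apply: eq_bigr => r _ /=; ring.
  rewrite split1.
  have IH1 r : \sum_(t <- localisations c.2)
      K ((false, c.1.2, ell_tree t) :: ell_children r) * dUpsilonT t X X H =
    \sum_j \sum_i H (idx j + idx i) * \sum_(x <- mark_to_grey (idx j) (idx i) c.2)
      \sum_(t <- localisations x)
        K ((false, c.1.2, ell_tree t) :: ell_children r) * UpsilonT S t X X.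
    apply: (IHc cp (fun x => K ((false, c.1.2, x) :: ell_children r))) => t tn.
    by apply: K0; rewrite /= (negbTE tn).
  have IH2 t : \sum_(r <- children_localisations ch)
      K ((false, c.1.2, ell_tree t) :: ell_children r) * dUpsilon_prod r X X H =
    \sum_j \sum_i H (idx j + idx i) *
      \sum_(ch' <- one_child (mark_to_grey (idx j) (idx i)) ch)
      \sum_(r <- children_localisations ch')
        K ((false, c.1.2, ell_tree t) :: ell_children r) * \prod_(c <- r) UpsilonT S c.2 X X.
    apply: (IHch (fun r => K ((false, c.1.2, ell_tree t) :: r))) => r rn.
    by apply: K0; rewrite /= (negbTE rn) andbF.
  have -> : \sum_(r <- children_localisations ch) (\sum_(t <- localisations c.2)
      K ((false, c.1.2, ell_tree t) :: ell_children r) * dUpsilonT t X X H) *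
      \prod_(c <- r) UpsilonT S c.2 X X =
    \sum_j \sum_i H (idx j + idx i) * \sum_(x <- mark_to_grey (idx j) (idx i) c.2)
      \sum_(r <- children_localisations ((c.1, x) :: ch))
        K (ell_children r) * \prod_(c <- r) UpsilonT S c.2 X X.
    rewrite (eq_bigr _ (fun r _ => congr1 (fun y => y * _) (IH1 r))).
    rewrite (eq_bigr _ (fun r _ => mulr_suml _ _ _ _)) exchange_big.
    apply: eq_bigr => j _.
    rewrite (eq_bigr _ (fun r _ => mulr_suml _ _ _ _)) exchange_big.
    apply: eq_bigr => i _.
    rewrite (eq_bigr _ (fun r _ => esym (mulrA _ _ _))) -mulr_sumr; congr (_ * _).
    rewrite (eq_bigr _ (fun r _ => mulr_suml _ _ _ _)) exchange_big.
    apply: eq_bigr => x _; rewrite big_allpairs_dep exchange_big.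
    apply: eq_bigr => r _; rewrite mulr_suml; apply: eq_bigr => t _.
    by rewrite big_cons mulrA.
  have -> : \sum_(t <- localisations c.2) UpsilonT S t X X *
      \sum_(r <- children_localisations ch)
      K ((false, c.1.2, ell_tree t) :: ell_children r) * dUpsilon_prod r X X H =
    \sum_j \sum_i H (idx j + idx i) *
      \sum_(ch' <- one_child (mark_to_grey (idx j) (idx i)) ch)
      \sum_(r <- children_localisations (c :: ch'))
        K (ell_children r) * \prod_(c <- r) UpsilonT S c.2 X X.
    rewrite (eq_bigr _ (fun t _ => congr1 (fun y => _ * y) (IH2 t))).
    rewrite (eq_bigr _ (fun t _ => mulr_sumr _ _ _ _)) exchange_big.
    apply: eq_bigr => j _.
    rewrite (eq_bigr _ (fun t _ => mulr_sumr _ _ _ _)) exchange_big.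
    apply: eq_bigr => i _.
    rewrite (eq_bigr _ (fun t _ => mulrCA _ _ _)) -mulr_sumr; congr (_ * _).
    rewrite (eq_bigr _ (fun t _ => mulr_sumr _ _ _ _)) exchange_big.
    apply: eq_bigr => ch' _; rewrite big_allpairs_dep.
    apply: eq_bigr => t _; rewrite mulr_sumr; apply: eq_bigr => r _.
    by rewrite big_cons mulrCA.
  rewrite -big_split; apply: eq_bigr => j _; rewrite -big_split; apply: eq_bigr => i _.
  by rewrite /= -mulrDr big_cat !big_map.
rewrite sum_localisations.
have labels' r : node_indices (ell_children r) gr = node_indices r gr.
  by rewrite /node_indices -map_comp.
pose l' := if is_grey_noise l then NoNoise else l.
pose e r q := E (Node l' (q + \sum_(g <- gr) g.2) false r [::]).
have e0 r q : (1 < sdeg q)%N -> e r q = 0.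
  move=> q2; apply: E0; rewrite tame_ell_tree negb_and -leqNgt sdegD.
  by rewrite (leq_trans q2)// leq_addr.
pose K r := \sum_i e r (idx i) * node_val S i (noise_on l) (node_indices r gr) X.
have K0 r : ~~ all (fun c => tame c.2) r -> K r = 0.
  move=> rn; rewrite /K big1// => i _; rewrite /e E0 ?mul0r//.
  by rewrite tame_ell_tree negb_and rn orbT.
transitivity (\sum_(r <- children_localisations ch)
   ((if v then \sum_i e (ell_children r) (idx i) *
       node_dval S i (noise_on l) (node_indices r gr) X H else 0) *
     \prod_(c <- r) UpsilonT S c.2 X X + K (ell_children r) * dUpsilon_prod r X X H)).
  apply: eq_bigr => r _; rewrite /K !mulr_suml.
  have -> : (if v then \sum_i e (ell_children r) (idx i) *
       node_dval S i (noise_on l) (node_indices r gr) X H else 0) =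
    \sum_i e (ell_children r) (idx i) *
      (if v then node_dval S i (noise_on l) (node_indices r gr) X H else 0).
    by case: v => //; rewrite big1// => i _; rewrite mulr0.
  rewrite mulr_suml -big_split; apply: eq_bigr => i _.
  rewrite ell_treeE add0r -/l' dUpsilonTE node_dval_decE if_same total_derivs_idx//.
  rewrite -/(e (ell_children r) (idx i)) labels'.
  by rewrite mulrDr !mulrA.
rewrite big_split /= (children _ K0).
transitivity (\sum_j \sum_i H (idx j + idx i) *
  ((\sum_(x <- (if v then [:: Node l 0 false ch ((idx j, idx i) :: gr)] else [::]))
    \sum_(t <- localisations x) E (ell_tree t) * UpsilonT S t X X) +
  \sum_(ch' <- one_child (mark_to_grey (idx j) (idx i)) ch)
    \sum_(t <- localisations (Node l 0 v ch' gr)) E (ell_tree t) * UpsilonT S t X X)); last first.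
  apply: eq_bigr => j _; apply: eq_bigr => i _; congr (_ * _).
  by rewrite big_cat big_map.
transitivity (\sum_j \sum_i H (idx j + idx i) *
  (\sum_(x <- (if v then [:: Node l 0 false ch ((idx j, idx i) :: gr)] else [::]))
    \sum_(t <- localisations x) E (ell_tree t) * UpsilonT S t X X) +
  \sum_j \sum_i H (idx j + idx i) *
  \sum_(ch' <- one_child (mark_to_grey (idx j) (idx i)) ch)
    \sum_(t <- localisations (Node l 0 v ch' gr)) E (ell_tree t) * UpsilonT S t X X); last first.
  rewrite -big_split; apply: eq_bigr => j _; rewrite -big_split; apply: eq_bigr => i _ /=.
  by rewrite -mulrDr.
congr (_ + _); last first.
  apply: eq_bigr => j _; apply: eq_bigr => i _; congr (_ * _).
  apply: eq_bigr => ch' _; rewrite sum_localisations; apply: eq_bigr => r _.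
  rewrite /K mulr_suml; apply: eq_bigr => m _.
  rewrite ell_treeE add0r -/l' UpsilonTE if_same total_derivs_idx//.
  by rewrite -/(e (ell_children r) (idx m)) labels' mulrA.
(* what is left is the root, where [node_identity] applies *)
case: (v); last first.
  rewrite big1 => [|r _]; last by rewrite mul0r.
  by rewrite big1// => j _; rewrite big1// => i _; rewrite big_nil mulr0.
rewrite (eq_bigr _ (fun r _ => congr1 (fun y => y * _) (node_identity _ _ _ _ (@e0 (ell_children r))))).
rewrite (eq_bigr _ (fun r _ => mulr_suml _ _ _ _)) exchange_big.
apply: eq_bigr => j _.
rewrite (eq_bigr _ (fun r _ => mulr_suml _ _ _ _)) exchange_big.
apply: eq_bigr => i _.
rewrite (eq_bigr _ (fun r _ => esym (mulrA _ _ _))) -mulr_sumr; congr (_ * _).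
rewrite big_seq1 sum_localisations; apply: eq_bigr => r _.
rewrite mulr_suml; apply: eq_bigr => m _.
rewrite ell_treeE add0r -/l' UpsilonTE (total_derivs_idx Ssm) big_cons addrA -/(e (ell_children r) (idx m + idx i)) mulrA.
congr (_ * _ * _); symmetry; apply: node_val_perm.
rewrite /node_indices [X in perm_eq X _]/= -cat_cons perm_catC.
by rewrite [X in perm_eq _ X]/= perm_cons perm_catC.
Qed.

End NodeIdentity.

(** * Derivative of the evaluation map *)

Section Leibniz.
Variables (R : realType) (I : Type).
Implicit Types (E dE : I -> R) (r : seq I).

Fixpoint dprod E dE r : R :=
  if r is i :: r' then dE i * \prod_(j <- r') E j + E i * dprod E dE r' else 0.

End Leibniz.

Section FieldDerivative.
Variables (R : realType) (d : nat).
Local Notation ST := (spacetime R d).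
Local Notation jf := (jetfield R d).
Variable Z : jf.

Lemma gdiff_prod (I : eqType) (r : seq I) (Y dY : I -> jf -> ST -> R) :
  (forall i, i \in r -> gdiff Z (Y i) (dY i)) ->
  gdiff Z (fun W z => \prod_(i <- r) Y i W z)
    (fun H z => dprod (fun i => Y i Z z) (fun i => dY i H z) r).
Proof.
elim: r => [|i r IH] D.
  apply: (@gdiff_ext _ _ _ (fun _ _ => 1) _ (fun _ _ => 0)) => //.
    by move=> W z; rewrite big_nil.
  exact/gdiff_cst/slab_continuous_cst.
have Di := D i (mem_head _ _).
have {}IH : gdiff Z _ _ := IH (fun j jr => D j (@mem_behead _ (i :: r) j jr)).
by apply: gdiff_ext (gdiffM Di IH) => // W z; rewrite big_cons.
Qed.

End FieldDerivative.

Section Derivative.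
Variables (R : realType) (d : nat) (S : setting R d) (eps mu : R).
Hypothesis HS : admissible S.
Hypothesis eps0 : 0 < eps.
Hypothesis mu01 : 0 <= mu <= 1.
Local Notation ST := (spacetime R d).
Local Notation jf := (jetfield R d).
Local Notation edge := (bool * mindex d * tree d)%type.
Implicit Types (s t T : tree d) (ch r : seq edge) (Z Zt H : jf) (z : ST)
  (X Xt : jet R d).

Let Ssm : forall l, smooth_on setT (nonlin S l). Proof. exact: adm_nonlin HS. Qed.

Fixpoint boxed T : bool :=
  let: Node l k v ch gr := T in (sdeg k < 2)%N && all (fun c => boxed c.2) ch.

Lemma boxed_localisations T t : no_poly_dec T -> t \in localisations T -> boxed t.
Proof.
elim/tree_nested_ind: T t => l k v ch gr IH t /andP[/eqP -> chp].
rewrite localisationsE => /allpairsP[[r i] [/= rch _ ->]] /=.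
rewrite add0r sdeg_idx /=.
elim: ch r IH chp rch => [r _ _|c ch IHch r [IHc /IHch {}IHch] /andP[cp /IHch {}IHch]].
  by rewrite /= mem_seq1 => /eqP ->.
by move=> /allpairsP[[t' r'] [/= tc /IHch rr ->]] /=; rewrite rr andbT; exact: IHc.
Qed.

Lemma tame_localisations T t : t \in localisations T -> tame t -> tame T.
Proof.
elim/tree_nested_ind: T t => l k v ch gr IH t.
rewrite localisationsE => /allpairsP[[r i] [/= rch _ ->]] /= /and3P[h -> rt].
apply/andP; split.
  by apply: leq_ltn_trans h; rewrite -addrA addrCA [leqRHS]sdegD leq_addl.
elim: ch r IH rt rch => [//|c ch IHch r [IHc /IHch {}IHch]] + /allpairsP[[t' r'] [/= tc rr E]].
rewrite E /= => /andP[tt rt].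
by apply/andP; split; [exact: IHc tc tt|exact: IHch rt rr].
Qed.

Lemma tame_ell T : tame T -> tame (ell_tree T).
Proof.
elim/tree_nested_ind: T => l k v ch gr IH; rewrite ell_treeE tame_ell_tree /=.
move=> /and3P[-> _ cht] /=.
by elim: ch IH cht => //= c ch IHch [IHc /IHch {}IHch] /andP[/IHc -> /IHch].
Qed.

Lemma mark_to_grey_wf a j T x : x \in mark_to_grey a j T ->
  left_wf T -> no_poly_dec T -> left_wf x /\ no_poly_dec x.
Proof.
elim/tree_nested_ind: T x => l k v ch gr IH x /=; rewrite mem_cat => /orP[|].
  by case: v => //; rewrite mem_seq1 => /eqP -> /= -> ->.
move=> /mapP[r rch ->] /= chw /andP[-> chp] /=.
elim: ch IH r rch chw chp => //= c ch IHch [IHc /IHch {}IHch] r.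
rewrite mem_cat => /orP[/mapP[t tc ->]|/mapP[r' rr ->]] /=
  /andP[/and3P[-> cn cw] chw] /andP[cp chp].
  have [-> ->] := IHc _ tc cw cp.
  by rewrite (null_mark_to_grey tc) cn chw chp.
by have [-> ->] := IHch _ rr chw chp; rewrite cn cw cp.
Qed.

(** By power counting, this cutoff of [ell] does not change the products of
    counterterms and elementary differentials. *)
Definition tame_ell_val T : R := if tame T then ell S T else 0.

Lemma left_valE T Z Zt z : left_wf T ->
  left_val S Z Zt z T = tame_ell_val (ell_tree T) * UpsilonT S T (Z^~ z) (Zt^~ z).
Proof.
move=> Tw; rewrite /left_val /tame_ell_val.
have lE : ell S (down T) = ell S (ell_tree T) by exact: ell_unmark (adm_ell HS) _.
rewrite lE; case: ifP => // /negP Tn; rewrite mul0r; apply/eqP/negPn/negP => h.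
by apply/Tn/tame_ell; apply: (tame_of_nonzero HS Tw); rewrite lE; exact: h.
Qed.

Lemma located_valE T Z Zt z : left_wf T -> no_poly_dec T ->
  located_val S Z Zt z T =
  \sum_(t <- localisations T) tame_ell_val (ell_tree t) * UpsilonT S t (Z^~ z) (Zt^~ z).
Proof.
move=> Tw Tp; rewrite /located_val !big_seq; apply: eq_bigr => t /mem_localisations[_ _ tw].
exact/left_valE/tw.
Qed.

Definition dlocated_val Z Zt H z T : R :=
  \sum_(t <- localisations T) tame_ell_val (ell_tree t) *
    dUpsilonT S t (Z^~ z) (Zt^~ z) (H^~ z).

(** The derivative along [H] of the factor of an extracted tree is the sum over the
    trees that root extraction yields after a grafting on one of its nodes. *)
Lemma dlocated_mark_to_grey T Z H z : left_wf T -> no_poly_dec T ->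
  dlocated_val Z Z H z T =
  \sum_j \sum_i H (idx j + idx i) z *
    \sum_(x <- mark_to_grey (idx j) (idx i) T) located_val S Z Z z x.
Proof.
move=> Tw Tp; rewrite /dlocated_val.
rewrite (@mark_to_grey_localisations _ _ _ Ssm (Z^~ z) (H^~ z) _ Tp tame_ell_val); last first.
  by move=> t /negbTE tn; rewrite /tame_ell_val tn.
apply: eq_bigr => j _; apply: eq_bigr => i _; congr (_ * _).
rewrite !big_seq; apply: eq_bigr => x xT.
by have [xw xp] := mark_to_grey_wf xT Tw Tp; rewrite located_valE.
Qed.

Lemma located_not_tame T Z Zt z : left_wf T -> no_poly_dec T -> ~~ tame T ->
  located_val S Z Zt z T = 0.
Proof.
move=> Tw Tp Tn; rewrite /located_val big_seq big1// => t tT.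
apply/eqP/negPn/negP => h; have [_ _ tw] := mem_localisations tT.
by move: Tn => /negP; apply; exact: tame_localisations tT (tame_of_nonzero HS (tw Tw Tp) h).
Qed.

Lemma dUpsilon_prodE ch X Xt (H : mindex d -> R) : dUpsilon_prod S ch X Xt H =
  dprod (fun c : edge => UpsilonT S c.2 X Xt) (fun c : edge => dUpsilonT S c.2 X Xt H) ch.
Proof. by elim: ch => //= c ch ->. Qed.

End Derivative.

Section FunctionalDerivative.
Variables (R : realType) (d : nat) (S : setting R d) (eps mu : R).
Hypothesis HS : admissible S.
Hypothesis eps0 : 0 < eps.

Local Notation ST := (spacetime R d).
Local Notation jf := (jetfield R d).
Local Notation edge := (bool * mindex d * tree d)%type.
Implicit Types (s t T : tree d) (ch r : seq edge) (c e : edge) (Z Zt H : jf) (z : ST).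

Let Ssm : forall l, smooth_on setT (nonlin S l). Proof. exact: adm_nonlin HS. Qed.

Section AtFields.
Variables Z Zt : jf.
Hypotheses (Zc : slab_field Z) (Ztc : slab_field Zt).

Lemma gdiff_UpsilonT T : boxed T ->
  gdiff Z (fun W z => UpsilonT S T (W^~ z) (Zt^~ z))
    (fun H z => dUpsilonT S T (Z^~ z) (Zt^~ z) (H^~ z)).
Proof.
elim/tree_nested_ind: T => l k v ch gr IH /andP[/sdeg_lt2P[i ->] chb].
set bs := node_indices ch gr.
have D1 : gdiff Z (fun W z => node_val S i (noise_on l) bs (if v then W^~ z else Zt^~ z))
    (fun H z => if v then node_dval S i (noise_on l) bs (Z^~ z) (H^~ z) else 0).
  case: (v); first exact: gdiff_node_val.
  exact: gdiff_cst (gd_val (gdiff_node_val Ssm i (noise_on l) bs Ztc)).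
have Dc c : c \in ch -> gdiff Z (fun W z => UpsilonT S c.2 (W^~ z) (Zt^~ z))
    (fun H z => dUpsilonT S c.2 (Z^~ z) (Zt^~ z) (H^~ z)).
  elim: (ch) IH chb => // c' ch' IHch [IHc /IHch {}IHch] /= /andP[/IHc {}IHc /IHch {}IHch].
  by rewrite in_cons => /orP[/eqP ->|].
have DM := gdiffM D1 (gdiff_prod Dc).
apply: gdiff_ext DM => [W z|H z].
  by rewrite UpsilonTE total_derivs_idx.
rewrite dUpsilonTE dUpsilon_prodE node_dval_decE total_derivs_idx//.
Qed.

Lemma gdiff_located_val T : left_wf T -> no_poly_dec T ->
  gdiff Z (fun W z => located_val S W Zt z T) (fun H z => dlocated_val S Z Zt H z T).
Proof.
move=> Tw Tp.
have D t : t \in localisations T ->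
    gdiff Z (fun W z => tame_ell_val S (ell_tree t) * UpsilonT S t (W^~ z) (Zt^~ z))
      (fun H z => tame_ell_val S (ell_tree t) * dUpsilonT S t (Z^~ z) (Zt^~ z) (H^~ z)).
  move=> tT; have c0 := @slab_continuous_cst R d (tame_ell_val S (ell_tree t)).
  have := gdiffM (gdiff_cst Z c0) (gdiff_UpsilonT (boxed_localisations Tp tT)).
  by apply: gdiff_ext => // H z; rewrite mul0r add0r.
by apply: gdiff_ext (gdiff_sum D) => W z //; rewrite located_valE.
Qed.

Lemma noise_continuous : slab_continuous (noise S eps).
Proof.
have [nc np] := adm_noise HS eps0; apply: (slab_continuous_ext _ np) => // z.
exact: (nc [::] z I).1.
Qed.

(** The kernel of [I'_b] vanishes near time zero and is integrable for all [b]; for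
    [I_b] the singularity of the Green kernel limits [b]. *)
Lemma edge_op_good b a : b || (sdeg a < 2)%N -> good_op (edge_op S mu b a).
Proof.
case: b => /= [_|/sdeg_lt2P[i ->]]; last exact: conv_good (green_cutoff_kernel mu HS i).
have [h1 h2 [C C0 h3]] := conv_good (pder_dGmu_kernel mu HS a).
split.
- move=> f fc; rewrite /edge_op.
  have -> : (fun z => - conv (pder a (dGmu S mu)) f z) =
    fun z => (-1) * conv (pder a (dGmu S mu)) f z by apply/funext => z; rewrite mulN1r.
  by apply: slab_continuousM; [exact: slab_continuous_cst|exact: h1].
- by move=> c f1 f2 z c1 c2 zs; rewrite /edge_op h2// opprD mulrN.
- by exists C => // f m fc fm z zs; rewrite /edge_op normrN; exact: h3.
Qed.

End AtFields.

Definition children t : seq edge := let: Node l k v ch gr := t in ch.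

Lemma children_mul s t : children (tree_mul s t) = children s ++ children t.
Proof. by case: s; case: t. Qed.

Lemma extractions_wf t : plain t -> forall p, p \in extractions t ->
  left_wf p.1 /\ no_poly_dec p.1.
Proof.
elim/tree_nested_ind: t => l k v ch gr IH /and4P[lg /eqP k0 gr0 chp]; rewrite extractionsE.
elim: ch IH chp => [_ _ p|c ch IHch [IHc /IHch {}IHch] /= /andP[cp /IHch {}IHch] p].
  rewrite /= /root_terms /mul_terms /= cats0 => /mapP[q + ->]; rewrite k0.
  by case: l lg => //= _; rewrite !inE; do ?[case/orP]; move=> /eqP -> /=; rewrite addr0 eqxx.
move=> /allpairsP[[e q] [/= ec /IHch[w1 w2] ->]] /=.
suff [e1 e2] : left_wf e.1 /\ no_poly_dec e.1.
  by split; [rewrite left_wf_mul e1|exact: no_poly_dec_mul].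
move: ec; rewrite mem_cat => /orP[|/mapP[i _ ->]]; last by rewrite /= eqxx.
rewrite /keep_terms; case: c.1.1 => // /mapP[q' + ->].
rewrite mem_filter => /andP[nn /(IHc cp)[h1 h2]].
by rewrite left_wf_planted nn h1 /= h2 eqxx.
Qed.

(** The last condition is what makes the edges of the right component act as
    bounded operators; the height allows an induction on [t]. *)
Lemma extractions_children t : plain t -> forall p, p \in extractions t ->
  forall e, e \in children p.2 ->
  [/\ plain e.2, (height e.2 < height t)%N & tame p.1 -> e.1.1 || (sdeg e.1.2 < 2)%N].
Proof.
elim/tree_nested_ind: t => l k v ch gr IH /and4P[lg /eqP k0 gr0 chp]; rewrite extractionsE.
rewrite [height _]/=.
elim: ch IH chp => [_ _ p|c ch IHch [IHc /IHch {}IHch] /= /andP[cp /IHch {}IHch] p].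
  rewrite /= /root_terms /mul_terms /= cats0 => /mapP[q + ->].
  by case: l lg => //= _; rewrite !inE; do ?[case/orP]; move=> /eqP -> /=.
move=> /allpairsP[[w q] [/= wc /IHch {}IHch ->]] e.
rewrite [(_, _).2]/= children_mul mem_cat => /orP[ew|/IHch[h1 h2 h3]]; last first.
  split=> //; first by rewrite (leq_trans h2)// ltnS leq_maxr.
  by move=> /tame_mul[_ /h3].
suff [h1 h2 h3] : [/\ plain e.2, (height e.2 <= height c.2)%N &
    tame w.1 -> e.1.1 || (sdeg e.1.2 < 2)%N].
  split=> //; first by rewrite ltnS (leq_trans h2)// leq_maxl.
  by move=> /tame_mul[/h3].
move: wc ew; rewrite mem_cat => /orP[|/mapP[i _ ->]]; last first.
  rewrite /= mem_seq1 => /eqP -> /=; split=> //.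
  by move=> /andP[_ /andP[/andP[h _] _]]; rewrite h orbT.
rewrite /keep_terms; case: c.1.1 => // /mapP[q' + ->].
rewrite mem_filter => /andP[nn q'c] /(IHc cp _ q'c)[h1 h2 h3].
by split=> //; [exact: ltnW|rewrite /= andbT => /andP[_ /h3]].
Qed.

(** Derivative of [PiTilde S eps mu t] in its first argument at [(Z, Zt)], for
    trees [t] of height at most [n]. *)
Fixpoint dPiTilde Z Zt n t H : ST -> R := fun z =>
  if n is m.+1 then
    \sum_(p <- [seq p <- extractions t | tame p.1])
      (dlocated_val S Z Zt H z p.1 * prod_val (noise S eps z) (edge_val S eps mu Z Zt z) p.2 +
       located_val S Z Zt z p.1 *
       ((if is_noise (root_noise p.2) then noise S eps z else 1) *
        dprod (edge_val S eps mu Z Zt z)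
          (fun e => edge_op S mu e.1.1 e.1.2 (dPiTilde Z Zt m e.2 H) z) (children p.2)))
  else 0.

Lemma PiTilde_tame t Z Zt z : plain t ->
  PiTilde S eps mu t Z Zt z =
  \sum_(p <- [seq p <- extractions t | tame p.1]) located_val S Z Zt z p.1 *
    prod_val (noise S eps z) (edge_val S eps mu Z Zt z) p.2.
Proof.
move=> tp; rewrite PiTildeE'// big_filter big_mkcond /eval_terms !big_seq.
apply: eq_bigr => p pt; case: ifP => // /negbT pn.
by have [w1 w2] := extractions_wf tp pt; rewrite located_not_tame// mul0r.
Qed.

(** Each factor in the expansion over tame extracted trees is differentiable, by
    induction on the height for those under an edge. *)
Lemma gdiff_PiTilde Z Zt : slab_field Z -> slab_field Zt -> forall n t,
  plain t -> (height t <= n)%N ->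
  gdiff Z (fun W => PiTilde S eps mu t W Zt) (dPiTilde Z Zt n t).
Proof.
move=> Zc Ztc; elim=> [|n IH] t tp tn; first by case: t tp tn.
have D p : p \in [seq p <- extractions t | tame p.1] ->
  gdiff Z (fun W z => located_val S W Zt z p.1 *
      prod_val (noise S eps z) (edge_val S eps mu W Zt z) p.2)
    (fun H z => dlocated_val S Z Zt H z p.1 * prod_val (noise S eps z) (edge_val S eps mu Z Zt z) p.2 +
       located_val S Z Zt z p.1 *
       ((if is_noise (root_noise p.2) then noise S eps z else 1) *
        dprod (edge_val S eps mu Z Zt z)
          (fun e => edge_op S mu e.1.1 e.1.2 (dPiTilde Z Zt n e.2 H) z) (children p.2))).
  rewrite mem_filter => /andP[ptame pt].
  have [w1 w2] := extractions_wf tp pt.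
  apply: (gdiffM (gdiff_located_val Zc Ztc w1 w2)).
  have De e : e \in children p.2 -> gdiff Z (fun W z => edge_val S eps mu W Zt z e)
      (fun H z => edge_op S mu e.1.1 e.1.2 (dPiTilde Z Zt n e.2 H) z).
    move=> ep; have [h1 h2 h3] := extractions_children tp pt ep.
    apply: (gdiff_op (edge_op_good (h3 ptame))); apply: IH => //.
    by rewrite -ltnS (leq_trans h2).
  have nc : slab_continuous (fun z => if is_noise (root_noise p.2) then noise S eps z else 1).
    case: (is_noise _); [exact: noise_continuous|exact: slab_continuous_cst].
  apply: gdiff_ext (gdiffM (gdiff_cst Z nc) (gdiff_prod De)) => [W z|H z].
    by case: (p.2).
  by rewrite mul0r add0r.
apply: gdiff_ext (gdiff_sum D) => [W z|//].
by rewrite PiTilde_tame.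
Qed.

Lemma PiTilde_continuous Z Zt t : slab_field Z -> slab_field Zt -> plain t ->
  slab_continuous (PiTilde S eps mu t Z Zt).
Proof. by move=> Zc Ztc tp; exact: gd_val (gdiff_PiTilde Zc Ztc tp (leqnn _)). Qed.

End FunctionalDerivative.

(** * Grafting is differentiation *)

Section GraftIsDerivative.
Variables (R : realType) (d : nat) (S : setting R d) (eps mu : R).
Hypothesis HS : admissible S.
Hypothesis eps0 : 0 < eps.
Local Notation ST := (spacetime R d).
Local Notation jf := (jetfield R d).
Local Notation edge := (bool * mindex d * tree d)%type.
Implicit Types (s t T : tree d) (ch r : seq edge) (c e : edge) (Z Zt H : jf) (z : ST).

Lemma sum_one_child (E : edge -> R) f ch :
  \sum_(r <- one_child f ch) \prod_(c <- r) E c =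
  dprod E (fun c => \sum_(t <- f c.2) E (c.1, t)) ch.
Proof.
elim: ch => [|c ch IH]; first by rewrite big_nil.
rewrite big_cat !big_map [RHS]/= -IH mulr_suml mulr_sumr.
by congr (_ + _); apply: eq_bigr => r _; rewrite big_cons.
Qed.

Lemma dprod_sum (E : edge -> R) (J : Type) (js : seq J) (dE : J -> edge -> R) ch :
  \sum_(j <- js) dprod E (dE j) ch = dprod E (fun c => \sum_(j <- js) dE j c) ch.
Proof.
elim: ch => [|c ch IH] /=; first by rewrite big1.
by rewrite big_split /= -mulr_suml -mulr_sumr IH.
Qed.

Lemma eq_dprod (E dE dE' : edge -> R) ch : {in ch, dE =1 dE'} ->
  dprod E dE ch = dprod E dE' ch.
Proof.
elim: ch => //= c ch IH H; rewrite H ?mem_head// IH// => e ech.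
by apply: H; rewrite in_cons ech orbT.
Qed.

Lemma mark_to_grey_tame a j T x : x \in mark_to_grey a j T -> tame x -> tame T.
Proof.
elim/tree_nested_ind: T x => l k v ch gr IH x /=; rewrite mem_cat => /orP[|].
  case: v => //; rewrite mem_seq1 => /eqP -> /= /and3P[h /andP[_ ->] ->].
  rewrite !andbT; apply: leq_ltn_trans h.
  by rewrite big_cons addrCA [leqRHS]sdegD leq_addl.
move=> /mapP[r rch ->] /= /and3P[-> -> rt] /=.
elim: ch IH r rch rt => //= c ch IHch [IHc /IHch {}IHch] r.
rewrite mem_cat => /orP[/mapP[t tc ->]|/mapP[r' rr ->]] /= /andP[h1 h2].
  by rewrite h2 andbT; exact: IHc tc h1.
by rewrite h1; exact: IHch rr h2.
Qed.

Lemma prod_val_children xi (E : edge -> R) t :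
  prod_val xi E t = (if is_noise (root_noise t) then xi else 1) * \prod_(c <- children t) E c.
Proof. by case: t. Qed.

Lemma dprod_val_children xi (E : edge -> R) f t :
  dprod_val xi E f t = (if is_noise (root_noise t) then xi else 1) *
    dprod E (fun c => \sum_(t <- f c.2) E (c.1, t)) (children t).
Proof.
case: t => l k v ch gr; rewrite /dprod_val big_map -sum_one_child mulr_sumr.
by apply: eq_bigr.
Qed.

(** The Leibniz formula for [PiTilde] against [graft_extractions]: the hypothesis
    on [H] compares the terms where an extracted tree is differentiated, and
    induction those where a subtree under an edge is.  The list [A] is general
    because the lemma serves twice: with all the [idx j] for the derivative, and
    with one index of larger degree and [H = 0] to show that the graftings along
    this index cancel. *)
Lemma dPiTilde_grafts Z s (A : seq (mindex d)) H :
  slab_field Z -> plain s -> ~~ null_planted s -> slab_field H ->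
  (forall T z, left_wf T -> no_poly_dec T -> slab R d z ->
    dlocated_val S Z Z H z T =
    \sum_(a <- A) dgrey (edge_val S eps mu Z Z z) a s (located_val S Z Z z) T) ->
  forall n t, plain t -> (height t <= n)%N -> forall z, slab R d z ->
  dPiTilde S eps mu Z Z n t H z =
  \sum_(a <- A) \sum_(x <- graft a s t) PiTilde S eps mu x Z Z z.
Proof.
move=> Zc sp sn Hc HT.
elim=> [|n IH] t tp tn z zs; first by case: t tp tn.
set E := edge_val S eps mu Z Z z; set xi := noise S eps z.
set W := located_val S Z Z z.
have -> : \sum_(a <- A) \sum_(x <- graft a s t) PiTilde S eps mu x Z Z z =
    \sum_(a <- A) deval_terms xi E a s (dgrey E a s) W (extractions t).
  apply: eq_bigr => a _; rewrite -(graft_extractions xi E a sn sp tp) !big_seq.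
  by apply: eq_bigr => x /(plain_graft sp tp) xp; rewrite PiTildeE'.
rewrite /deval_terms exchange_big [LHS]big_filter big_mkcond [LHS]big_seq [RHS]big_seq.
apply: eq_bigr => p pt; have [w1 w2] := extractions_wf tp pt.
rewrite big_split /= -mulr_suml -mulr_sumr; case: ifP => [ptame|/negbT pn]; last first.
  rewrite [W p.1](located_not_tame HS)// mul0r addr0 big1 ?mul0r// => a _.
  rewrite /dgrey big1// => i _; rewrite big_seq big1 ?mulr0// => x xp.
  have [x1 x2] := mark_to_grey_wf xp w1 w2.
  rewrite /W located_not_tame//; apply: contra pn; exact: mark_to_grey_tame xp.
congr (_ * _ + _ * _); first exact: HT.
have -> : \sum_(a <- A) dprod_val xi E (graft a s) p.2 = \sum_(a <- A)
    (if is_noise (root_noise p.2) then xi else 1) *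
    dprod E (fun c => \sum_(x <- graft a s c.2) E (c.1, x)) (children p.2).
  by apply: eq_bigr => a _; exact: dprod_val_children.
rewrite -mulr_sumr dprod_sum; congr (_ * _).
apply: eq_dprod => e ep; have [h1 h2 h3] := extractions_children tp pt ep.
have eg := edge_op_good mu HS (h3 ptame).
pose xs := [seq x | a <- A, x <- graft a s e.2].
have xsp x : x \in xs -> slab_continuous (PiTilde S eps mu x Z Z).
  by move=> /allpairsPdep[a [y [_ yg ->]]]; apply: PiTilde_continuous => //; exact: plain_graft yg.
have en : (height e.2 <= n)%N by rewrite -ltnS (leq_trans h2).
transitivity (edge_op S mu e.1.1 e.1.2 (fun w => \sum_(x <- xs) PiTilde S eps mu x Z Z w) z).
  apply: (good_ext eg) => //.
  - exact: gd_cont (gdiff_PiTilde mu HS eps0 Zc Zc h1 en) _ Hc.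
  - exact: slab_continuous_sum xsp.
  - by move=> w ws; apply: etrans (IH _ h1 en _ ws) _; rewrite big_allpairs_dep.
rewrite (good_sum eg xsp zs) big_allpairs_dep.
by apply: eq_bigr.
Qed.

(** The increment of the fields along which grafting [s] is a derivative. *)
Definition graft_field s Z : jf := fun b => edge_op S mu true b (PiTilde S eps mu s Z Z).

Lemma slab_field_graft s Z : slab_field Z -> plain s -> slab_field (graft_field s Z).
Proof.
move=> Zc sp b; apply: (good_cont (edge_op_good mu HS (isT : true || _))).
exact: PiTilde_continuous.
Qed.

Lemma dPiTilde_graft Z s n t z : slab_field Z -> plain s -> ~~ null_planted s ->
  plain t -> (height t <= n)%N -> slab R d z ->
  dPiTilde S eps mu Z Z n t (graft_field s Z) z =
  \sum_j \sum_(x <- graft (idx j) s t) PiTilde S eps mu x Z Z z.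
Proof.
move=> Zc sp sn tp tn zs.
rewrite (@dPiTilde_grafts _ s [seq idx j | j <- enum 'I_d.+1])//.
- by rewrite big_map big_enum.
- exact: slab_field_graft.
- by move=> T w Tw Tp ws; rewrite (dlocated_mark_to_grey HS)// big_map big_enum.
Qed.

Lemma gdiff_0 Z (Y dY : jf -> ST -> R) z : gdiff Z Y dY -> slab R d z ->
  dY (fun _ _ => 0) z = 0.
Proof.
move=> D zs; have c0 := @slab_continuous_cst R d 0.
rewrite (gd_sum D)//.
rewrite big1// => a _; have [C _ HC] := fd_bound (gd_partial D a).
have b0 : slab_bounded 0 ((fun=> 0) : ST -> R) by move=> w _; rewrite normr0.
by have := HC _ _ c0 b0 z zs; rewrite mulr0 normr_le0 => /eqP.
Qed.

(** Such a grafting leaves a grey edge that is not tame. *)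
Lemma graft_sum_out Z s t a z : slab_field Z -> plain s -> ~~ null_planted s ->
  plain t -> (1 < sdeg a)%N -> slab R d z ->
  \sum_(x <- graft a s t) PiTilde S eps mu x Z Z z = 0.
Proof.
move=> Zc sp sn tp a2 zs.
have c0 : slab_field ((fun _ _ => 0) : jf) by move=> b; exact: slab_continuous_cst.
have := gdiff_0 (gdiff_PiTilde mu HS eps0 Zc Zc tp (leqnn _)) zs.
rewrite (@dPiTilde_grafts _ s [:: a])//; first by rewrite big_seq1.
move=> T w Tw Tp ws; rewrite big_seq1 (dlocated_mark_to_grey HS)//.
rewrite big1 => [|j _]; last by rewrite big1// => i _; rewrite mul0r.
rewrite /dgrey big1// => i _; rewrite big_seq big1 ?mulr0// => x xT.
have [x1 x2] := mark_to_grey_wf xT Tw Tp; rewrite (located_not_tame HS)//.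
elim/tree_nested_ind: T x xT {Tw Tp x1 x2} => l k v ch gr IH x /=; rewrite mem_cat => /orP[|].
  case: v => //; rewrite mem_seq1 => /eqP -> /=.
  apply/negP => /and3P[_ /andP[+ _] _].
  by rewrite sdegD ltnNge (leq_trans a2)// leq_addr.
move=> /mapP[r rch ->] /=; rewrite !negb_and.
apply/orP; right; apply/orP; right.
elim: ch IH r rch => //= c ch IHch [IHc /IHch {}IHch] r.
rewrite mem_cat => /orP[/mapP[t' tc ->]|/mapP[r' rr ->]] /=; rewrite negb_and.
  by rewrite (IHc _ tc).
by rewrite (IHch _ rr) orbT.
Qed.

End GraftIsDerivative.

(** * Linear combinations and the operator [B] *)

Section Proposition.
Variables (R : realType) (d : nat) (S : setting R d) (eps mu : R).
Hypothesis HS : admissible S.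
Hypothesis eps0 : 0 < eps.
Local Notation ST := (spacetime R d).
Local Notation jf := (jetfield R d).
Implicit Types (s t T : tree d) (Z Zt H : jf) (z : ST) (sigma tau : lincomb R d).

Lemma plain_in_T0 t : in_T0 t -> plain t.
Proof.
elim/tree_nested_ind: t => l k v ch gr IH /andP[/= /and3P[-> -> cht] /andP[-> chp]] /=.
elim: ch IH cht chp => //= c ch IHch [IHc /IHch {}IHch] /andP[/and3P[_ _ cX] chX] /andP[cp chp].
by rewrite IHch// andbT; apply: IHc; rewrite /in_T0 cX cp.
Qed.

Lemma plain_not_null t : plain t -> ~~ is_bare t -> ~~ null_planted t.
Proof.
move=> tp; rewrite negb_or => tb; apply/andP; split.
  by apply: contra tb; case: t tp => l k v ch gr /= /and4P[-> -> -> _] /and3P[-> _ ->].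
elim/tree_nested_ind: t tp {tb} => l k v ch gr IH /= /and4P[/negbTE -> _ _ chp].
by elim: ch IH chp => //= c ch IHch [IHc /IHch {}IHch] /andP[/IHc/negbTE -> /IHch].
Qed.

Lemma fdiff_good (y L : (ST -> R) -> ST -> R) : fdiff y L -> good_op L.
Proof.
by move=> D; split; [exact: fd_lcont D|exact: fd_lin D|exact: fd_bound D].
Qed.

Lemma slab_field_jet (phi : ST -> R) : smooth_on setT phi -> space_periodic phi ->
  slab_field (jet_of phi).
Proof.
move=> phis phip a; apply: (slab_continuous_ext (g := pder a phi)) => //.
  by move=> z; exact: (smooth_on_pderivs (index_seq a) phis [::] I).1.
exact: space_periodic_pderivs.
Qed.

Definition dPi_lin Z tau H : ST -> R :=
  fun z => \sum_(q <- tau) q.1 * dPiTilde S eps mu Z Z (height q.2) q.2 H z.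

Lemma gdiff_PiTilde_lin Z tau : slab_field Z -> supported (@in_T0 d) tau ->
  gdiff Z (fun W => PiTilde_lin S eps mu tau W Z) (dPi_lin Z tau).
Proof.
move=> Zc tauT; apply: gdiff_sum => q qtau.
have qp : plain q.2 by exact/plain_in_T0/(allP tauT q qtau).
have := gdiffM (gdiff_cst Z (@slab_continuous_cst R d q.1))
  (gdiff_PiTilde mu HS eps0 Zc Zc qp (leqnn _)).
by apply: gdiff_ext => // H z; rewrite mul0r add0r.
Qed.

Lemma edge_op_lin Z b sigma z : slab_field Z -> supported (@in_T0 d) sigma -> slab R d z ->
  edge_op S mu true b (PiTilde_lin S eps mu sigma Z Z) z =
  \sum_(p <- sigma) p.1 * graft_field S eps mu p.2 Z b z.
Proof.
move=> Zc sT zs; have eg := edge_op_good mu HS (isT : true || (sdeg b < 2)%N).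
have pc p : p \in sigma -> slab_continuous (PiTilde S eps mu p.2 Z Z).
  by move=> /(allP sT) pT; apply: PiTilde_continuous => //; exact: plain_in_T0.
rewrite (good_sum eg) => [||//]; last first.
  move=> p ps; apply: slab_continuousM; [exact: slab_continuous_cst|exact: pc].
rewrite !big_seq; apply: eq_bigr => p ps.
by rewrite (good_scale _ eg (pc p ps) zs).
Qed.

(** The increments [H] and [G] are compared on the slab only, so linearity goes
    through the bounded partial derivatives. *)
Lemma gd_linear Z (Y dY : jf -> ST -> R) (r : lincomb R d) (G : R * tree d -> jf) H z :
  gdiff Z Y dY -> slab R d z -> slab_field H ->
  (forall p, p \in r -> slab_field (G p)) ->
  (forall b w, slab R d w -> H b w = \sum_(p <- r) p.1 * G p b w) ->
  dY H z = \sum_(p <- r) p.1 * dY (G p) z.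
Proof.
move=> D zs Hc Gc HG; rewrite (gd_sum D)//.
transitivity (\sum_(b <- box2 d) \sum_(p <- r) p.1 * dY (single b (G p b)) z).
  apply: eq_bigr => b _; have gL := fdiff_good (gd_partial D b).
  have sc p : p \in r -> slab_continuous (fun w => p.1 * G p b w).
    move=> pr; apply: slab_continuousM; [exact: slab_continuous_cst|exact: Gc].
  transitivity (dY (single b (fun w => \sum_(p <- r) p.1 * G p b w)) z).
    by apply: (good_ext gL) => //; [exact: slab_continuous_sum sc|exact: HG].
  rewrite (good_sum gL sc zs) !big_seq; apply: eq_bigr => p pr.
  by rewrite (good_scale _ gL (Gc p pr b) zs).
rewrite exchange_big !big_seq; apply: eq_bigr => p pr.
by rewrite (gd_sum D (Gc p pr) zs) mulr_sumr.
Qed.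

Lemma sum_graft_lin a sigma tau (F : tree d -> R) :
  \sum_(u <- graft_lin a sigma tau) u.1 * F u.2 =
  \sum_(p <- sigma) \sum_(q <- tau) p.1 * q.1 * \sum_(x <- graft a p.2 q.2) F x.
Proof.
rewrite /graft_lin big_flatten big_allpairs_dep; apply: eq_bigr => p _.
by apply: eq_bigr => q _; rewrite big_map mulr_sumr.
Qed.

(** The partial derivatives that make up [B] add up to the total derivative along
    the increment [H] generated by [sigma], which is linear in [sigma]. *)
Lemma B_PiTilde_lin Z sigma tau z : slab_field Z ->
  supported (@in_T0 d) sigma -> supported (fun s => ~~ is_bare s) sigma ->
  supported (@in_T0 d) tau -> slab R d z ->
  B S mu (PiTilde_lin S eps mu sigma) (PiTilde_lin S eps mu tau) Z Z z =
  \sum_(a \in [set: mindex d]) PiTilde_lin S eps mu (graft_lin a sigma tau) Z Z z.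
Proof.
move=> Zc sT sb tT zs.
have D := gdiff_PiTilde_lin Zc tT.
pose H : jf := fun b => edge_op S mu true b (PiTilde_lin S eps mu sigma Z Z).
have Hc : slab_field H.
  move=> b; apply: (good_cont (edge_op_good mu HS (isT : true || _))).
  exact: gd_val (gdiff_PiTilde_lin Zc sT).
have BaE a : Ba S mu a (PiTilde_lin S eps mu sigma) (PiTilde_lin S eps mu tau) Z Z z =
    dPi_lin Z tau (single a (H a)) z.
  exact: (frechet_unique Zc (gd_partial D a) (Hc a) zs).
have pp p : p \in sigma -> plain p.2 by move=> /(allP sT)/plain_in_T0.
have BE : B S mu (PiTilde_lin S eps mu sigma) (PiTilde_lin S eps mu tau) Z Z z =
    dPi_lin Z tau H z.
  rewrite (gd_sum D)// /B (@fsum_seq _ _ (box2 d)) ?undup_uniq//.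
    by apply: eq_bigr => a _; exact: BaE.
  move=> a an; rewrite BaE (gd_sum D)//; last exact/slab_field_single/Hc.
  rewrite big_seq big1// => b bb.
  have -> : single b (single a (H a) b) = fun _ _ => 0.
    do 2 apply/funext => ?; rewrite /single.
    have [ba|_] := eqVneq b a; first by rewrite -ba bb in an.
    by rewrite mul0r mulr0.
  exact: gdiff_0 D zs.
rewrite BE (@gd_linear _ _ _ sigma (fun p => graft_field S eps mu p.2 Z) H z D)//; last 2 first.
- by move=> p ps; apply: slab_field_graft => //; exact: pp.
- by move=> b w ws; exact: edge_op_lin.
have out a : a \notin [seq idx j | j <- enum 'I_d.+1] ->
    PiTilde_lin S eps mu (graft_lin a sigma tau) Z Z z = 0.
  move=> an; rewrite /PiTilde_lin (sum_graft_lin _ _ _ (fun x => PiTilde S eps mu x Z Z z)).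
  rewrite big_seq big1// => p ps; rewrite big_seq big1// => q qt.
  rewrite (graft_sum_out mu HS eps0 Zc (pp p ps)) ?mulr0//.
  - exact: plain_not_null (pp p ps) (allP sb p ps).
  - exact/plain_in_T0/(allP tT q qt).
  - rewrite ltnNge; apply: contra an => /sdeg_lt2P[i ->].
    by rewrite map_f// mem_enum.
rewrite (fsum_seq _ out); last by rewrite map_inj_uniq ?enum_uniq//; exact: idx_inj.
rewrite big_map big_enum /PiTilde_lin.
rewrite (eq_bigr _ (fun j _ => sum_graft_lin (idx j) sigma tau (fun x => PiTilde S eps mu x Z Z z))).
rewrite exchange_big /= !big_seq; apply: eq_bigr => p ps.
rewrite exchange_big /dPi_lin mulr_sumr /= !big_seq; apply: eq_bigr => q qt.
rewrite (dPiTilde_graft mu HS eps0 Zc (pp p ps))//.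
- by rewrite mulrA mulr_sumr.
- exact: plain_not_null (pp p ps) (allP sb p ps).
- exact/plain_in_T0/(allP tT q qt).
Qed.

Lemma extractions_marked t : all_marked t -> forall p, p \in extractions t ->
  all_marked p.1 && all (fun e => all_marked e.2) (children p.2).
Proof.
elim/tree_nested_ind: t => l k v ch gr IH /= /andP[vt chm] p pt.
have mark : root_mark p.1 by rewrite (children_terms_mark pt).
suff below : all (fun c => all_marked c.2) (children p.1) &&
    all (fun e => all_marked e.2) (children p.2).
  by case: p {pt} mark below => -[l' k' v' ch' gr'] /= q -> /andP[-> ->].
elim: ch IH chm p pt {mark} => [_ _ p|c ch IHch [IHc /IHch {}IHch] /= /andP[cm /IHch {}IHch] p].
  rewrite /= /root_terms /mul_terms /= cats0 => /mapP[q + ->].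
  by case: l => /=; rewrite !inE; do ?[case/orP]; move=> /eqP ->.
move=> /allpairsP[[w q] [/= wc /IHch/andP[q1 q2] ->]] /=.
rewrite !children_mul !all_cat q1 q2 !andbT.
move: wc; rewrite mem_cat => /orP[|/mapP[i _ ->]]; last by rewrite /= cm.
rewrite /keep_terms; case: c.1.1 => // /mapP[q' + ->].
by rewrite mem_filter => /andP[nn /(IHc cm)/andP[h1 h2]]; rewrite /= h1 h2.
Qed.

Lemma localisations_marked T t : all_marked T -> t \in localisations T -> all_marked t.
Proof.
elim/tree_nested_ind: T t => l k v ch gr IH t /andP[vt chm].
rewrite localisationsE => /allpairsP[[r i] [/= rch _ ->]] /=; rewrite vt /=.
elim: ch r IH chm rch => [r _ _|c ch IHch r [IHc /IHch {}IHch] /andP[cm /IHch {}IHch]].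
  by rewrite /= mem_seq1 => /eqP ->.
by move=> /allpairsP[[t' r'] [/= tc /IHch rr ->]] /=; rewrite rr andbT; exact: IHc.
Qed.

Lemma UpsilonT_marked T (X Xt Xt' : jet R d) : all_marked T ->
  UpsilonT S T X Xt = UpsilonT S T X Xt'.
Proof.
elim/tree_nested_ind: T => l k v ch gr IH /andP[vt chm]; rewrite !UpsilonTE vt; congr (_ * _).
elim: ch IH chm => [|c ch IHch [IHc /IHch {}IHch] /= /andP[cm chm]]; first by rewrite !big_nil.
by rewrite !big_cons (IHc cm) (IHch chm).
Qed.

(** Extraction and localisation keep the marks, so no factor is evaluated at the
    second family of fields. *)
Lemma PiTilde_marked n t Z Zt Zt' : (height t <= n)%N -> plain t -> all_marked t ->
  PiTilde S eps mu t Z Zt = PiTilde S eps mu t Z Zt'.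
Proof.
elim: n t => [|n IH] t tn tp tm; first by case: t tn {tp tm}.
apply/funext => z; rewrite !PiTildeE'// /eval_terms !big_seq; apply: eq_bigr => p pt.
have /andP[m1 m2] := extractions_marked tm pt; congr (_ * _).
  rewrite /located_val !big_seq; apply: eq_bigr => T /(localisations_marked m1) Tm.
  by rewrite /left_val (UpsilonT_marked _ _ (Zt'^~ z)).
rewrite !prod_val_children !big_seq; congr (_ * _); apply: eq_bigr => e ep.
have [h1 h2 _] := extractions_children tp pt ep.
rewrite /edge_val (IH e.2)//; first by rewrite -ltnS (leq_trans h2).
exact: (allP m2 e ep).
Qed.

Lemma Pi_lin_marked tau : supported (@in_T0star d) tau ->
  Pi_lin S eps mu tau = PiTilde_lin S eps mu tau.
Proof.
move=> tT; do 3 apply/funext => ?; rewrite /Pi_lin /PiTilde_lin !big_seq.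
apply: eq_bigr => q /(allP tT)/andP[qT qm].
by congr (_ * _); congr (_ _); exact: PiTilde_marked (leqnn _) (plain_in_T0 qT) qm.
Qed.

End Proposition.

Theorem proposition4p6 (R : realType) (d : nat) (S : setting R d) (eps mu : R)
    (sigma tau : lincomb R d) :
  admissible S -> 0 < eps -> 0 <= mu <= 1 ->
  supported (@in_T0 d) sigma ->
  (* no bare node, for which [I'_a] is zero by convention *)
  supported (fun s => ~~ is_bare s) sigma ->
  supported (@in_T0 d) tau ->
  (forall (phi : spacetime R d -> R) (z : spacetime R d),
    smooth_on setT phi -> space_periodic phi -> slab R d z ->
    at_fields (B S mu (PiTilde_lin S eps mu sigma) (PiTilde_lin S eps mu tau))
      phi phi z =
    \sum_(a \in [set: mindex d])
      at_fields (PiTilde_lin S eps mu (graft_lin a sigma tau)) phi phi z)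
  /\
  (supported (@in_T0star d) tau ->
   forall (phi : spacetime R d -> R) (z : spacetime R d),
    smooth_on setT phi -> space_periodic phi -> slab R d z ->
    at_fields (B S mu (Pi_lin S eps mu sigma) (Pi_lin S eps mu tau)) phi phi z =
    \sum_(a \in [set: mindex d])
      at_fields (Pi_lin S eps mu (graft_lin a sigma tau)) phi phi z).
Proof.
move=> HS eps0 _ sT sb tT; split=> [|tm] phi z phis phip zs.
  exact: (B_PiTilde_lin mu HS eps0 (slab_field_jet phis phip) sT sb tT zs).
rewrite (Pi_lin_marked eps mu HS tm).
exact: (B_PiTilde_lin mu HS eps0 (slab_field_jet phis phip) sT sb tT zs).
Qed.
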